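(* Let $N\ge 2$ be a fixed integer, let $R>0$ be given, and let $$b=\max\left\{\frac{\ln 4}{2\pi},\ \frac{4R\left(\sqrt{\pi}+\sqrt{2\pi}+24\pi^2R\exp(2\pi^{3/2}R)\right)}{\sqrt[N]{8^N+3^{N-1}}-8}\right\}.$$ Then there is a constant $A_R>0$ depending only on $R$ such that, for any two potentials $\mathrm q=[q_j]_{j=1}^N$ and $\tilde{\mathrm q}=[\tilde q_j]_{j=1}^N$ on the star-graph satisfying $$\omega_j=\tilde\omega_j,\quad j=1,\dots,N,\qquad \|\mathrm q\|<R,\qquad \|\tilde{\mathrm q}\|<R,$$ the corresponding Weyl vectors $\mathrm M$, $\tilde{\mathrm M}$ satisfy $$\|\mathrm q-\tilde{\mathrm q}\|\le A_R\,\|\mathrm M-\tilde{\mathrm M}\|_{L_2(\mathbb R+ib)}.$$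
   Context: Star-graph with $N$ edges of length $\pi$ ($N\ge2$ fixed). A potential is a vector function $\mathrm q=[q_j]_{j=1}^N$ with complex-valued $q_j\in L_2(0,\pi)$, with norm $\|\mathrm q\|=\max_{1\le j\le N}\|q_j\|_{L_2(0,\pi)}$. Put $\omega_j=\frac12\int_0^\pi q_j(t)\,dt$. For $\lambda\in\mathbb C$ consider the system $$-y_j''(x)+q_j(x)y_j(x)=\lambda y_j(x),\quad x\in(0,\pi),\ j=1,\dots,N,$$ with matching conditions $y_1(0)=y_j(\pi)$ for $j=2,\dots,N$ and $y_1'(0)=\sum_{j=2}^N y_j'(\pi)$. For $k=2,\dots,N$ the Weyl solution $\Phi_k(x,\lambda)=[\Phi_{jk}(x,\lambda)]_{j=1}^N$ is the solution of this system (including the matching conditions) satisfying $\Phi_{1k}(\pi,\lambda)=0$ and $\Phi_{jk}(0,\lambda)=\delta_{jk}$ for $j=2,\dots,N$ ($\delta_{jk}$ is the Kronecker delta). The Weyl functions are $M_k(\lambda)=\Phi_{kk}'(0,\lambda)$ (derivative in $x$), $k=2,\dots,N$; they are meromorphic in $\lambda$. The Weyl vector is $\mathrm M(\lambda)=[M_k(\lambda)]_{k=2}^N$. Objects with a tilde ($\tilde\omega_j$, $\tilde M_k$, $\tilde{\mathrm M}$) are the same objects constructed from $\tilde{\mathrm q}$. For $\tau>0$, $$\|\mathrm M-\tilde{\mathrm M}\|_{L_2(\mathbb R+i\tau)}:=\max_{2\le k\le N}\left(\int_{\mathbb R+i\tau}|M_k(\rho^2)-\tilde M_k(\rho^2)|^2\,d\rho\right)^{1/2}.$$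 *)

(* Defs.v *)
From HB Require Import structures.
From mathcomp Require Import all_boot all_order all_algebra.
From mathcomp Require Import complex.
From mathcomp Require Import all_classical all_reals all_analysis.
Set Implicit Arguments.
Unset Strict Implicit.
Unset Printing Implicit Defensive.
Import Order.TTheory GRing.Theory Num.Theory.
Import numFieldNormedType.Exports.
Local Open Scope classical_set_scope.
Local Open Scope ring_scope.
Local Open Scope complex_scope.

Notation cmod z := (ComplexField.Normc.normc z).

Section ComplexValuedFunctions.
Variable R : realType.
Implicit Types (f df : R -> R[i]) (D : set R).

Definition Cmeasurable_fun D f :=
  measurable_fun D (fun x => complex.Re (f x)) /\
  measurable_fun D (fun x => complex.Im (f x)).

(* The value is +oo when the square of |f| is not integrable on D. *)
Definition L2norm D f : \bar R :=
  ((\int[@lebesgue_measure R]_(x in D) ((cmod (f x)) ^+ 2)%:E) `^ 2^-1)%E.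

Definition L2 D f := Cmeasurable_fun D f /\ (L2norm D f < +oo)%E.

Definition Cintegral D f : R[i] :=
  Rintegral (@lebesgue_measure R) D (fun x => complex.Re (f x)) +i*
  Rintegral (@lebesgue_measure R) D (fun x => complex.Im (f x)).

Definition is_Cderive (x : R) f (l : R[i]) :=
  is_derive x 1 (fun t => complex.Re (f t)) (complex.Re l) /\
  is_derive x 1 (fun t => complex.Im (f t)) (complex.Im l).

Definition abs_continuous (a b : R) f :=
  forall e : R, 0 < e -> exists2 d : R, 0 < d &
    forall (m : nat) (s t : 'I_m -> R),
      (forall i, [/\ a <= s i, s i <= t i & t i <= b]) ->
      trivIset setT (fun i => `]s i, t i[%classic) ->
      \sum_(i < m) (t i - s i) < d ->
      \sum_(i < m) cmod (f (t i) - f (s i)) < e.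

(* Carathéodory solution of - y'' + q y = lam y on (0, pi): y and y' are
   absolutely continuous on [0, pi] and the equation holds almost everywhere.
   The derivative dy = y' is carried along with y, so that dy 0 and dy pi are
   the one-sided derivatives of y at the endpoints. *)
Definition SL_solution (q : R -> R[i]) (lam : R[i]) (y dy : R -> R[i]) :=
  [/\ abs_continuous 0 pi y,
      abs_continuous 0 pi dy,
      forall x, 0 < x < pi -> is_Cderive x y (dy x) &
      {ae @lebesgue_measure R, forall x, 0 < x < pi ->
        exists2 d2y, is_Cderive x dy d2y & - d2y + q x * y x = lam * y x}].

End ComplexValuedFunctions.

(* The star-graph has N = n.+1 edges, indexed by 'I_n.+1: ord0 is edge 1, and
   the indices different from ord0 are the edges 2, ..., N. *)
Section StarGraph.
Variables (R : realType) (n : nat).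
Implicit Types (q : 'I_n.+1 -> R -> R[i]) (k : 'I_n.+1).

Definition potential q := forall j, L2 `]0, pi[ (q j).

Definition potential_norm q : \bar R :=
  \big[maxe/0%E]_(j < n.+1) L2norm `]0, pi[ (q j).

Definition omega q (j : 'I_n.+1) : R[i] := (2^-1)%:C * Cintegral `]0, pi[ (q j).

Definition star_solution q (lam : R[i]) (y dy : 'I_n.+1 -> R -> R[i]) :=
  [/\ forall j, SL_solution (q j) lam (y j) (dy j),
      forall j, j != ord0 -> y ord0 0 = y j pi &
      dy ord0 0 = \sum_(j < n.+1 | j != ord0) dy j pi].

Definition weyl_solution q k (lam : R[i]) (Phi dPhi : 'I_n.+1 -> R -> R[i]) :=
  [/\ star_solution q lam Phi dPhi,
      Phi ord0 pi = 0 &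
      forall j, j != ord0 -> Phi j 0 = (j == k)%:R].

(* M_k(lam) = Phi_kk'(0, lam). The Weyl solution exists and is unique for every
   lam outside the discrete set of eigenvalues (which contains the poles of
   M_k), where the value of this total function is irrelevant. *)
Definition weyl_function q k (lam : R[i]) : R[i] :=
  xget 0 [set m | exists Phi dPhi,
            weyl_solution q k lam Phi dPhi /\ m = dPhi k 0].

Definition weyl_dist q (q' : 'I_n.+1 -> R -> R[i]) (tau : R) : \bar R :=
  \big[maxe/0%E]_(k < n.+1 | k != ord0)
    L2norm setT (fun s : R =>
      weyl_function q k ((s +i* tau) ^+ 2)
      - weyl_function q' k ((s +i* tau) ^+ 2)).

End StarGraph.

Definition line_height (R : realType) (N : nat) (r : R) : R :=
  Num.max
    (ln 4 / (2 * pi))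
    (4 * r * (Num.sqrt pi + Num.sqrt (2 * pi)
              + 24 * pi ^+ 2 * r * expR (2 * pi `^ (3 / 2) * r))
     / ((8 ^+ N + 3 ^+ N.-1) `^ N%:R^-1 - 8)).

(* Main.v *)
(** Write [rho^2] for the spectral parameter.  On [Im rho >= b] a Volterra equation
    gives solutions of the edge equations close to exponentials, hence for each edge
    [e] an explicit solution [phi] of the star whose boundary value at [e] does not
    vanish; the choice of [b] enters here.  The Weyl function is the quotient of the
    boundary derivative and value of [phi].  Summing Wronskians over the edges, the
    difference of two Weyl functions is, up to bounded factors, the function
    [G_e(rho) = sum_j int (q_j - q'_j) phi_j phi'_j].

    [G_e] is reproduced by the Poisson integral on [Im rho >= b], so its L2 norm on
    [Im rho = tau] is at most the one on [Im rho = b] for every [tau > b].  On the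
    line of height [tau], [G_e] is the Fourier transform of a combination of
    translates and reflections of the [q_j - q'_j], weighted by [exp (- 2 tau t)], up
    to an error of order [1 / |rho|].  By a one-sided Plancherel inequality the first
    windows of that combination control the weighted norms of all [q_j - q'_j]; the
    window (0, pi) yields the edges carrying a Weyl function and the window
    (pi, 2 pi) the remaining edge.  The error has a factor [1 / tau] relative to the
    same weighted norms and is absorbed by taking [tau] large. *)
Require Import Defs.
From HB Require Import structures.
From mathcomp Require Import all_boot all_order all_algebra.
From mathcomp Require Import complex.
From mathcomp Require Import all_classical all_reals all_analysis.
From mathcomp Require Import measurable_realfun.
From mathcomp Require Import ring lra.
Set Implicit Arguments.
Unset Strict Implicit.
Unset Printing Implicit Defensive.
Import Order.TTheory GRing.Theory Num.Theory.
Import numFieldNormedType.Exports.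
Local Open Scope classical_set_scope.
Local Open Scope ring_scope.
Local Open Scope complex_scope.

(** * Complex numbers and integrals *)

(** The obstacle is that the error in the Fourier representation of [G_e] is measured by the unknown
    potentials themselves, with a constant that need not be small on [Im rho = b], so Plancherel on
    that line alone does not close the estimate. Raising the line helps because leading term and
    error carry the same weights [exp (- 4 tau d)], with [d] the distance in the graph to the
    boundary vertex of [e], while the integral of [1 / |rho|^2] over the line is only [pi / tau].
    Removing the weights costs a factor [exp (8 pi tau)], which is harmless because [tau] is fixed
    before the potentials. Reproduction by Poisson integrals is not deduced from holomorphy. It is
    verified for exponentials, then carried through sums, products, integrals over a parameter and
    uniform limits, the operations that build [G_e]. The first entry of the maximum defining [b]
    keeps [|exp (2 pi i rho)|] below 1/4, so the leading factors [1 +- exp (2 pi i rho)] stay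
    between 3/4 and 5/4; the second keeps the perturbation of a product of N such factors below
    [(3/4)^N]. *)

Section ComplexModulus.
Variable R : realType.
Implicit Types (x y z : R[i]) (a b : R).

Lemma cReD x y : complex.Re (x + y) = complex.Re x + complex.Re y.
Proof. by case: x y => [? ?] [? ?]. Qed.

Lemma cImD x y : complex.Im (x + y) = complex.Im x + complex.Im y.
Proof. by case: x y => [? ?] [? ?]. Qed.

Lemma cReN x : complex.Re (- x) = - complex.Re x.
Proof. by case: x. Qed.

Lemma cImN x : complex.Im (- x) = - complex.Im x.
Proof. by case: x. Qed.

Lemma cReM x y :
  complex.Re (x * y) = complex.Re x * complex.Re y - complex.Im x * complex.Im y.
Proof. by case: x y => [? ?] [? ?]. Qed.

Lemma cImM x y :
  complex.Im (x * y) = complex.Re x * complex.Im y + complex.Im x * complex.Re y.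
Proof. by case: x y => [? ?] [? ?]. Qed.

Lemma complex_eqP x y :
  complex.Re x = complex.Re y -> complex.Im x = complex.Im y -> x = y.
Proof. by case: x y => [? ?] [? ?] /= -> ->. Qed.

Lemma cmod_sqr z : cmod z ^+ 2 = complex.Re z ^+ 2 + complex.Im z ^+ 2.
Proof. by case: z => a b /=; rewrite sqr_sqrtr // addr_ge0 // sqr_ge0. Qed.

Lemma cmod_ge0 z : 0 <= cmod z.
Proof. by case: z => a b; exact: sqrtr_ge0. Qed.

Lemma cmodM x y : cmod (x * y) = cmod x * cmod y.
Proof. exact: ComplexField.Normc.normcM. Qed.

Lemma cmodV x : cmod x^-1 = (cmod x)^-1.
Proof. exact: ComplexField.Normc.normcV. Qed.

Lemma cmod0 : cmod (0 : R[i]) = 0.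
Proof. by rewrite /= expr0n /= addr0 sqrtr0. Qed.

Lemma cmod1 : cmod (1 : R[i]) = 1.
Proof. by rewrite /= expr0n /= addr0 expr1n sqrtr1. Qed.

Lemma cmodN x : cmod (- x) = cmod x.
Proof. exact: normcN. Qed.

Lemma cmodX x n : cmod (x ^+ n) = cmod x ^+ n.
Proof. by elim: n => [|n IH]; rewrite ?expr0 ?cmod1 // !exprS cmodM IH. Qed.

Lemma ler_cmodD x y : cmod (x + y) <= cmod x + cmod y.
Proof. exact: le_normcD. Qed.

Lemma ler_cmodB x y : cmod (x - y) <= cmod x + cmod y.
Proof. by rewrite -(cmodN y); exact: ler_cmodD. Qed.

Lemma cmod_eq0 x : (cmod x == 0) = (x == 0).
Proof.
apply/eqP/eqP => [/ComplexField.Normc.eq0_normc //|->]; exact: cmod0.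
Qed.

Lemma cmod_gt0 x : (0 < cmod x) = (x != 0).
Proof. by rewrite lt_def cmod_eq0 cmod_ge0 andbT. Qed.

Lemma cmod_real a : cmod a%:C = `|a|.
Proof. by rewrite /= expr0n /= addr0 sqrtr_sqr. Qed.

Lemma cmod_nat n : cmod (n%:R : R[i]) = n%:R.
Proof.
have -> : n%:R = (n%:R : R)%:C :> R[i] by rewrite rmorph_nat.
by rewrite cmod_real normr_nat.
Qed.

Lemma cmod_conj x : cmod (conjc x) = cmod x.
Proof. by case: x => a b /=; rewrite sqrrN. Qed.

Lemma ler_Re_cmod z : `|complex.Re z| <= cmod z.
Proof.
rewrite -ler_sqr ?nnegrE ?cmod_ge0 ?normr_ge0 // cmod_sqr real_normK ?num_real //.
by rewrite lerDl sqr_ge0.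
Qed.

Lemma ler_Im_cmod z : `|complex.Im z| <= cmod z.
Proof.
rewrite -ler_sqr ?nnegrE ?cmod_ge0 ?normr_ge0 // cmod_sqr real_normK ?num_real //.
by rewrite lerDr sqr_ge0.
Qed.

Lemma cmod_le_Re_Im z : cmod z <= `|complex.Re z| + `|complex.Im z|.
Proof.
rewrite -ler_sqr ?nnegrE ?cmod_ge0 ?addr_ge0 ?normr_ge0 // cmod_sqr.
rewrite -[complex.Re z ^+ 2]real_normK ?num_real //.
rewrite -[complex.Im z ^+ 2]real_normK ?num_real //.
have := mulr_ge0 (normr_ge0 (complex.Re z)) (normr_ge0 (complex.Im z)).
by move: `|_| `|_| => u v; nra.
Qed.

Lemma mulc_conj z : z * conjc z = (cmod z ^+ 2)%:C.
Proof. by rewrite cmod_sqr; case: z => a b /=; simpc; congr Complex; ring. Qed.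

Lemma ler_cmod_sum (I : Type) (s : seq I) (P : pred I) (F : I -> R[i]) :
  cmod (\sum_(i <- s | P i) F i) <= \sum_(i <- s | P i) cmod (F i).
Proof.
elim/big_rec2: _ => [|i u v _ uv]; first by rewrite cmod0.
by rewrite (le_trans (ler_cmodD _ _)) // lerD2l.
Qed.

(** Cauchy-Schwarz against the constant 1, by expanding the nonnegative double sum of the
    [(F i - F j) ^+ 2]. *)
Lemma sqr_sum_le (I : finType) (P : pred I) (F : I -> R) :
  (\sum_(i | P i) F i) ^+ 2 <= #|I|%:R * \sum_(i | P i) F i ^+ 2.
Proof.
have H : \sum_(i | P i) \sum_(j | P j) (F i - F j) ^+ 2 >= 0.
  by apply: sumr_ge0 => i _; apply: sumr_ge0 => j _; exact: sqr_ge0.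
have E i : \sum_(j | P j) (F i - F j) ^+ 2 = #|P|%:R * F i ^+ 2
    - 2 * (\sum_(j | P j) F j) * F i + \sum_(j | P j) F j ^+ 2.
  under eq_bigr => j _ do rewrite sqrrB -mulr_natl mulrA.
  by rewrite big_split sumrB /= sumr_const -mulr_natl -mulr_sumr; ring.
have PI : #|P|%:R <= #|I|%:R :> R by rewrite ler_nat max_card.
have Q : 0 <= \sum_(i | P i) F i ^+ 2 by apply: sumr_ge0 => i _; exact: sqr_ge0.
move: H; under eq_bigr do rewrite E.
rewrite big_split sumrB /= sumr_const -!mulr_sumr -mulr_natl.
by have := ler_wpM2r Q PI; nra.
Qed.

End ComplexModulus.

Arguments ComplexField.Normc.normc : simpl never.
Arguments conjc : simpl never.

Section ComplexMeasurable.
Variable R : realType.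

(** Inversion is continuous away from 0 and takes the value 0 there by convention, so it is glued
    from two pieces. *)
Lemma measurable_invr : measurable_fun setT (@GRing.inv R).
Proof.
have -> : @GRing.inv R = fun x => if x == 0 then 0 else x^-1.
  by apply/funext => x; case: eqP => // ->; rewrite invr0.
have m0 : measurable_fun setT (fun x : R => x == 0).
  exact: measurable_fun_eqr.
apply: measurable_fun_if => //.
apply: (@measurable_funS _ _ _ _ [set x : R | x != 0]).
- by apply: open_measurable; exact: open_neq.
- by move=> x /= [_ /negbT].
- apply: open_continuous_measurable_fun; first exact: open_neq.
  by move=> x; rewrite inE /= => x0; exact: inv_continuous.
Qed.

Lemma measurable_sqrtr : measurable_fun setT (@Num.sqrt R).
Proof. by apply: continuous_measurable_fun; exact: sqrt_continuous. Qed.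

Lemma measurable_cos : measurable_fun setT (@cos R).
Proof. by apply: continuous_measurable_fun; exact: continuous_cos. Qed.

Lemma measurable_sin : measurable_fun setT (@sin R).
Proof. by apply: continuous_measurable_fun; exact: continuous_sin. Qed.

Definition cmeas d (T : measurableType d) (f : T -> R[i]) :=
  measurable_fun setT (fun x => complex.Re (f x)) /\
  measurable_fun setT (fun x => complex.Im (f x)).

Section Closure.
Context d (T : measurableType d).
Implicit Types (f g : T -> R[i]) (h k : T -> R).

Lemma cmeas_cst (c : R[i]) : cmeas (fun _ : T => c).
Proof. by split; exact: measurable_cst. Qed.

Lemma cmeas_pair h k : measurable_fun setT h -> measurable_fun setT k ->
  cmeas (fun x => h x +i* k x).
Proof. by []. Qed.

Lemma cmeas_real h : measurable_fun setT h -> cmeas (fun x => (h x)%:C).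
Proof. by split => //; exact: measurable_cst. Qed.

Lemma cmeasD f g : cmeas f -> cmeas g -> cmeas (fun x => f x + g x).
Proof.
move=> [fr fi] [gr gi]; split.
- by under eq_fun do rewrite cReD; exact: measurable_funD.
- by under eq_fun do rewrite cImD; exact: measurable_funD.
Qed.

Lemma cmeasN f : cmeas f -> cmeas (fun x => - f x).
Proof.
move=> [fr fi]; split.
- by under eq_fun do rewrite cReN; exact: measurable_funN.
- by under eq_fun do rewrite cImN; exact: measurable_funN.
Qed.

Lemma cmeasB f g : cmeas f -> cmeas g -> cmeas (fun x => f x - g x).
Proof. by move=> mf mg; apply: cmeasD => //; exact: cmeasN. Qed.

Lemma cmeasM f g : cmeas f -> cmeas g -> cmeas (fun x => f x * g x).
Proof.
move=> [fr fi] [gr gi]; split.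
- by under eq_fun do rewrite cReM; apply: measurable_funB; exact: measurable_funM.
- by under eq_fun do rewrite cImM; apply: measurable_funD; exact: measurable_funM.
Qed.

Lemma cmeasX f n : cmeas f -> cmeas (fun x => f x ^+ n).
Proof.
move=> mf; elim: n => [|n IH]; first exact: cmeas_cst.
by under eq_fun do rewrite exprS; exact: cmeasM.
Qed.

Lemma cmeas_conj f : cmeas f -> cmeas (fun x => (conjc (f x))).
Proof.
move=> [fr fi]; split.
- rewrite (_ : (fun x => _) = (fun x => complex.Re (f x))) //.
  by apply/funext => x; case: (f x).
- rewrite (_ : (fun x => _) = (fun x => - complex.Im (f x))); first exact: measurable_funN.
  by apply/funext => x; case: (f x).
Qed.

Lemma measurable_cmod f : cmeas f -> measurable_fun setT (fun x => cmod (f x)).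
Proof.
move=> [fr fi].
rewrite (_ : (fun x => _) =
  Num.sqrt \o (fun x => complex.Re (f x) ^+ 2 + complex.Im (f x) ^+ 2)); last first.
  by apply/funext => x /=; case: (f x).
apply: measurableT_comp; first exact: measurable_sqrtr.
by apply: measurable_funD; exact: measurable_funX.
Qed.

(** Rests on [z^-1 = conjc z / |z|^2], which with [0^-1 = 0] holds at the zeros of [f] as well. *)
Lemma cmeas_inv f : cmeas f -> cmeas (fun x => (f x)^-1).
Proof.
move=> mf; have [fr fi] := cmeas_conj mf.
have m2 : measurable_fun setT (fun x => (cmod (f x) ^+ 2)^-1).
  apply: (measurableT_comp measurable_invr).
  by apply: measurable_funX; exact: measurable_cmod.
rewrite (_ : (fun x => _) = fun x => (conjc (f x)) * ((cmod (f x) ^+ 2)^-1)%:C).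
  by apply: cmeasM; [exact: cmeas_conj|exact: cmeas_real].
apply/funext => x; have [->|fx0] := eqVneq (f x) 0.
  by rewrite cmod0 expr0n /= !invr0 mulr0.
apply: (mulfI fx0); rewrite mulfV // mulrA mulc_conj -rmorphM /= mulfV //.
by rewrite expf_neq0 // cmod_eq0.
Qed.

Lemma cmeas_sum I (s : seq I) (P : pred I) (F : I -> T -> R[i]) :
  (forall i, P i -> cmeas (F i)) -> cmeas (fun x => \sum_(i <- s | P i) F i x).
Proof.
move=> mF; elim: s => [|i s IH].
  by under eq_fun do rewrite big_nil; exact: cmeas_cst.
under eq_fun do rewrite big_cons.
case Pi: (P i) => //; apply: cmeasD => //; exact: mF.
Qed.

Lemma cmeas_prod I (s : seq I) (P : pred I) (F : I -> T -> R[i]) :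
  (forall i, P i -> cmeas (F i)) -> cmeas (fun x => \prod_(i <- s | P i) F i x).
Proof.
move=> mF; elim: s => [|i s IH].
  by under eq_fun do rewrite big_nil; exact: cmeas_cst.
under eq_fun do rewrite big_cons.
case Pi: (P i) => //; apply: cmeasM => //; exact: mF.
Qed.

Lemma cmeas_if (P : T -> bool) f g : measurable_fun setT P ->
  cmeas f -> cmeas g -> cmeas (fun x => if P x then f x else g x).
Proof.
move=> mP [fr fi] [gr gi]; split.
- rewrite (_ : (fun x => _) =
      fun x => if P x then complex.Re (f x) else complex.Re (g x)).
    exact: measurable_fun_ifT.
  by apply/funext => x; case: (P x).
- rewrite (_ : (fun x => _) =
      fun x => if P x then complex.Im (f x) else complex.Im (g x)).
    exact: measurable_fun_ifT.
  by apply/funext => x; case: (P x).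
Qed.

Lemma cmeas_comp d' (T' : measurableType d') (f : T' -> R[i]) (p : T -> T') :
  cmeas f -> measurable_fun setT p -> cmeas (fun x => f (p x)).
Proof.
by move=> [fr fi] mp; split;
  [exact: (measurableT_comp fr mp)|exact: (measurableT_comp fi mp)].
Qed.

Lemma cmeas_cvg (F : nat -> T -> R[i]) f : (forall n, cmeas (F n)) ->
  (forall x (e : R), 0 < e -> exists N, forall n, (N <= n)%N ->
     cmod (F n x - f x) < e) ->
  cmeas f.
Proof.
move=> mF cF; split.
- apply: (@measurable_fun_cvg _ _ _ _ (fun n x => complex.Re (F n x))).
    by move=> n; have [] := mF n.
  move=> x _; apply/cvgrPdist_lt => e e0.
  have [N HN] := cF x e e0; exists N => //= n /HN; apply: le_lt_trans.
  by rewrite distrC -cReN -cReD; exact: ler_Re_cmod.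
- apply: (@measurable_fun_cvg _ _ _ _ (fun n x => complex.Im (F n x))).
    by move=> n; have [] := mF n.
  move=> x _; apply/cvgrPdist_lt => e e0.
  have [N HN] := cF x e e0; exists N => //= n /HN; apply: le_lt_trans.
  by rewrite distrC -cImN -cImD; exact: ler_Im_cmod.
Qed.

End Closure.

End ComplexMeasurable.

HB.lock Definition rint (R : realType) (h : R -> R) : R :=
  Rintegral (@lebesgue_measure R) setT h.

HB.lock Definition cint (R : realType) (f : R -> R[i]) : R[i] := Cintegral setT f.

Section ComplexIntegral.
Variable R : realType.
Notation mu := (@lebesgue_measure R).
Implicit Types (f g : R -> R[i]) (h k : R -> R).

Definition rintble h := mu.-integrable setT (EFin \o h).

Definition cintble f :=
  rintble (fun x => complex.Re (f x)) /\ rintble (fun x => complex.Im (f x)).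

Lemma Re_cint f : complex.Re (cint f) = rint (fun x => complex.Re (f x)).
Proof. by rewrite cint.unlock rint.unlock. Qed.

Lemma Im_cint f : complex.Im (cint f) = rint (fun x => complex.Im (f x)).
Proof. by rewrite cint.unlock rint.unlock. Qed.

Lemma eq_rint h k : h =1 k -> rint h = rint k.
Proof. by move=> /funext ->. Qed.

Lemma eq_cint f g : f =1 g -> cint f = cint g.
Proof. by move=> /funext ->. Qed.

Lemma rintble_meas h : rintble h -> measurable_fun setT h.
Proof. by move=> /measurable_int /measurable_EFinP. Qed.

Lemma cintble_meas f : cintble f -> cmeas f.
Proof. by move=> [/rintble_meas fr /rintble_meas fi]. Qed.

Lemma rintble_le h k : measurable_fun setT h -> (forall x, `|h x| <= k x) ->
  rintble k -> rintble h.
Proof.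
move=> mh hk; apply: le_integrable => //; first exact/measurable_EFinP.
move=> x _; rewrite /= lee_fin; apply: (le_trans (hk x)); exact: ler_norm.
Qed.

Lemma rintbleD h k : rintble h -> rintble k -> rintble (fun x => h x + k x).
Proof.
move=> ih ik; rewrite /rintble.
rewrite (_ : EFin \o _ = (EFin \o h) \+ (EFin \o k))%E; first exact: integrableD.
by apply/funext => x /=; rewrite EFinD.
Qed.

Lemma rintbleZ (c : R) h : rintble h -> rintble (fun x => c * h x).
Proof.
move=> ih; rewrite /rintble (_ : EFin \o _ = (fun x => c%:E * (EFin \o h) x)%E).
  exact: integrableZl.
by apply/funext => x /=; rewrite EFinM.
Qed.

Lemma rintbleN h : rintble h -> rintble (fun x => - h x).
Proof.
by move=> /(rintbleZ (-1)); under eq_fun do rewrite mulN1r.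
Qed.

Lemma rintble0 : rintble (fun=> 0 : R).
Proof. exact: integrable0. Qed.

Lemma rintD h k : rintble h -> rintble k ->
  rint (fun x => h x + k x) = rint h + rint k.
Proof. by move=> ih ik; rewrite rint.unlock RintegralD. Qed.

Lemma rintZ (c : R) h : rintble h -> rint (fun x => c * h x) = c * rint h.
Proof. by move=> ih; rewrite rint.unlock RintegralZl. Qed.

Lemma rintN h : rintble h -> rint (fun x => - h x) = - rint h.
Proof. by move=> ih; rewrite -mulN1r -rintZ //; congr rint; apply/funext => x; rewrite mulN1r. Qed.

Lemma rintB h k : rintble h -> rintble k ->
  rint (fun x => h x - k x) = rint h - rint k.
Proof. by move=> ih ik; rewrite rintD ?rintN //; exact: rintbleN. Qed.

Lemma ler_rint h k : rintble h -> rintble k -> (forall x, h x <= k x) ->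
  rint h <= rint k.
Proof. by move=> ih ik hk; rewrite rint.unlock; apply: le_Rintegral. Qed.

Lemma rint_ge0 h : (forall x, 0 <= h x) -> 0 <= rint h.
Proof. by move=> h0; rewrite rint.unlock; apply: Rintegral_ge0. Qed.

Lemma rint0 : rint (fun=> 0 : R) = 0.
Proof. by rewrite rint.unlock /Rintegral integral0. Qed.

Lemma rintE h : rintble h -> (\int[mu]_x (h x)%:E)%E = (rint h)%:E.
Proof. by move=> ih; rewrite rint.unlock /Rintegral fineK //; exact: integrable_fin_num. Qed.

Lemma cintble_le f h : cmeas f -> (forall x, cmod (f x) <= h x) ->
  rintble h -> cintble f.
Proof.
move=> [fr fi] fh ih; split; apply: (rintble_le _ _ ih) => // x;
  apply: le_trans (fh x); [exact: ler_Re_cmod|exact: ler_Im_cmod].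
Qed.

Lemma rintble_cmod f : cintble f -> rintble (fun x => cmod (f x)).
Proof.
move=> fi; have mf := cintble_meas fi; case: fi => fr fi.
apply: (@rintble_le _ (fun x => `|complex.Re (f x)| + `|complex.Im (f x)|)).
- exact: measurable_cmod.
- by move=> x; rewrite ger0_norm ?cmod_ge0 // cmod_le_Re_Im.
- by apply: rintbleD; exact: integrable_norm.
Qed.

Lemma cintble0 : cintble (fun=> 0).
Proof. by split; exact: rintble0. Qed.

Lemma cintbleD f g : cintble f -> cintble g -> cintble (fun x => f x + g x).
Proof.
move=> [fr fi] [gr gi]; split.
- by under eq_fun do rewrite cReD; exact: rintbleD.
- by under eq_fun do rewrite cImD; exact: rintbleD.
Qed.

Lemma cintbleMl f g (B : R) : cmeas g -> (forall x, cmod (g x) <= B) ->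
  cintble f -> cintble (fun x => g x * f x).
Proof.
move=> mg gB fi; apply: (@cintble_le _ (fun x => B * cmod (f x))).
- by apply: cmeasM => //; exact: cintble_meas.
- by move=> x; rewrite cmodM ler_wpM2r // cmod_ge0.
- by apply: rintbleZ; exact: rintble_cmod.
Qed.

Lemma cintbleZ (c : R[i]) f : cintble f -> cintble (fun x => c * f x).
Proof. by apply: (@cintbleMl _ _ (cmod c)) => //; exact: cmeas_cst. Qed.

Lemma cintbleN f : cintble f -> cintble (fun x => - f x).
Proof. by move=> /(cintbleZ (-1)); under eq_fun do rewrite mulN1r. Qed.

Lemma cintbleB f g : cintble f -> cintble g -> cintble (fun x => f x - g x).
Proof. by move=> ih ik; apply: cintbleD => //; exact: cintbleN. Qed.

Lemma cintble_sum I (s : seq I) (P : pred I) (F : I -> R -> R[i]) :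
  (forall i, P i -> cintble (F i)) -> cintble (fun x => \sum_(i <- s | P i) F i x).
Proof.
move=> mF; elim: s => [|i s IH].
  by under eq_fun do rewrite big_nil; exact: cintble0.
under eq_fun do rewrite big_cons.
case Pi: (P i) => //; apply: cintbleD => //; exact: mF.
Qed.

Lemma cint0 : cint (fun=> 0 : R[i]) = 0 :> R[i].
Proof. by apply: complex_eqP; rewrite ?Re_cint ?Im_cint rint0. Qed.

Lemma cintD f g : cintble f -> cintble g ->
  cint (fun x => f x + g x) = cint f + cint g.
Proof.
move=> [fr fi] [gr gi]; apply: complex_eqP.
- by rewrite cReD !Re_cint -rintD //; under eq_fun do rewrite cReD.
- by rewrite cImD !Im_cint -rintD //; under eq_fun do rewrite cImD.
Qed.

Lemma cintZ (c : R[i]) f : cintble f -> cint (fun x => c * f x) = c * cint f.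
Proof.
move=> [fr fi]; apply: complex_eqP.
- rewrite cReM !Re_cint Im_cint -!rintZ // -rintB; [|exact: rintbleZ..].
  by under eq_fun do rewrite cReM.
- rewrite cImM !Im_cint Re_cint -!rintZ // -rintD; [|exact: rintbleZ..].
  by under eq_fun do rewrite cImM.
Qed.

Lemma cintN f : cintble f -> cint (fun x => - f x) = - cint f.
Proof. by move=> fi; rewrite -mulN1r -cintZ //; congr cint; apply/funext => x; rewrite mulN1r. Qed.

Lemma cintB f g : cintble f -> cintble g ->
  cint (fun x => f x - g x) = cint f - cint g.
Proof. by move=> ih ik; rewrite cintD ?cintN //; exact: cintbleN. Qed.

Lemma cint_sum I (s : seq I) (P : pred I) (F : I -> R -> R[i]) :
  (forall i, P i -> cintble (F i)) ->
  cint (fun x => \sum_(i <- s | P i) F i x) = \sum_(i <- s | P i) cint (F i).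
Proof.
move=> mF; elim: s => [|i s IH].
  by under eq_fun do rewrite big_nil; rewrite big_nil cint0.
under eq_fun do rewrite big_cons.
rewrite big_cons; case Pi: (P i) => //; rewrite cintD ?IH //; first exact: mF.
by apply: cintble_sum.
Qed.

Lemma cint_conj f : cintble f -> cint (fun x => (conjc (f x))) = (conjc (cint f)).
Proof.
move=> [fr fi]; apply: complex_eqP.
- rewrite [RHS](_ : _ = complex.Re (cint f)); last by case: (cint f).
  rewrite !Re_cint.
  by congr rint; apply/funext => x; case: (f x).
- rewrite [RHS](_ : _ = - complex.Im (cint f)); last by case: (cint f).
  rewrite !Im_cint -rintN //.
  by congr rint; apply/funext => x; case: (f x).
Qed.

Lemma cint_real h : cint (fun x => (h x)%:C) = (rint h)%:C.
Proof. by apply: complex_eqP; rewrite ?Re_cint ?Im_cint //= rint0. Qed.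

(* Rotating the integral onto the positive real axis reduces the bound to real parts. *)
Lemma ler_cmod_cint f h : cintble f -> rintble h ->
  (forall x, cmod (f x) <= h x) -> cmod (cint f) <= rint h.
Proof.
move=> fi ih fh; have [->|I0] := eqVneq (cint f) 0.
  by rewrite cmod0 rint_ge0 // => x; exact: le_trans (cmod_ge0 _) (fh x).
set c := (conjc (cint f)) / (cmod (cint f))%:C.
have n0 : cmod (cint f) != 0 by rewrite cmod_eq0.
have c1 : cmod c = 1.
  by rewrite cmodM cmodV cmod_conj cmod_real ger0_norm ?cmod_ge0 // mulfV.
have cI : c * cint f = (cmod (cint f))%:C.
  rewrite mulrAC [conjc _ * _]mulrC mulc_conj expr2 rmorphM /= mulfK //.
  by apply/eqP => -[/eqP]; apply/negP.
have -> : cmod (cint f) = complex.Re (cint (fun x => c * f x)).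
  by rewrite cintZ // cI.
rewrite Re_cint; apply: ler_rint => // [|x].
  by have [] := cintbleZ c fi.
apply: le_trans (fh x); rewrite -[leRHS]mul1r -c1 -cmodM.
exact: le_trans (ler_norm _) (ler_Re_cmod _).
Qed.

(** Tonelli gives measurability in the parameter for nonnegative functions; it is applied to the
    positive and negative parts, and [fine] takes care of slices whose integral is infinite. *)
Lemma measurable_rint d (T : measurableType d) (F : T * R -> R) :
  measurable_fun setT F -> measurable_fun setT (fun t => rint (fun y => F (t, y))).
Proof.
move=> mF; rewrite (_ : (fun t => _) =
    fine \o ((fubini_F mu ((EFin \o F)^\+)) \- (fubini_F mu ((EFin \o F)^\-)))%E).
  apply: measurableT_comp; first exact: fine_measurable.
  apply: emeasurable_funB.
  - apply: measurable_fun_fubini_tonelli_F => //.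
    by apply: measurable_funepos; exact/measurable_EFinP.
  - apply: measurable_fun_fubini_tonelli_F => //.
    by apply: measurable_funeneg; exact/measurable_EFinP.
apply/funext => t; rewrite rint.unlock /Rintegral integralE /= /fubini_F.
by congr (fine (_ - _)); apply: eq_integral => y _; rewrite ?funeposE ?funenegE.
Qed.

Lemma cmeas_cint d (T : measurableType d) (F : T * R -> R[i]) :
  cmeas F -> cmeas (fun t => cint (fun y => F (t, y))).
Proof.
move=> [Fr Fi]; split.
- by under eq_fun do rewrite Re_cint; exact: (measurable_rint Fr).
- by under eq_fun do rewrite Im_cint; exact: (measurable_rint Fi).
Qed.

(** The product bound makes [F] integrable for the product measure; all double integrals below are
    dominated in this separated form. *)
Lemma rint_swap (F : R * R -> R) h k : measurable_fun setT F ->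
  (forall x y, `|F (x, y)| <= h x * k y) -> rintble h -> rintble k ->
  rint (fun x => rint (fun y => F (x, y))) =
  rint (fun y => rint (fun x => F (x, y))).
Proof.
move=> mF Fhk ih ik.
have mx x : measurable_fun setT (fun y => F (x, y)) by exact: measurableT_comp.
have my y : measurable_fun setT (fun x => F (x, y)) by exact: measurableT_comp.
have ix x : rintble (fun y => F (x, y)).
  by apply: (@rintble_le _ (fun y => h x * k y)) => //; exact: rintbleZ.
have iy y : rintble (fun x => F (x, y)).
  apply: (@rintble_le _ (fun x => k y * h x)) => //; last exact: rintbleZ.
  by move=> x; rewrite mulrC.
have iF : (mu \x mu)%E.-integrable setT (EFin \o F).
  apply/(integrable12ltyP mu mu); first exact/measurable_EFinP.
  apply: (@le_lt_trans _ _ (\int[mu]_x (`|h x| * rint (fun y => `|k y|))%:E)%E).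
    apply: ge0_le_integral => //.
    + by move=> x _; exact: integral_ge0.
    + apply: (@measurable_fun_fubini_tonelli_F _ _ _ _ _ mu (fun z => `|(F z)%:E|%E)) => //.
      by apply/measurable_EFinP; exact: measurableT_comp.
    + apply/measurable_EFinP; apply: measurable_funM => //.
      by apply: measurableT_comp => //; exact: rintble_meas.
    + move=> x _; rewrite EFinM.
      have ik' : rintble (fun y => `|k y|) by exact: integrable_norm.
      rewrite -rintE // -ge0_integralZl //; last first.
        by apply/measurable_EFinP; apply: measurableT_comp => //; exact: rintble_meas.
      apply: ge0_le_integral => //.
      * apply/measurable_EFinP.
        exact: (measurableT_comp (@normr_measurable R setT) (mx x)).
      * apply: measurable_funeM; apply/measurable_EFinP.
        by apply: measurableT_comp => //; exact: rintble_meas.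
      * move=> y _; rewrite -EFinM /= lee_fin -normrM.
        exact: le_trans (Fhk x y) (ler_norm _).
  have : rintble (fun x => rint (fun y => `|k y|) * `|h x|).
    by apply: rintbleZ; exact: integrable_norm.
  under eq_integral do rewrite mulrC.
  by move=> H; rewrite rintE // ltry.
have := Fubini iF.
under eq_integral do rewrite rintE //.
under [X in _ = X -> _]eq_integral do rewrite rintE //.
by rewrite rint.unlock /Rintegral => ->.
Qed.

Lemma cint_swap (F : R * R -> R[i]) h k : cmeas F ->
  (forall x y, cmod (F (x, y)) <= h x * k y) -> rintble h -> rintble k ->
  cint (fun x => cint (fun y => F (x, y))) =
  cint (fun y => cint (fun x => F (x, y))).
Proof.
move=> [Fr Fi] Fhk ih ik; apply: complex_eqP.
- rewrite !Re_cint; under eq_rint do rewrite Re_cint.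
  under [RHS]eq_rint do rewrite Re_cint.
  apply: (rint_swap Fr _ ih ik) => x y.
  exact: le_trans (ler_Re_cmod _) (Fhk x y).
- rewrite !Im_cint; under eq_rint do rewrite Im_cint.
  under [RHS]eq_rint do rewrite Im_cint.
  apply: (rint_swap Fi _ ih ik) => x y.
  exact: le_trans (ler_Im_cmod _) (Fhk x y).
Qed.

End ComplexIntegral.

Section AffineChangeOfVariable.
Variable R : realType.
Notation mu := (@lebesgue_measure R).

Definition affine_map (a b : R) (x : R) : R := a * x + b.

Lemma measurable_affine_map a b : measurable_fun setT (affine_map a b).
Proof.
by rewrite /affine_map; apply: measurable_funD.
Qed.

(** Both sides are measures that agree on half-open intervals, where uniqueness of Lebesgue measure
    applies. For [a < 0] the preimage is closed on the other side, which does not change its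
    length. *)
Lemma lebesgue_measure_affine (a b : R) (A : set R) : a != 0 -> measurable A ->
  mu A = (`|a|%:E * mu (affine_map a b @^-1` A))%E.
Proof.
move=> a0 mA.
have na : 0 <= `|a| by [].
apply: (@lebesgue_measure_unique _
  (mscale (NngNum na) (pushforward mu (affine_map a b : _ -> measurableTypeR R)))) => //=.
  exact: measurable_affine_map.
move=> ? _ [[u v]] _ <- /=.
rewrite /mscale /= /pushforward.
have [apos|aneg] : 0 < a \/ a < 0.
  by case: (ltgtP a 0) a0 => // *; [right|left].
- have -> : affine_map a b @^-1` `]u, v] = `](u - b) / a, (v - b) / a]%classic.
    apply/seteqP; split => x /=; rewrite !in_itv /= /affine_map.
      by rewrite ltr_pdivrMr // ler_pdivlMr // mulrC ltrBlDr lerBrDr.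
    by rewrite ltr_pdivrMr // ler_pdivlMr // mulrC ltrBlDr lerBrDr.
  rewrite !lebesgue_measure_itv /= !lte_fin ltr_pM2r ?invr_gt0 // ltrD2r.
  case: ifP => _; last by rewrite mule0.
  rewrite -!EFinB -EFinM gtr0_norm //; congr EFin.
  by field.
- have -> : affine_map a b @^-1` `]u, v] = `[(v - b) / a, (u - b) / a[%classic.
    apply/seteqP; split => x /=; rewrite !in_itv /= /affine_map.
      by rewrite ltr_ndivlMr // ler_ndivrMr // mulrC ltrBlDr lerBrDr andbC.
    by rewrite ltr_ndivlMr // ler_ndivrMr // mulrC ltrBlDr lerBrDr andbC.
  rewrite !lebesgue_measure_itv /= !lte_fin ltr_nM2r ?invr_lt0 // ltrD2r.
  case: ifP => _; last by rewrite mule0.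
  rewrite -!EFinB -EFinM ltr0_norm //; congr EFin.
  by field.
Qed.

Lemma ge0_integral_affine (a b : R) (f : R -> \bar R) : a != 0 ->
  measurable_fun setT f -> (forall x, 0 <= f x)%E ->
  (\int[mu]_x f x = `|a|%:E * \int[mu]_x f (a * x + b)%R)%E.
Proof.
move=> a0 mf f0.
have na : 0 <= `|a| by [].
have mphi := measurable_affine_map a b.
rewrite (@eq_measure_integral _ _ _ _
  (mscale (NngNum na) (pushforward mu (affine_map a b : _ -> measurableTypeR R)))); last first.
  by move=> A mA _; exact: lebesgue_measure_affine.
rewrite ge0_integral_mscale //=; congr (_ * _)%E.
by rewrite ge0_integral_pushforward.
Qed.

Lemma rintble_affine (a b : R) (h : R -> R) : a != 0 ->
  rintble h -> rintble (fun x => h (a * x + b)).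
Proof.
move=> a0 ih; have mh := rintble_meas ih.
have mc : measurable_fun setT (fun x => h (a * x + b)).
  exact: (measurableT_comp mh (measurable_affine_map a b)).
apply/integrableP; split; first exact/measurable_EFinP.
have : (\int[mu]_x `|(h x)%:E| < +oo)%E by case/integrableP: ih.
rewrite (@ge0_integral_affine a b) //; last first.
  by apply: measurableT_comp => //; exact/measurable_EFinP.
move=> H; rewrite ltey; apply/eqP => E; move: H.
by rewrite E gt0_muley // lte_fin normr_gt0.
Qed.

Lemma rint_affine (a b : R) (h : R -> R) : a != 0 -> rintble h ->
  rint h = `|a| * rint (fun x => h (a * x + b)).
Proof.
move=> a0 ih; have mh := rintble_meas ih.
have pos (k : R -> R) : rintble k -> (forall x, 0 <= k x) ->
    rint k = `|a| * rint (fun x => k (a * x + b)).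
  move=> ik k0; apply: EFin_inj; rewrite EFinM -!rintE //; last exact: rintble_affine.
  rewrite (@ge0_integral_affine a b) //.
  by apply/measurable_EFinP; exact: rintble_meas.
have ip : rintble (fun x => `|h x| + h x).
  by apply: rintbleD => //; exact: integrable_norm.
have im : rintble (fun x => `|h x|) by exact: integrable_norm.
(* Reduces to nonnegative functions, for which the change of variable is already known in the
   extended reals. *)
have -> : h = fun x => (`|h x| + h x) - `|h x| by apply/funext => x; rewrite addrC addKr.
rewrite rintB // pos ?(pos _ im) //; last first.
  by move=> x; have := ler_norm (- h x); rewrite normrN -subr_ge0 opprK.
rewrite -mulrBr; congr (_ * _); rewrite -rintB //.
- exact: (rintble_affine b a0 ip).
- exact: (rintble_affine b a0 im).
Qed.

Lemma cintble_affine (a b : R) (f : R -> R[i]) : a != 0 ->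
  cintble f -> cintble (fun x => f (a * x + b)).
Proof. by move=> a0 [fr fi]; split; [exact: (rintble_affine b a0 fr)|exact: (rintble_affine b a0 fi)]. Qed.

Lemma cint_affine (a b : R) (f : R -> R[i]) : a != 0 -> cintble f ->
  cint f = `|a|%:C * cint (fun x => f (a * x + b)).
Proof.
move=> a0 [fr fi]; apply: complex_eqP.
- by rewrite cReM !Re_cint Im_cint (rint_affine b a0 fr) /= mul0r subr0.
- by rewrite cImM !Im_cint Re_cint (rint_affine b a0 fi) /= mul0r addr0.
Qed.

Lemma cint_reflect (b : R) (f : R -> R[i]) : cintble f ->
  cint (fun x => f (b - x)) = cint f.
Proof.
move=> fi; rewrite (@cint_affine (-1) b f) ?oppr_eq0 ?oner_eq0 // normrN1 mul1r.
by congr cint; apply/funext => x; rewrite mulN1r addrC.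
Qed.

End AffineChangeOfVariable.

(** The Fejér kernel: up to the factor [pi], the Fourier transform of the triangle function of
    half-width [|a|]. At [s = 0] the division gives 0 instead of the limit [a ^+ 2 / 2], which
    changes it on a null set only. *)
HB.lock Definition fejer (R : realType) (a s : R) : R := (1 - cos (a * s)) / s ^+ 2.

(** * Fourier integrals *)

Section FejerCauchy.
Variable R : realType.
Implicit Types a s : R.
Notation mu := (@lebesgue_measure R).

Lemma ae_imp (P Q : R -> Prop) : (forall x, P x -> Q x) ->
  {ae mu, forall x, P x} -> {ae mu, forall x, Q x}.
Proof. by move=> PQ; apply: filterS => //; exact: (ae_filter_ringOfSetsType mu). Qed.

Lemma ae_and (P Q : R -> Prop) : {ae mu, forall x, P x} ->
  {ae mu, forall x, Q x} -> {ae mu, forall x, P x /\ Q x}.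
Proof.
by move=> p q; apply: filterS2 p q => //; exact: (ae_filter_ringOfSetsType mu).
Qed.

Lemma eq_rint_ae (f g : R -> R) : measurable_fun setT f -> measurable_fun setT g ->
  {ae mu, forall x, f x = g x} -> rint f = rint g.
Proof.
move=> mf mg fg; rewrite rint.unlock /Rintegral; congr fine.
apply: ae_eq_integral => //; try exact/measurable_EFinP.
by apply: ae_imp fg => x /= ->.
Qed.

Lemma ae_neq (c : R) : {ae mu, forall x, x != c}.
Proof.
exists [set c]; split => //; first exact: lebesgue_measure_set1.
by move=> x /= /negP; rewrite negbK => /eqP ->.
Qed.

Lemma is_derive_cosM (a x : R) : is_derive x 1 (fun t => cos (a * t)) (- (a * sin (a * x))).
Proof.
have d1 : is_derive x 1 (fun t : R => a * t) a.
  by apply: is_derive_eq; rewrite /GRing.scale /= mulr1.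
have := is_derive1_comp (is_derive_cos (a * x)) d1.
by rewrite mulNr mulrC.
Qed.

Lemma is_derive_sinM (a x : R) : is_derive x 1 (fun t => sin (a * t)) (a * cos (a * x)).
Proof.
have d1 : is_derive x 1 (fun t : R => a * t) a.
  by apply: is_derive_eq; rewrite /GRing.scale /= mulr1.
have := is_derive1_comp (is_derive_sin (a * x)) d1.
by rewrite mulrC.
Qed.

Lemma is_derive_expRM (a x : R) :
  is_derive x 1 (fun t => expR (a * t)) (a * expR (a * x)).
Proof.
have d1 : is_derive x 1 (fun t : R => a * t) a.
  by apply: is_derive_eq; rewrite /GRing.scale /= mulr1.
have := is_derive1_comp (is_derive_expR (a * x)) d1.
by rewrite mulrC.
Qed.

Lemma ler_norm_sin (x : R) : `|sin x| <= `|x|.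
Proof.
wlog x0 : x / 0 <= x => [H|].
  have [|/ltW x0] := leP 0 x; first exact: H.
  by rewrite -normrN -(normrN x) -sinN; apply: H; rewrite oppr_ge0.
move: x0; rewrite le_eqVlt => /predU1P[<-|x0]; first by rewrite sin0 normr0.
have [|c _] := @MVT R sin cos 0 x x0 (fun c _ => is_derive_sin c).
  by apply: continuous_subspaceT => y; exact: continuous_sin.
rewrite sin0 !subr0 => ->; rewrite normrM ler_piMl //; exact: cos_max.
Qed.

(** Half-angle formula: [1 - cos x] is twice the square of [sin (x / 2)]. *)
Lemma oneBcos_le (x : R) : 1 - cos x <= x ^+ 2 / 2.
Proof.
have -> : x = (x / 2) *+ 2 by rewrite -mulr_natr divfK.
have := ler_norm_sin (x / 2); set y := x / 2.
rewrite cos_mulr2n -ler_sqr ?nnegrE // !real_normK ?num_real // => H.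
have -> : (y *+ 2) ^+ 2 / 2 = 2 * y ^+ 2 by rewrite -mulr_natr; field.
have := cos2Dsin2 y; rewrite -mulr_natl; move: (cos y ^+ 2) H => c2; lra.
Qed.

Lemma rintble_cauchy : rintble (fun s : R => (1 + s ^+ 2)^-1) /\
  rint (fun s : R => (1 + s ^+ 2)^-1) = pi.
Proof.
have p0 (x : R) : 0 < 1 + x ^+ 2 by rewrite ltr_pwDl // sqr_ge0.
have E : (\int[mu]_x ((1 + x ^+ 2)^-1)%:E = pi%:E)%E.
  rewrite (@ge0_symfun_integralT _ (fun x : R => (1 + x ^+ 2)^-1)).
  - have -> : [set x : R | 0 <= x] = `[0, +oo[%classic.
      by apply/seteqP; split => x /=; rewrite in_itv /= andbT.
    rewrite integral0y_oneDsqr -EFinM; congr EFin; rewrite mulrC divfK //.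
  - by move=> x; rewrite invr_ge0 ltW.
  - exact: continuous_oneDsqrV.
  - by move=> x /=; rewrite sqrrN.
have mf : measurable_fun setT (fun s : R => (1 + s ^+ 2)^-1).
  by apply: continuous_measurable_fun; exact: continuous_oneDsqrV.
split; last by rewrite rint.unlock /Rintegral E.
apply/integrableP; split; first exact/measurable_EFinP.
under eq_integral do rewrite /= ger0_norm ?invr_ge0 ?(ltW (p0 _)) //.
by rewrite E ltry.
Qed.

Lemma fejer_ge0 a s : 0 <= fejer a s.
Proof. by rewrite fejer.unlock divr_ge0 ?sqr_ge0 // subr_ge0 cos_le1. Qed.

Lemma fejer_le a s : fejer a s <= a ^+ 2 / 2.
Proof.
rewrite fejer.unlock; have [->|s0] := eqVneq s 0.
  by rewrite expr0n /= invr0 mulr0 divr_ge0 // sqr_ge0.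
rewrite ler_pdivrMr ?exprn_even_gt0 //.
by apply: (le_trans (oneBcos_le _)); rewrite exprMn mulrAC.
Qed.

Lemma fejer_le_cauchy a s : fejer a s <= (a ^+ 2 / 2 + 2) * (1 + s ^+ 2)^-1.
Proof.
have p0 : 0 < 1 + s ^+ 2 by rewrite ltr_pwDl // sqr_ge0.
rewrite ler_pdivlMr // mulrDr mulr1 lerD ?fejer_le // fejer.unlock.
have [->|s0] := eqVneq s 0; first by rewrite expr0n /= mulr0.
by rewrite divfK ?expf_neq0 // lerBlDr -lerBlDl; have := cos_geN1 (a * s); lra.
Qed.

Lemma measurable_fejer : measurable_fun setT (fun z : R * R => fejer z.1 z.2).
Proof.
rewrite fejer.unlock; apply: measurable_funM.
  apply: measurable_funB => //; apply: (measurableT_comp (@measurable_cos R)).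
  exact: measurable_funM.
apply: (measurableT_comp (@measurable_invr R)); exact: measurable_funX.
Qed.

Lemma rintble_fejer a : rintble (fejer a).
Proof.
apply: (@rintble_le _ _ (fun s => (a ^+ 2 / 2 + 2) * (1 + s ^+ 2)^-1)).
- exact: (measurableT_comp measurable_fejer (@measurable_pair1 _ _ R R a)).
- by move=> s; rewrite ger0_norm ?fejer_ge0 // fejer_le_cauchy.
- by apply: rintbleZ; case: rintble_cauchy.
Qed.

(** This integral is not computed directly. It enters as an unknown factor and is identified with
    [pi] in [c0E]. *)
Let c0 : R := rint (fejer 1).

Let rint_fejer_scale a : rint (fejer a) = `|a| * c0.
Proof.
have [->|a0] := eqVneq a 0.
  rewrite normr0 mul0r -[RHS]rint0; congr rint; apply/funext => s.
  by rewrite fejer.unlock mul0r cos0 subrr mul0r.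
rewrite /c0 (rint_affine 0 a0 (rintble_fejer 1)).
have -> : (fun x => fejer 1 (a * x + 0)) = fun x => a ^- 2 * fejer a x.
  apply/funext => x; rewrite fejer.unlock addr0 mul1r exprMn invfM; ring.
rewrite rintZ; last exact: rintble_fejer.
rewrite mulrA -normrM mulrA -expr2 normrX real_normK ?num_real // mulfV ?mul1r //.
by rewrite expf_neq0.
Qed.

(** Product-to-sum formulas write the integrand as a combination of Fejér kernels of widths [h + u],
    [h - u] and [u]; the triangle function is the matching combination of [|h + u|], [|h - u|] and
    [|u|]. *)
Let rint_fejer_cos_scale (h u : R) : 0 <= h ->
  rint (fun s => fejer h s * cos (u * s)) = c0 * Num.max 0 (h - `|u|).
Proof.
move=> h0.
have -> : (fun s => fejer h s * cos (u * s)) =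
    fun s => (2^-1 * fejer (h + u) s + 2^-1 * fejer (h - u) s) - fejer u s.
  apply/funext => s; rewrite fejer.unlock.
  have -> : (h + u) * s = h * s + u * s by ring.
  have -> : (h - u) * s = h * s + - (u * s) by ring.
  by rewrite !cosD !cosN !sinN; move: (s ^- 2) => w; field.
rewrite rintB; [|by apply: rintbleD; apply: rintbleZ; exact: rintble_fejer|
  exact: rintble_fejer].
rewrite rintD; [|by apply: rintbleZ; exact: rintble_fejer..].
rewrite !rintZ; [|exact: rintble_fejer..].
rewrite !rint_fejer_scale.
have -> : Num.max 0 (h - `|u|) = 2^-1 * `|h + u| + 2^-1 * `|h - u| - `|u|.
  have [u0|u0] := leP 0 u.
    rewrite (ger0_norm u0) (ger0_norm (_ : 0 <= h + u)); last exact: addr_ge0.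
    by have [hu|hu] := leP 0 (h - u); [rewrite (ger0_norm hu)|rewrite (ltr0_norm hu)]; lra.
  rewrite (ltr0_norm u0) (ger0_norm (_ : 0 <= h - u)); last by lra.
  by rewrite opprK; have [hu|hu] := leP 0 (h + u);
    [rewrite (ger0_norm hu)|rewrite (ltr0_norm hu)]; lra.
ring.
Qed.

Lemma cvgy_exprn_expR n : (fun x : R => x ^+ n * expR (- x)) x @[x --> +oo] --> (0 : R).
Proof.
apply/cvgrPdist_lt => e e0; near=> x.
have x0 : 0 < x by near: x; exact: nbhs_pinfty_gt.
have xe : n.+1`!%:R / e < x by near: x; apply: nbhs_pinfty_gt; exact: num_real.
have f0 : 0 < n.+1`!%:R :> R by rewrite ltr0n fact_gt0.
rewrite sub0r normrN ger0_norm ?mulr_ge0 ?expR_ge0 ?exprn_ge0 ?(ltW x0) //.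
rewrite expRN ltr_pdivrMr ?expR_gt0 //.
have := expR_ge1Dxn n (ltW x0).
rewrite ltr_pdivrMr // in xe.
have p : 0 < x ^+ n by rewrite exprn_gt0.
have : x ^+ n < e * (x ^+ n.+1 / n.+1`!%:R).
  rewrite mulrA ltr_pdivlMr // exprS (_ : e * _ = x ^+ n * (x * e)); last by ring.
  by rewrite ltr_pM2l.
move=> H1 H2; apply: (lt_le_trans H1); rewrite ler_pM2l //.
by apply: le_trans H2; rewrite lerDr.
Unshelve. all: by end_near. Qed.

Let is_derive_expRN (x : R) : is_derive x 1 (fun t => expR (- t)) (- expR (- x)).
Proof.
have := is_derive_expRM (-1) x; rewrite !mulN1r.
by under eq_fun do rewrite mulN1r.
Qed.

Let rint_exp_gen (f F : R -> R) (w : R) : 0 <= w ->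
  (forall x, w <= x -> 0 <= f x) -> continuous f ->
  (forall x : R, is_derive x 1 F (f x)) -> F x @[x --> +oo] --> (0 : R) ->
  rintble (fun x => if w <= x then f x else 0) /\
  rint (fun x => if w <= x then f x else 0) = - F w.
Proof.
move=> w0 f0 cf dF cF.
have E : (\int[mu]_x (if w <= x then f x else 0)%:E = (- F w)%:E)%E.
  transitivity (\int[mu]_(x in `[w, +oo[) (f x)%:E)%E.
    rewrite [RHS]integral_mkcond; apply: eq_integral => x _.
    rewrite patchE; case: ifPn => wx; first by rewrite mem_set //= in_itv /= wx.
    by rewrite memNset //= in_itv /= andbT; exact/negP.
  rewrite (@ge0_continuous_FTC2y _ f F w 0) ?sub0e //.
  - exact: continuous_subspaceT.
  - apply: cvg_at_right_filter; apply: differentiable_continuous.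
    by apply/derivable1_diffP; case: (dF w).
  - by move=> x _; rewrite derive1E; case: (dF x).
have m : measurable_fun setT (fun x => if w <= x then f x else 0).
  apply: measurable_fun_ifT => //; first exact: measurable_fun_ler.
  exact: continuous_measurable_fun.
split; last by rewrite rint.unlock /Rintegral E.
apply/integrableP; split; first exact/measurable_EFinP.
under eq_integral => x _.
  rewrite /= ger0_norm; last by case: ifPn => // /f0.
  over.
by rewrite E ltry.
Qed.

Let is_derive_polyexp (a b c x : R) :
  is_derive x 1 (fun t => - ((a * t ^+ 2 + b * t + c) * expR (- t)))
    ((a * x ^+ 2 + b * x + c - (2 * a * x + b)) * expR (- x)).
Proof.
have d1 : is_derive x 1 (fun t : R => a * t ^+ 2 + b * t + c) (2 * a * x + b).
  by apply: is_derive_eq; rewrite /GRing.scale /= !mulr1; ring.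
apply: (is_derive_eq (is_deriveN (is_deriveM d1 (is_derive_expRN x)))).
rewrite /GRing.scale /=; ring.
Qed.

Let cvg_polyexp (a b c : R) :
  (fun t => - ((a * t ^+ 2 + b * t + c) * expR (- t))) x @[x --> +oo] --> (0 : R).
Proof.
rewrite (_ : (fun t => _) = fun t => - (a * (t ^+ 2 * expR (- t)) +
   b * (t ^+ 1 * expR (- t)) + c * (t ^+ 0 * expR (- t)))); last first.
  by apply/funext => t; ring.
rewrite -[X in _ --> X](_ : - (a * 0 + b * 0 + c * 0) = 0); last by ring.
apply: cvgN; apply: cvgD; [apply: cvgD|];
  by apply: cvgMr; exact: cvgy_exprn_expR.
Qed.

Let continuous_expN (g : R -> R) : continuous g -> continuous (fun t => g t * expR (- t)).
Proof.
move=> cg x; apply: cvgM; first exact: cg.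
apply: (@continuous_comp _ _ _ (-%R) expR); first exact: oppr_continuous.
exact: continuous_expR.
Qed.

Let rint_exp_shift (w : R) : 0 <= w ->
  rint (fun T => if w <= T then (T - w) * expR (- T) else 0) = expR (- w).
Proof.
move=> w0.
have [||||_ ->] := @rint_exp_gen (fun T => (T - w) * expR (- T))
  (fun t => - ((0 * t ^+ 2 + 1 * t + (1 - w)) * expR (- t))) w w0.
- by move=> x wx; rewrite mulr_ge0 ?expR_ge0 // subr_ge0.
- apply: continuous_expN => x; apply: cvgB; [exact: cvg_id|exact: cvg_cst].
- by move=> x; apply: (is_derive_eq (is_derive_polyexp 0 1 (1 - w) x));
   ring.
- exact: cvg_polyexp.
- by ring.
Qed.

Let rintble_exp2 : rintble (fun T : R => if 0 <= T then (T ^+ 2 / 2 + 2) * expR (- T) else 0).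
Proof.
have [||||//] := @rint_exp_gen (fun T => (T ^+ 2 / 2 + 2) * expR (- T))
  (fun t => - ((2^-1 * t ^+ 2 + 1 * t + 3) * expR (- t))) 0 (lexx 0).
- by move=> x wx; rewrite mulr_ge0 ?expR_ge0 // addr_ge0 // divr_ge0 ?sqr_ge0.
- apply: continuous_expN => x; apply: cvgD; last exact: cvg_cst.
  by apply: cvgMl; exact: exprn_continuous.
- by move=> x; apply: (is_derive_eq (is_derive_polyexp 2^-1 1 3 x));
   field.
- exact: cvg_polyexp.
Qed.

(** The Laplace transform of the Fejér kernel in its width. It exhibits the Cauchy kernel as a
    superposition of Fejér kernels, whose Fourier transforms are known up to [c0]. *)
Let rint_exp_fejer (s : R) : s != 0 ->
  rint (fun T => if 0 <= T then expR (- T) * fejer T s else 0) = (1 + s ^+ 2)^-1.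
Proof.
move=> s0.
have p0 : 1 + s ^+ 2 != 0 by rewrite gt_eqF // ltr_pwDl // sqr_ge0.
(* The antiderivative comes from the fact that [exp (- t) * (cos (s t) - s * sin (s t))] has
   derivative [- (1 + s^2) * exp (- t) * cos (s t)]. *)
have [||||_] := @rint_exp_gen (fun T => fejer T s * expR (- T))
  (fun t => (- expR (- t) + expR (- t) * ((cos (s * t) - s * sin (s * t)) * (1 + s ^+ 2)^-1))
     / s ^+ 2) 0 (lexx 0).
- by move=> x wx; rewrite mulr_ge0 ?expR_ge0 // fejer_ge0.
- apply: continuous_expN => x; rewrite fejer.unlock; apply: cvgMl; apply: cvgB; first exact: cvg_cst.
  have cc : {for x, continuous (fun t : R => cos (t * s))}.
    apply: (@continuous_comp R R R (fun t => t * s) cos x); last exact: continuous_cos.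
    exact: mulrr_continuous.
  exact: cc.
- move=> x; have dc := is_derive_cosM s x; have ds := is_derive_sinM s x.
  have de := is_derive_expRN x.
  apply: is_derive_eq; rewrite /GRing.scale /= fejer.unlock [x * s]mulrC.
  by move: (cos _) (sin _) (expR _) => c d e; field; rewrite s0 p0.
- apply: (@squeeze_cvgr _ _ _ _
     (fun t => - ((2 + `|s|) / s ^+ 2 * expR (- t))) (fun t => (2 + `|s|) / s ^+ 2 * expR (- t))).
  + near=> t.
    have e0 := expR_ge0 (- t).
    rewrite -ler_norml normrM [leRHS]mulrAC normfV [X in _ / X]ger0_norm ?sqr_ge0 //.
    rewrite ler_wpM2r ?invr_ge0 ?sqr_ge0 // -mulrN1 -mulrDr normrM ger0_norm //.
    rewrite mulrC ler_wpM2r //.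
    apply: (le_trans (ler_normD _ _)); rewrite normrN1 (_ : 2 + `|s| = 1 + (1 + `|s|)); last by ring.
    rewrite lerD2l normrM normfV [X in _ / X]ger0_norm; last by rewrite addr_ge0 // sqr_ge0.
    apply: (@le_trans _ _ `|cos (s * t) - s * sin (s * t)|).
      by rewrite ler_piMr // invf_le1 ?lerDl ?sqr_ge0 // ltr_pwDl // sqr_ge0.
    apply: (le_trans (ler_normB _ _)); rewrite lerD ?cos_max // normrM ler_piMr //.
    exact: sin_max.
  + rewrite -[X in _ --> X]oppr0; apply: cvgN.
    rewrite -[X in _ --> X](mulr0 ((2 + `|s|) / s ^+ 2)); apply: cvgMr; exact: cvgr_expR.
  + rewrite -[X in _ --> X](mulr0 ((2 + `|s|) / s ^+ 2)); apply: cvgMr; exact: cvgr_expR.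
rewrite mulr0 cos0 sin0 mulr0 subr0 oppr0 expR0 => H.
rewrite -[RHS](_ : - ((-1 + 1 * (1 * (1 + s ^+ 2)^-1)) / s ^+ 2) = _); last first.
  by field; rewrite s0 p0.
rewrite -H; congr rint; apply/funext => T; by rewrite mulrC.
Unshelve. all: by end_near. Qed.

(** Fubini in the superposition above: the transform becomes [c0] times the integral of
    [exp (- T) * max (0, T - |w|)] over [T >= 0], which is [exp (- |w|)]. *)
Let rint_cauchy_cos_scale (w : R) :
  rint (fun s => (1 + s ^+ 2)^-1 * cos (w * s)) = c0 * expR (- `|w|).
Proof.
pose F (z : R * R) : R :=
  (if 0 <= z.2 then expR (- z.2) * fejer z.2 z.1 else 0) * cos (w * z.1).
have mF0 : measurable_fun setT (fun z : R * R => if 0 <= z.2 then expR (- z.2) * fejer z.2 z.1 else 0).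
  apply: measurable_fun_ifT => //; first exact: measurable_fun_ler.
  apply: measurable_funM.
    apply: (measurableT_comp (@measurable_expR R)); exact: measurable_funN.
  apply: (measurableT_comp (f := fun z : R * R => fejer z.1 z.2) (g := fun z : R * R => (z.2, z.1))).
    exact: measurable_fejer.
  by apply: measurable_fun_pair.
have mF : measurable_fun setT F.
  apply: measurable_funM => //.
  apply: (measurableT_comp (@measurable_cos R)); exact: measurable_funM.
have mc : measurable_fun setT (fun s : R => cos (w * s)).
  by apply: (measurableT_comp (@measurable_cos R)).
have inner s : rint (fun T => F (s, T)) =
    rint (fun T => if 0 <= T then expR (- T) * fejer T s else 0) * cos (w * s).
  rewrite mulrC -rintZ; first by congr rint; apply/funext => T; rewrite /F mulrC.
  apply: (@rintble_le _ _ (fun T => if 0 <= T then (T ^+ 2 / 2 + 2) * expR (- T) else 0)) => //.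
    exact: (measurableT_comp mF0 (@measurable_pair1 _ _ R R s)).
  move=> T; case: ifPn => // T0; last by rewrite normr0.
  have e0 := mulr_ge0 (expR_ge0 (- T)) (fejer_ge0 T s).
  rewrite (ger0_norm e0) mulrC ler_wpM2r ?expR_ge0 //.
  by apply: (le_trans (fejer_le _ _)); rewrite lerDl.
have bF s T : `|F (s, T)| <= (1 + s ^+ 2)^-1 *
    (if 0 <= T then (T ^+ 2 / 2 + 2) * expR (- T) else 0).
  rewrite /F /= normrM; apply: (@le_trans _ _ (`|if 0 <= T then expR (- T) * fejer T s else 0| * 1)).
    by rewrite ler_wpM2l // cos_max.
  rewrite mulr1; case: ifPn => T0; last by rewrite normr0 mulr0.
  have e0 := mulr_ge0 (expR_ge0 (- T)) (fejer_ge0 T s).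
  rewrite (ger0_norm e0) (_ : (1 + s ^+ 2)^-1 * (_ * expR (- T)) =
    expR (- T) * ((T ^+ 2 / 2 + 2) * (1 + s ^+ 2)^-1)); last by ring.
  by rewrite ler_wpM2l ?expR_ge0 // fejer_le_cauchy.
transitivity (rint (fun s => rint (fun T => F (s, T)))).
  apply: eq_rint_ae.
  - apply: measurable_funM => //.
    by apply: rintble_meas; case: rintble_cauchy.
  - exact: (measurable_rint mF).
  - apply: ae_imp (ae_neq 0) => s s0; by rewrite inner rint_exp_fejer.
rewrite (rint_swap mF bF); last 2 first.
  by case: rintble_cauchy.
  exact: rintble_exp2.
transitivity (rint (fun T => c0 * (if `|w| <= T then (T - `|w|) * expR (- T) else 0))).
  congr rint; apply/funext => T; rewrite /F /=.
  have [T0|T0] := leP 0 T.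
    transitivity (expR (- T) * rint (fun s => fejer T s * cos (w * s))).
      rewrite -rintZ; first by congr rint; apply/funext => s; rewrite mulrA.
      apply: (@rintble_le _ _ (fejer T)); last exact: rintble_fejer.
        by apply: measurable_funM => //; apply: rintble_meas; exact: rintble_fejer.
      move=> s; rewrite normrM (ger0_norm (fejer_ge0 _ _)) ler_piMr ?fejer_ge0 //.
      exact: cos_max.
    rewrite rint_fejer_cos_scale //; case: (leP `|w| T) => wT.
      by rewrite max_r ?subr_ge0 //; ring.
    by rewrite max_l ?subr_le0 ?(ltW wT) // !mulr0.
  rewrite leNgt (lt_le_trans T0) //= mulr0 -[RHS]rint0; congr rint; apply/funext => s.
  by rewrite mul0r.
rewrite rintZ; first by rewrite rint_exp_shift.
have [||||//] := @rint_exp_gen (fun T => (T - `|w|) * expR (- T))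
  (fun t => - ((0 * t ^+ 2 + 1 * t + (1 - `|w|)) * expR (- t))) `|w| (normr_ge0 w).
- by move=> x wx; rewrite mulr_ge0 ?expR_ge0 // subr_ge0.
- apply: continuous_expN => x; apply: cvgB; [exact: cvg_id|exact: cvg_cst].
- by move=> x; apply: (is_derive_eq (is_derive_polyexp 0 1 (1 - `|w|) x));
   ring.
- exact: cvg_polyexp.
Qed.

(** At frequency 0 the left side of the previous identity is the integral of the Cauchy kernel,
    known through the arctangent. *)
Let c0E : c0 = pi.
Proof.
have := rint_cauchy_cos_scale 0.
rewrite normr0 oppr0 expR0 mulr1 => <-.
rewrite -[RHS](rintble_cauchy.2); congr rint; apply/funext => s.
by rewrite mul0r cos0 mulr1.
Qed.

Lemma rint_fejer_cos (h u : R) : 0 <= h ->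
  rint (fun s => fejer h s * cos (u * s)) = pi * Num.max 0 (h - `|u|).
Proof. by rewrite -c0E; exact: rint_fejer_cos_scale. Qed.

Lemma rint_cauchy_cos (w : R) :
  rint (fun s => (1 + s ^+ 2)^-1 * cos (w * s)) = pi * expR (- `|w|).
Proof. by rewrite -c0E; exact: rint_cauchy_cos_scale. Qed.

End FejerCauchy.

HB.lock Definition cis (R : realType) (t : R) : R[i] := cos t +i* sin t.

(* [ce rho x] is exp (i * rho * x). *)
HB.lock Definition ce (R : realType) (rho : R[i]) (x : R) : R[i] :=
  (expR (- (complex.Im rho * x)))%:C * cis (complex.Re rho * x).

Section ComplexExponential.
Variable R : realType.
Implicit Types (rho : R[i]) (s t : R).

Lemma cisD (s t : R) : cis (s + t) = cis s * cis t.
Proof. by apply: complex_eqP; rewrite cis.unlock /= ?cosD ?sinD //; ring. Qed.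

Lemma cmod_cis t : cmod (cis t) = 1.
Proof. by rewrite cis.unlock /ComplexField.Normc.normc cos2Dsin2 sqrtr1. Qed.

Lemma conj_cis t : (conjc (cis t)) = cis (- t).
Proof. by rewrite cis.unlock /= cosN sinN. Qed.

Lemma cmeas_cis d (T : measurableType d) (f : T -> R) :
  measurable_fun setT f -> cmeas (fun x => cis (f x)).
Proof.
move=> mf; split; rewrite cis.unlock /=.
- exact: (measurableT_comp (@measurable_cos R) mf).
- exact: (measurableT_comp (@measurable_sin R) mf).
Qed.

Lemma cis0 : cis (0 : R) = 1.
Proof. by rewrite cis.unlock cos0 sin0. Qed.

Lemma ce0 rho : ce rho 0 = 1.
Proof. by rewrite ce.unlock !mulr0 oppr0 expR0 cis0 mulr1. Qed.

Lemma ceD rho x y : ce rho (x + y) = ce rho x * ce rho y.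
Proof. by rewrite ce.unlock !mulrDr opprD expRD cisD rmorphM /=; ring. Qed.

Lemma cmod_ce rho x : cmod (ce rho x) = expR (- (complex.Im rho * x)).
Proof. by rewrite ce.unlock cmodM cmod_cis mulr1 cmod_real ger0_norm // expR_ge0. Qed.

Lemma cmod_ce_le1 rho x : 0 <= complex.Im rho -> 0 <= x -> cmod (ce rho x) <= 1.
Proof. by move=> r0 x0; rewrite cmod_ce -expR0 ler_expR oppr_le0 mulr_ge0. Qed.

Lemma cmeas_ce d (T : measurableType d) (f : T -> R[i]) (g : T -> R) :
  cmeas f -> measurable_fun setT g -> cmeas (fun z => ce (f z) (g z)).
Proof.
move=> [fr fi] mg; rewrite ce.unlock; apply: cmeasM.
- apply: cmeas_real; apply: (measurableT_comp (@measurable_expR R)).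
  by apply: measurable_funN; exact: measurable_funM.
- by apply: cmeas_cis; exact: measurable_funM.
Qed.

End ComplexExponential.

(** * A Plancherel inequality for functions of bounded support *)

Section Plancherel.
Variable R : realType.
Notation mu := (@lebesgue_measure R).
Implicit Types (g : R -> R[i]).

Lemma rintble_itv (a b : R) : rintble (fun x => if a < x < b then 1 else 0).
Proof.
have E : (\int[mu]_x `|((if a < x < b then 1 else 0) : R)%:E| = mu `]a, b[)%E.
  rewrite -[RHS](mul1e (mu `]a, b[)) -integral_cst // [RHS]integral_mkcond.
  apply: eq_integral => x _; rewrite patchE.
  case: ifPn => xab; first by rewrite mem_set //= ?normr1 // in_itv.
  by rewrite memNset //= ?normr0 // in_itv; exact/negP.
apply/integrableP; split.
  apply/measurable_EFinP; apply: measurable_fun_ifT => //.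
  by apply: measurable_and; exact: measurable_fun_ltr.
rewrite E lebesgue_measure_itv /=; case: ifP => _; last by rewrite ltry.
by rewrite -EFinB ltry.
Qed.

Lemma rint_itv (a b : R) : rint (fun x => if a < x < b then 1 else 0) = Num.max 0 (b - a).
Proof.
apply: EFin_inj; rewrite -rintE; last exact: rintble_itv.
transitivity (mu `]a, b[).
  rewrite -[RHS](mul1e (mu `]a, b[)) -integral_cst // [RHS]integral_mkcond.
  apply: eq_integral => x _; rewrite patchE.
  case: ifPn => xab; first by rewrite mem_set //= ?normr1 // in_itv.
  by rewrite memNset //= ?normr0 // in_itv; exact/negP.
rewrite lebesgue_measure_itv /= lte_fin; case: ltP => ab.
  by rewrite -EFinB max_r // subr_ge0 ltW.
by rewrite max_l // subr_le0.
Qed.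

(** Expands the square and moves the integral over [s] innermost, so that the weighted energy of the
    transform depends on [w] and [e] only through a kernel in [(x, y)]. Two transforms with the same
    kernel therefore have the same energy. *)
Lemma cint_sqr_kernel g (w : R -> R) (e : R * R -> R[i]) : cintble g -> rintble w ->
  cmeas e -> (forall z, cmod (e z) <= 1) ->
  let F s := cint (fun x => g x * e (s, x)) in
  cint (fun s => (w s)%:C * (F s * (conjc (F s)))) =
  cint (fun x => g x * cint (fun y => (conjc (g y)) *
    cint (fun s => (w s)%:C * (e (s, x) * (conjc (e (s, y))))))).
Proof.
move=> ig iw me e1 F.
have mg := cintble_meas ig; have iag := rintble_cmod ig.
have iaw : rintble (fun s => `|w s|) by exact: integrable_norm.
have mw := rintble_meas iw.
have mex s : cmeas (fun x => e (s, x)).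
  by apply: cmeas_comp me _; exact: measurable_pair1.
have mey x : cmeas (fun s => e (s, x)).
  by apply: cmeas_comp me _; exact: measurable_pair2.
have ige s : cintble (fun x => g x * e (s, x)).
  apply: (@cintble_le _ _ (fun x => cmod (g x))) => //; first exact: cmeasM.
  by move=> x; rewrite cmodM ler_piMr // cmod_ge0.
set B := rint (fun x => cmod (g x)).
have FB s : cmod (F s) <= B.
  by apply: ler_cmod_cint => // x; rewrite cmodM ler_piMr // cmod_ge0.
have mge : cmeas (fun z : R * R => g z.2 * e z).
  by apply: cmeasM => //; apply: cmeas_comp mg _.
have mF : cmeas F by exact: (cmeas_cint mge).
have mwc d (T : measurableType d) (p : T -> R) : measurable_fun setT p ->
    cmeas (fun z => (w (p z))%:C).
  by move=> mp; apply: cmeas_real; exact: (measurableT_comp mw mp).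
transitivity (cint (fun s => cint (fun x => (w s)%:C * (conjc (F s)) * (g x * e (s, x))))).
  apply: eq_cint => s; rewrite cintZ //.
  by rewrite -/(F s) mulrAC mulrA.
rewrite (@cint_swap _ (fun z => (w z.1)%:C * (conjc (F z.1)) * (g z.2 * e z))
   (fun s => B * `|w s|) (fun x => cmod (g x))) //; last first.
- exact: rintbleZ.
- move=> s x /=; rewrite !cmodM cmod_conj cmod_real mulrC [`|_| * _]mulrC.
  rewrite mulrC ler_pM ?mulr_ge0 ?cmod_ge0 //.
    by rewrite ler_wpM2r.
  by rewrite ler_piMr ?cmod_ge0.
- apply: cmeasM => //; apply: cmeasM; first exact: mwc.
  by apply: cmeas_conj; apply: cmeas_comp mF _.
apply: eq_cint => x /=.
have i1 : cintble (fun s => (w s)%:C * (conjc (F s)) * e (s, x)).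
  apply: (@cintble_le _ _ (fun s => B * `|w s|)); last exact: rintbleZ.
    apply: cmeasM => //; apply: cmeasM; first exact: mwc.
    exact: cmeas_conj.
  move=> s; rewrite !cmodM cmod_conj cmod_real [`|_| * _]mulrC -[leRHS]mulr1.
  by rewrite ler_pM ?mulr_ge0 ?cmod_ge0 // ler_wpM2r.
transitivity (g x * cint (fun s => (w s)%:C * (conjc (F s)) * e (s, x))).
  by rewrite -cintZ //; apply: eq_cint => s; rewrite mulrCA.
congr (_ * _).
transitivity (cint (fun s => cint (fun y => (w s)%:C * e (s, x) * ((conjc (g y)) * (conjc (e (s, y))))))).
  apply: eq_cint => s.
  have -> : (conjc (F s)) = cint (fun y => (conjc (g y * e (s, y)))) by exact/esym/cint_conj.
  rewrite mulrAC -cintZ; last first.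
    apply: (@cintble_le _ _ (fun x => cmod (g x))) => //.
      by apply: cmeas_conj; exact: cmeasM.
    by move=> y; rewrite cmod_conj cmodM ler_piMr // cmod_ge0.
  by apply: eq_cint => y; rewrite rmorphM.
rewrite (@cint_swap _ (fun z => (w z.1)%:C * e (z.1, x) * ((conjc (g z.2)) * (conjc (e z))))
   (fun s => `|w s|) (fun x => cmod (g x))) //; last first.
- move=> s y /=; rewrite !cmodM !cmod_conj cmod_real.
  rewrite ler_pM ?mulr_ge0 ?cmod_ge0 //; by rewrite ler_piMr ?cmod_ge0.
- apply: cmeasM.
    apply: cmeasM; first exact: mwc.
    by apply: cmeas_comp (mey x) _.
  apply: cmeasM; apply: cmeas_conj => //; exact: (cmeas_comp mg).
apply: eq_cint => y /=; rewrite -cintZ.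
  by apply: eq_cint => s; ring.
apply: (@cintble_le _ _ (fun s => `|w s|)) => //.
  by apply: cmeasM; [exact: mwc|apply: cmeasM => //; exact: cmeas_conj].
move=> s; rewrite !cmodM cmod_conj cmod_real ler_piMr // -[leRHS]mulr1.
by apply: ler_pM => //; exact: cmod_ge0.
Qed.

Lemma rint_sqr_kernel g (w : R -> R) (e : R * R -> R[i]) : cintble g -> rintble w ->
  cmeas e -> (forall z, cmod (e z) <= 1) ->
  let F s := cint (fun x => g x * e (s, x)) in
  (rint (fun s => w s * cmod (F s) ^+ 2))%:C =
  cint (fun x => g x * cint (fun y => conjc (g y) *
    cint (fun s => (w s)%:C * (e (s, x) * conjc (e (s, y)))))).
Proof.
move=> ig iw me e1 F; rewrite -cint_sqr_kernel // -cint_real.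
by apply: eq_cint => s; rewrite mulc_conj rmorphM.
Qed.

Let box (r : R) (z : R * R) : R[i] := if `|z.1 - z.2| < r then 1 else 0.

Let cmeas_box r : cmeas (box r).
Proof.
apply: cmeas_if; [|exact: cmeas_cst..].
apply: measurable_fun_ltr => //; apply: (measurableT_comp (@normr_measurable R setT)).
exact: measurable_funB.
Qed.

Let cmod_box r z : cmod (box r z) <= 1.
Proof. by rewrite /box; case: ifP => _; rewrite ?cmod1 ?cmod0. Qed.

(** Both sides are quadratic forms in [g] with the kernel [2 pi max (0, 2 r - |x - y|)]: on the left
    by the Fourier transform of the Fejér kernel, on the right as the length of the intersection of
    two intervals of radius [r]. As [r <= 1], the window from [-1] to [L + 1] contains all these
    intervals; it makes the weight integrable. *)
Let box_average_identity g (L r : R) : cintble g -> 0 < r -> r <= 1 ->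
  (forall x, ~~ (0 <= x <= L) -> g x = 0) ->
  rint (fun s => fejer (4 * r) s *
    cmod (cint (fun x => g x * cis (2 * s * x))) ^+ 2) =
  rint (fun z => 2 * pi * (if -1 < z < L + 1 then 1 else 0) *
    cmod (cint (fun x => g x * box r (z, x))) ^+ 2).
Proof.
move=> ig r0 r1 gL; apply: (@complexI R).
pose e (z : R * R) := cis (2 * z.1 * z.2).
have me : cmeas e.
  by apply: cmeas_cis; apply: measurable_funM => //; exact: measurable_funM.
have e1 z : cmod (e z) <= 1 by rewrite cmod_cis.
have iw := rintbleZ (2 * pi) (rintble_itv (-1) (L + 1)).
apply: etrans (rint_sqr_kernel ig (rintble_fejer (4 * r)) me e1) _.
apply: esym; apply: etrans (rint_sqr_kernel ig iw (cmeas_box r) (cmod_box r)) _.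
apply: esym.
apply: eq_cint => x.
have [xL|/gL gx0] := boolP (0 <= x <= L); last first.
  by rewrite gx0; exact: etrans (mul0r _) (esym (mul0r _)).
apply: (congr1 ( *%R (g x))); apply: eq_cint => y.
have [yL|/gL gy0] := boolP (0 <= y <= L); last first.
  by rewrite gy0 conjc0; exact: etrans (mul0r _) (esym (mul0r _)).
apply: (congr1 ( *%R (conjc (g y)))).
have -> : (fun s => (fejer (4 * r) s)%:C * (e (s, x) * conjc (e (s, y)))) =
    fun s => (fejer (4 * r) s * cos (2 * (x - y) * s)) +i*
             (fejer (4 * r) s * sin (2 * (x - y) * s)).
  apply/funext => s; rewrite /e /= conj_cis -cisD.
  have -> : 2 * s * x + - (2 * s * y) = 2 * (x - y) * s by ring.
  by apply: complex_eqP; rewrite cis.unlock /=; ring.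
have -> : (fun s : R => (2 * pi * (if -1 < s < L + 1 then 1 else 0))%:C *
     (box r (s, x) * conjc (box r (s, y)))) =
   fun s => (2 * pi * (if Num.max x y - r < s < Num.min x y + r then 1 else 0))%:C.
  apply/funext => s; rewrite /box /=.
  have -> : (Num.max x y - r < s < Num.min x y + r) = (`|s - x| < r) && (`|s - y| < r).
    rewrite !ltr_norml; have [xy|xy] := leP x y.
      by apply/idP/idP; lra.
    by apply/idP/idP; lra.
  case: (ltP _ r) => sx; case: (ltP _ r) => sy /=; rewrite ?conjc0 ?conjc1 ?mulr0 ?mul0r ?mulr0 //.
  suff -> : -1 < s < L + 1 by rewrite !mulr1.
  by move: sx; rewrite ltr_norml; lra.
rewrite cint_real rintZ; last exact: rintble_itv.
rewrite rint_itv; apply: complex_eqP; rewrite ?Re_cint ?Im_cint /=.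
- rewrite rint_fejer_cos ?mulr_ge0 ?(ltW r0) //.
  rewrite normrM ger0_norm //.
  have -> : 4 * r - 2 * `|x - y| = 2 * (2 * r - `|x - y|) by ring.
  have -> : Num.min x y + r - (Num.max x y - r) = 2 * r - `|x - y|.
    by have [xy|xy] := leP x y; [rewrite ler0_norm ?subr_le0 //|
      rewrite gtr0_norm ?subr_gt0 //]; ring.
  have := maxr_pMr 0 (2 * r - `|x - y|) (ler0n R 2); rewrite mulr0 => <-.
  by ring.
(* The imaginary part of the kernel integrates a function odd in [s], hence vanishes. *)
- set f := fun s => _.
  have fN : (fun s => f (-1 * s + 0)) = fun s => - f s.
    apply/funext => s; rewrite /f addr0 mulN1r fejer.unlock !mulrN cosN sinN sqrrN; ring.
  have fi : rintble f.
    apply: (rintble_le _ _ (rintble_fejer (4 * r))).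
      apply: measurable_funM; first exact: rintble_meas (rintble_fejer _).
      by apply: (measurableT_comp (@measurable_sin R)).
    move=> s; rewrite normrM (ger0_norm (fejer_ge0 _ _)) ler_piMr ?fejer_ge0 //.
    exact: sin_max.
  have := rint_affine 0 (_ : -1 != 0 :> R) fi.
  rewrite oppr_eq0 oner_eq0 => /(_ isT); rewrite fN rintN // normrN1 mul1r => H.
  lra.
Qed.

Lemma rintble_locally (h : R -> R) : rintble h -> locally_integrable setT h.
Proof.
move=> ih; split; [exact: rintble_meas|exact: openT|move=> K _ cK].
have mK := compact_measurable cK.
apply: (@le_lt_trans _ _ (\int[mu]_x `|(h x)%:E|)%E); last by case/integrableP: ih.
apply: ge0_subset_integral => //.
apply/measurable_EFinP.
exact: (measurableT_comp (@normr_measurable R setT) (rintble_meas ih)).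
Qed.

Let radius (n : nat) : R := n.+1%:R^-1.

Let radius_gt0 n : 0 < radius n. Proof. by rewrite invr_gt0. Qed.

Let cvg_average (h : R -> R) (x : R) : rintble h -> lebesgue_pt h x ->
  ((2 * radius n)^-1 * rint (fun y => h y * (if `|x - y| < radius n then 1 else 0)))
    @[n --> \oo] --> h x.
Proof.
move=> ih lx.
have shrink (y : R) : nicely_shrinking y (fun n => ball y (radius n)).
  split => [n|]; first exact: measurable_ball.
  exists (1, fun n => PosNum (radius_gt0 n)); split => //=.
  - exact: cvg_harmonic.
  - by move=> n; exact: subset_refl.
  - by move=> n; rewrite mul1e.
have /fine_cvgP[_] := nice_lebesgue_differentiation shrink (rintble_locally ih) lx.
apply: cvg_trans; apply: near_eq_cvg; apply: nearW => n /=.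
have r2 : radius n *+ 2 != 0 by rewrite mulrn_eq0 negb_or /= gt_eqF.
have -> : lebesgue_measure (ball x (radius n)) = (2 * radius n)%:E.
  by rewrite lebesgue_measure_ball ?(ltW (radius_gt0 n)) // mulr_natl.
have ib : rintble (fun y => h y * (if `|x - y| < radius n then 1 else 0)).
  apply: (@rintble_le _ _ (fun y => `|h y|)); last exact: integrable_norm.
    apply: measurable_funM; first exact: rintble_meas.
    apply: measurable_fun_ifT => //; apply: measurable_fun_ltr => //.
    by apply: (measurableT_comp (@normr_measurable R setT)); exact: measurable_funB.
  by move=> y; rewrite normrM; case: ifP; rewrite ?normr1 ?normr0 ?mulr1 ?mulr0.
have -> : (\int[mu]_(y in ball x (radius n)) (h y)%:E =
    (rint (fun y => h y * (if `|x - y| < radius n then 1 else 0)))%:E)%E.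
  rewrite -rintE // integral_mkcond; apply: eq_integral => y _.
  rewrite patchE; case: ifPn => xy.
    by rewrite ifT ?mulr1 //; move: xy; rewrite inE.
  by rewrite ifF ?mulr0 //; apply/negP => H; move/negP: xy; apply; rewrite inE.
by rewrite inver ifF -?EFinM //; apply/negP; rewrite mulr_natl; exact/negP.
Qed.

Let cvg_box_average g (x : R) : cintble g ->
  lebesgue_pt (fun y => complex.Re (g y)) x ->
  lebesgue_pt (fun y => complex.Im (g y)) x ->
  ((2 * radius n) ^- 2 * cmod (cint (fun y => g y * box (radius n) (x, y))) ^+ 2)
    @[n --> \oo] --> cmod (g x) ^+ 2.
Proof.
move=> [ir ii] lr li; rewrite cmod_sqr.
pose a (h : R -> R) n :=
  (2 * radius n)^-1 * rint (fun y => h y * (if `|x - y| < radius n then 1 else 0)).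
rewrite (_ : (fun n => _) = fun n =>
  a (fun y => complex.Re (g y)) n * a (fun y => complex.Re (g y)) n +
  a (fun y => complex.Im (g y)) n * a (fun y => complex.Im (g y)) n).
  rewrite !expr2; apply: cvgD; apply: cvgM; exact: cvg_average.
apply/funext => n; rewrite cmod_sqr Re_cint Im_cint /a; move: (2 * radius n) => t.
rewrite -!expr2 !exprMn -mulrDr exprVn; congr (_ * (_ ^+ 2 + _ ^+ 2)); apply: eq_rint => y; rewrite /box /=; case: ifP => _.
- by rewrite !mulr1.
- by rewrite !mulr0.
- by rewrite !mulr1.
- by rewrite !mulr0.
Qed.

Let sqr_cmod_le (z : R[i]) (b : R) : cmod z <= b -> cmod z ^+ 2 <= b ^+ 2.
Proof.
move=> zb; rewrite ler_sqr ?nnegrE ?cmod_ge0 //; exact: le_trans (cmod_ge0 _) zb.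
Qed.

(** In the identity above the Fejér weight is at most [8 * radius n ^+ 2], which turns it into a
    bound for the normalised box averages of [g]; Lebesgue differentiation and Fatou then let the
    radius tend to 0. Since [g] is only integrable, square integrability is part of the conclusion
    whenever the right side is finite. *)
Lemma plancherel_lower g (L : R) : cintble g ->
  (forall x, ~~ (0 <= x <= L) -> g x = 0) ->
  (pi%:E * \int[mu]_x (cmod (g x) ^+ 2)%:E <=
   \int[mu]_s (cmod (cint (fun x => g x * cis (2 * s * x))) ^+ 2)%:E)%E.
Proof.
move=> ig gL; pose F (s : R) := cint (fun x => g x * cis (2 * s * x)).
rewrite [leRHS](_ : _ = \int[mu]_s (cmod (F s) ^+ 2)%:E)%E //.
have mg := cintble_meas ig.
pose w (z : R) : R := if -1 < z < L + 1 then 1 else 0.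
pose B n z := cint (fun x => g x * box (radius n) (z, x)).
pose f n z : \bar R := (w z * ((2 * radius n) ^- 2 * cmod (B n z) ^+ 2))%:E.
have mw : measurable_fun setT w by exact: rintble_meas (rintble_itv _ _).
have mB n : cmeas (B n).
  apply: (@cmeas_cint _ _ _ (fun z => g z.2 * box (radius n) z)).
  by apply: cmeasM; [apply: cmeas_comp mg _|exact: cmeas_box].
have mF : cmeas F.
  apply: (@cmeas_cint _ _ _ (fun z : R * R => g z.2 * cis (2 * z.1 * z.2))).
  apply: cmeasM; first by apply: cmeas_comp mg _.
  by apply: cmeas_cis; apply: measurable_funM => //; exact: measurable_funM.
have BF n z : cmod (B n z) <= rint (fun x => cmod (g x)).
  apply: ler_cmod_cint; last 2 first.
  - exact: rintble_cmod.
  - by move=> x; rewrite cmodM ler_piMr // ?cmod_ge0 // cmod_box.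
  apply: (@cintble_le _ _ (fun x => cmod (g x))); last exact: rintble_cmod.
    by apply: cmeasM => //; apply: cmeas_comp (cmeas_box _) _; exact: measurable_pair1.
  by move=> x; rewrite cmodM ler_piMr // ?cmod_ge0 // cmod_box.
have FB s : cmod (F s) <= rint (fun x => cmod (g x)).
  apply: ler_cmod_cint; last 2 first.
  - exact: rintble_cmod.
  - by move=> x; rewrite cmodM cmod_cis mulr1.
  apply: (@cintble_le _ _ (fun x => cmod (g x))); last exact: rintble_cmod.
    by apply: cmeasM => //; apply: cmeas_cis; apply: measurable_funM.
  by move=> x; rewrite cmodM cmod_cis mulr1.
have mf n : measurable_fun setT (f n).
  apply/measurable_EFinP; apply: measurable_funM => //.
  apply: measurable_funM => //; apply: measurable_funX; exact: measurable_cmod.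
have f0 n z : (0 <= f n z)%E.
  rewrite lee_fin mulr_ge0 //; first by rewrite /w; case: ifP.
  by rewrite mulr_ge0 // ?invr_ge0 ?sqr_ge0.
have mF2 : measurable_fun setT (fun s => (cmod (F s) ^+ 2)%:E).
  by apply/measurable_EFinP; apply: measurable_funX; exact: measurable_cmod.
have main n : (pi%:E * \int[mu]_z f n z <= \int[mu]_s (cmod (F s) ^+ 2)%:E)%E.
  have r0 := radius_gt0 n.
  have r1 : radius n <= 1 by rewrite invf_le1 // ler1n.
  have id : rint (fun s => fejer (4 * radius n) s * cmod (F s) ^+ 2) =
      rint (fun z => 2 * pi * w z * cmod (B n z) ^+ 2).
    exact: (box_average_identity ig r0 r1 gL).
  have i1 : rintble (fun s => fejer (4 * radius n) s * cmod (F s) ^+ 2).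
    apply: (@rintble_le _ _ (fun s => rint (fun x => cmod (g x)) ^+ 2 * fejer (4 * radius n) s)).
    - apply: measurable_funM; first exact: rintble_meas (rintble_fejer _).
      by apply: measurable_funX; exact: measurable_cmod.
    - move=> s; rewrite normrM (ger0_norm (fejer_ge0 _ _)) (ger0_norm (sqr_ge0 _)).
      rewrite [leLHS]mulrC; apply: ler_wpM2r; first exact: fejer_ge0.
      exact: sqr_cmod_le (FB s).
    - by apply: rintbleZ; exact: rintble_fejer.
  have i2 : rintble (fun z => 2 * pi * w z * cmod (B n z) ^+ 2).
    apply: (@rintble_le _ _ (fun z => 2 * pi * rint (fun x => cmod (g x)) ^+ 2 * w z)).
    - apply: measurable_funM; first by apply: measurable_funM.
      by apply: measurable_funX; exact: measurable_cmod.
    - move=> s; have w0 : 0 <= w s by rewrite /w; case: ifP.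
      have p2 : 0 <= 2 * pi :> R by rewrite mulr_ge0 // pi_ge0.
      rewrite normrM (ger0_norm (mulr_ge0 p2 w0)) (ger0_norm (sqr_ge0 _)) mulrAC.
      apply: ler_wpM2r => //; apply: ler_wpM2l => //; exact: sqr_cmod_le (BF n s).
    - by apply: rintbleZ; exact: rintble_itv.
  have e1 : (\int[mu]_s (fejer (4 * radius n) s * cmod (F s) ^+ 2)%:E =
     (8 * radius n ^+ 2)%:E * (pi%:E * \int[mu]_z f n z))%E.
    rewrite rintE // id -rintE // muleA -EFinM -ge0_integralZl_EFin //; last first.
      by rewrite mulr_ge0 ?pi_ge0 // mulr_ge0 // sqr_ge0.
      exact: (mf n).
    apply: eq_integral => z _; rewrite -EFinM; congr EFin.
    by move: (w z) (cmod _ ^+ 2) => u v; field; rewrite gt_eqF.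
  have e2 : (\int[mu]_s (fejer (4 * radius n) s * cmod (F s) ^+ 2)%:E <=
     (8 * radius n ^+ 2)%:E * \int[mu]_s (cmod (F s) ^+ 2)%:E)%E.
    rewrite -ge0_integralZl_EFin //; last 2 first.
    - by move=> s _; rewrite lee_fin sqr_ge0.
    - by rewrite mulr_ge0 // sqr_ge0.
    apply: ge0_le_integral => //.
    - by move=> s _; rewrite lee_fin mulr_ge0 ?fejer_ge0 ?sqr_ge0.
    - by apply/measurable_EFinP; exact: rintble_meas i1.
    - exact: measurable_funeM.
    - move=> s _; rewrite -EFinM lee_fin ler_wpM2r ?sqr_ge0 //.
      apply: (le_trans (fejer_le _ _)); rewrite le_eqVlt; apply/orP; left; apply/eqP.
      by field.
  move: e2; rewrite e1 lee_pmul2l // lte_fin mulr_gt0 // exprn_gt0 //.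
have liminf_ge0 z : (0 <= limn_einf (f^~ z))%E.
  rewrite limn_einf_lim; apply: lime_ge; first exact: is_cvg_einfs.
  by apply: nearW => n; apply: le_ereal_inf_tmp => _ [m _ <-]; exact: f0.
have lim : (\int[mu]_x (cmod (g x) ^+ 2)%:E <= limn_einf (fun n => \int[mu]_z f n z))%E.
  apply: le_trans (fatou mu measurableT mf (fun n x _ => f0 n x)).
  apply: ae_ge0_le_integral => //.
  - by move=> x _; rewrite lee_fin sqr_ge0.
  - by apply/measurable_EFinP; apply: measurable_funX; exact: measurable_cmod.
  - apply: measurableT_comp => //; apply: measurable_fun_limn_esup => n.
    exact: (measurableT_comp (@oppe_measurable R setT) (mf n)).
  have := ae_and (lebesgue_differentiation (rintble_locally ig.1))
                 (lebesgue_differentiation (rintble_locally ig.2)).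
  apply: ae_imp => z [lr li] _.
  have [zL|zL] := boolP (-1 < z < L + 1).
    have cv : f n z @[n --> \oo] --> (cmod (g z) ^+ 2)%:E.
      apply: cvg_EFin; first by apply: nearW.
      rewrite /f /w zL; apply: cvg_trans (cvg_box_average ig lr li).
      by apply: near_eq_cvg; apply: nearW => n /=; rewrite mul1r.
    by rewrite (cvg_limn_einf_sup cv).1.
  rewrite gL ?cmod0 ?expr0n /=; last by move: zL; lra.
  exact: liminf_ge0.
have [F1|] := boolP (\int[mu]_s (cmod (F s) ^+ 2)%:E == +oo)%E.
  by rewrite (eqP F1) leey.
rewrite -ltey => Ffin.
rewrite -lee_pdivlMl ?pi_gt0 //; apply: (le_trans lim).
rewrite limn_einf_lim; apply: lime_le; first exact: is_cvg_einfs.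
apply: nearW => n; apply: (@le_trans _ _ (\int[mu]_z f n z)%E).
  by apply: ereal_inf_lbound; exists n => //=.
by rewrite lee_pdivlMl ?pi_gt0.
Qed.

End Plancherel.

(** * Poisson integrals *)

HB.lock Definition poisson (R : realType) (h s : R) : R := h / (pi * (h ^+ 2 + s ^+ 2)).

Section PoissonKernel.
Variable R : realType.
Implicit Types h s w : R.

Lemma poisson_ge0 h s : 0 < h -> 0 <= poisson h s.
Proof.
move=> h0; rewrite poisson.unlock divr_ge0 ?(ltW h0) // mulr_ge0 ?pi_ge0 //.
by rewrite addr_ge0 // sqr_ge0.
Qed.

Let poisson_scale h s : 0 < h -> poisson h (h * s + 0) = (pi * h)^-1 * (1 + s ^+ 2)^-1.
Proof.
move=> h0; rewrite poisson.unlock addr0 exprMn.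
have p0 : pi != 0 :> R by rewrite gt_eqF // pi_gt0.
have q0 : 1 + s ^+ 2 != 0 by rewrite gt_eqF // ltr_pwDl // sqr_ge0.
have hn : h != 0 by rewrite gt_eqF.
have -> : h ^+ 2 + h ^+ 2 * s ^+ 2 = h * h * (1 + s ^+ 2) by ring.
by move: (1 + s ^+ 2) pi p0 q0 => t p p0 q0; field; rewrite p0 q0 hn.
Qed.

Lemma measurable_poisson h : measurable_fun setT (poisson h).
Proof.
rewrite poisson.unlock; apply: measurable_funM => //.
apply: (measurableT_comp (@measurable_invr R)); apply: measurable_funM => //.
by apply: measurable_funD => //; exact: measurable_funX.
Qed.

Lemma rintble_poisson h : 0 < h -> rintble (poisson h).
Proof.
move=> h0; have hV : h^-1 != 0 by rewrite invr_eq0 gt_eqF.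
have -> : poisson h = fun s => (fun t => (pi * h)^-1 * (1 + t ^+ 2)^-1) (h^-1 * s + 0).
  apply/funext => s /=; rewrite -poisson_scale // !addr0 mulrA mulfV ?mul1r //.
  by rewrite gt_eqF.
apply: (@rintble_affine _ h^-1 0 (fun t => (pi * h)^-1 * (1 + t ^+ 2)^-1)) => //.
by apply: rintbleZ; case: (rintble_cauchy R).
Qed.

Lemma rintble_poissonM h (k : R -> R) (B : R) : 0 < h -> measurable_fun setT k ->
  (forall s, `|k s| <= B) -> rintble (fun s => poisson h s * k s).
Proof.
move=> h0 mk kB; apply: (@rintble_le _ _ (fun s => B * poisson h s)).
- by apply: measurable_funM => //; exact: measurable_poisson.
- by move=> s; rewrite normrM (ger0_norm (poisson_ge0 s h0)) mulrC ler_wpM2r // poisson_ge0.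
- by apply: rintbleZ; exact: rintble_poisson.
Qed.

Lemma rint_poisson_cos h w : 0 < h ->
  rint (fun s => poisson h s * cos (w * s)) = expR (- (`|w| * h)).
Proof.
move=> h0; have hn : h != 0 by rewrite gt_eqF.
have p0 : pi != 0 :> R by rewrite gt_eqF // pi_gt0.
rewrite (@rint_affine _ h 0) //; last first.
  apply: (@rintble_poissonM _ _ 1) => //; last by move=> s; exact: cos_max.
  by apply: (measurableT_comp (@measurable_cos R)).
rewrite (@eq_rint _ _ (fun s => (pi * h)^-1 * ((1 + s ^+ 2)^-1 * cos (w * h * s)))); last first.
  by move=> s; rewrite poisson_scale // addr0 mulrA mulrA.
rewrite rintZ; last first.
  apply: (rintble_le _ _ (rintble_cauchy R).1).
    apply: measurable_funM; first exact: rintble_meas (rintble_cauchy R).1.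
    by apply: (measurableT_comp (@measurable_cos R)).
  move=> s; have q0 : 0 <= (1 + s ^+ 2)^-1 by rewrite invr_ge0 addr_ge0 // sqr_ge0.
  by rewrite normrM (ger0_norm q0) ler_piMr // cos_max.
rewrite rint_cauchy_cos normrM (gtr0_norm h0).
by move: (expR _) pi p0 => e p p0; field; rewrite p0 hn.
Qed.

Lemma rint_poisson h : 0 < h -> rint (poisson h) = 1.
Proof.
move=> h0; have := rint_poisson_cos 0 h0; rewrite normr0 mul0r oppr0 expR0 => <-.
by apply: eq_rint => s; rewrite mul0r cos0 mulr1.
Qed.

(** For [w >= 0] the Poisson integral of [exp (i w s)] is its holomorphic continuation; for negative
    frequencies it would be the antiholomorphic one. This is where the upper half-plane enters. *)
Lemma cint_poisson_cis h w : 0 < h -> 0 <= w ->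
  cint (fun s => (poisson h s)%:C * cis (w * s)) = (expR (- (w * h)))%:C.
Proof.
move=> h0 w0; apply: complex_eqP.
  rewrite Re_cint -[in RHS](ger0_norm w0) /= -rint_poisson_cos //.
  by apply: eq_rint => s; rewrite cis.unlock /= mul0r subr0.
rewrite Im_cint /=; pose f s := poisson h s * sin (w * s).
rewrite (@eq_rint _ _ f); last by move=> s; rewrite cis.unlock /= mul0r addr0.
have fi : rintble f.
  apply: (@rintble_poissonM _ _ 1) => //; last by move=> s; exact: sin_max.
  by apply: (measurableT_comp (@measurable_sin R)).
have := rint_affine 0 (_ : -1 != 0 :> R) fi.
rewrite oppr_eq0 oner_eq0 => /(_ isT).
rewrite (@eq_rint _ (fun x => f (-1 * x + 0)) (fun s => - f s)); last first.
  by move=> s; rewrite /f addr0 mulN1r poisson.unlock !mulrN sinN sqrrN mulrN.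
by rewrite rintN // normrN1 mul1r; lra.
Qed.

(** Jensen's inequality for the probability density [poisson h], read off from the nonnegative
    variance. *)
Lemma sqr_rint_poisson h (k : R -> R) (B : R) : 0 < h -> measurable_fun setT k ->
  (forall s, `|k s| <= B) ->
  rint (fun s => poisson h s * k s) ^+ 2 <= rint (fun s => poisson h s * k s ^+ 2).
Proof.
move=> h0 mk kB; set m := rint (fun s => _).
have i1 := rintble_poissonM h0 mk kB.
have i2 : rintble (fun s => poisson h s * k s ^+ 2).
  apply: (@rintble_poissonM _ _ (B ^+ 2)) => //; first exact: measurable_funX.
  by move=> s; rewrite normrX lerXn2r ?nnegrE // (le_trans (normr_ge0 _) (kB s)).
have : 0 <= rint (fun s => poisson h s * (k s - m) ^+ 2).
  by apply: rint_ge0 => s; rewrite mulr_ge0 ?sqr_ge0 // poisson_ge0.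
rewrite (@eq_rint _ _ (fun s => poisson h s * k s ^+ 2 +
    (- (2 * m) * (poisson h s * k s) + m ^+ 2 * poisson h s))); last first.
  by move=> s; ring.
rewrite rintD //; last first.
  by apply: rintbleD; apply: rintbleZ => //; exact: rintble_poisson.
rewrite rintD; [|by apply: rintbleZ..|by apply: rintbleZ; exact: rintble_poisson].
rewrite !rintZ //; last exact: rintble_poisson.
by rewrite rint_poisson // -/m; nra.
Qed.

End PoissonKernel.

Section PoissonClass.
Variables (R : realType) (s0 b h : R).
Hypotheses (b0 : 0 <= b) (h0 : 0 < h).
Notation mu := (@lebesgue_measure R).
Implicit Types F G : R[i] -> R[i].

Let z0 : R[i] := s0 +i* (b + h).

Definition line_bounded F := cmeas (fun s : R => F (s +i* b)) /\
  exists B : R, forall s : R, cmod (F (s +i* b)) <= B.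

Definition poisson_value F : R[i] :=
  cint (fun s => (poisson h s)%:C * F ((s0 + s) +i* b)).

(** Quantifying over the frequency [w] makes the condition invariant under multiplication by
    exponentials, since two exponentials merge into one. This is the only product that has to be
    checked by computation. *)
Definition poisson_stable F := line_bounded F /\ forall w : R, 0 <= w ->
  poisson_value (fun r => ce r w * F r) = ce z0 w * F z0.

(* Multipliers of [poisson_stable]: an algebra of functions reproduced by the
   Poisson integral, which unlike [poisson_stable] is visibly closed under products. *)
Definition poisson_algebra F := line_bounded F /\
  forall G, poisson_stable G -> poisson_stable (fun r => F r * G r).

Lemma line_boundedM F G : line_bounded F -> line_bounded G ->
  line_bounded (fun r => F r * G r).
Proof.
move=> [mF [B FB]] [mG [C GC]]; split; first exact: cmeasM.
by exists (B * C) => s; rewrite cmodM ler_pM ?cmod_ge0.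
Qed.

Lemma line_boundedD F G : line_bounded F -> line_bounded G ->
  line_bounded (fun r => F r + G r).
Proof.
move=> [mF [B FB]] [mG [C GC]]; split; first exact: cmeasD.
by exists (B + C) => s; rewrite (le_trans (ler_cmodD _ _)) // lerD.
Qed.

Lemma line_bounded_ce w : 0 <= w -> line_bounded (fun r => ce r w).
Proof.
move=> w0; split.
  by apply: cmeas_ce => //; apply: cmeas_pair => //; exact: measurable_cst.
by exists 1 => s; rewrite cmod_ce_le1.
Qed.

Lemma cintble_poisson F : line_bounded F ->
  cintble (fun s => (poisson h s)%:C * F ((s0 + s) +i* b)).
Proof.
move=> [mF [B FB]]; apply: (@cintble_le _ _ (fun s => B * poisson h s)).
- apply: cmeasM; first by apply: cmeas_real; exact: measurable_poisson.
  apply: (@cmeas_comp R _ _ _ _ (fun s : R => F (s +i* b)) (fun s => s0 + s)) => //.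
  by apply: measurable_funD.
- move=> s; rewrite cmodM cmod_real (ger0_norm (poisson_ge0 _ h0)) mulrC.
  by rewrite ler_wpM2r // poisson_ge0.
- by apply: rintbleZ; exact: rintble_poisson.
Qed.

Lemma cmod_poisson_value F (B : R) : line_bounded F ->
  (forall s : R, cmod (F (s +i* b)) <= B) -> cmod (poisson_value F) <= B.
Proof.
move=> lF FB; rewrite -[leRHS]mulr1 -(rint_poisson h0) -rintZ; last exact: rintble_poisson.
apply: ler_cmod_cint; first exact: cintble_poisson.
  by apply: rintbleZ; exact: rintble_poisson.
move=> s; rewrite cmodM cmod_real (ger0_norm (poisson_ge0 _ h0)) mulrC.
by rewrite ler_wpM2r // poisson_ge0.
Qed.

Lemma poisson_valueD F G : line_bounded F -> line_bounded G ->
  poisson_value (fun r => F r + G r) = poisson_value F + poisson_value G.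
Proof.
move=> lF lG; rewrite /poisson_value -cintD; [|exact: cintble_poisson..].
by apply: eq_cint => s; rewrite mulrDr.
Qed.

Lemma poisson_stable1 : poisson_stable (fun=> 1).
Proof.
split; first by split; [exact: cmeas_cst|exists 1 => s; rewrite cmod1].
move=> w w0; rewrite /poisson_value mulr1.
rewrite (@eq_cint _ _ (fun s => ce (s0 +i* b) w * ((poisson h s)%:C * cis (w * s)))); last first.
  by move=> s; rewrite mulr1 ce.unlock /= mulrDl cisD [s * w]mulrC; ring.
rewrite cintZ; last first.
  apply: (@cintble_le _ _ (poisson h)); last exact: rintble_poisson.
    by apply: cmeasM; [apply: cmeas_real; exact: measurable_poisson|apply: cmeas_cis].
  by move=> s; rewrite cmodM cmod_cis cmod_real (ger0_norm (poisson_ge0 _ h0)) mulr1.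
rewrite cint_poisson_cis // ce.unlock /= mulrDl opprD expRD rmorphM /= [h * w]mulrC; ring.
Qed.

Lemma poisson_algebra_stable F : poisson_algebra F -> poisson_stable F.
Proof.
move=> [lF /(_ _ poisson_stable1)].
by rewrite (_ : (fun r => F r * 1) = F) //; apply/funext => r; rewrite mulr1.
Qed.

Lemma poisson_algebra_value F : poisson_algebra F -> poisson_value F = F z0.
Proof.
move=> /poisson_algebra_stable[lF /(_ _ (lexx 0))].
rewrite ce0 mul1r => <-; apply: eq_cint => s.
by rewrite ce0 mul1r.
Qed.

Lemma poisson_algebra_ce w : 0 <= w -> poisson_algebra (fun r => ce r w).
Proof.
move=> w0; split; first exact: line_bounded_ce.
move=> G [lG GE]; split; first by apply: line_boundedM => //; exact: line_bounded_ce.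
move=> v v0; rewrite mulrA -ceD -GE ?addr_ge0 //.
by apply: eq_cint => s; rewrite ceD; ring.
Qed.

Lemma poisson_algebra_cst (c : R[i]) : poisson_algebra (fun=> c).
Proof.
have lc : line_bounded (fun=> c) by split; [exact: cmeas_cst|exists (cmod c)].
split => // G [lG GE]; split; first exact: line_boundedM.
move=> v v0; rewrite mulrCA -(GE _ v0) /poisson_value -cintZ; last first.
  apply: (@cintble_poisson (fun r => ce r v * G r)).
  by apply: line_boundedM => //; exact: line_bounded_ce.
by apply: eq_cint => s; ring.
Qed.

Lemma poisson_algebraM F G : poisson_algebra F -> poisson_algebra G ->
  poisson_algebra (fun r => F r * G r).
Proof.
move=> [lF HF] [lG HG]; split; first exact: line_boundedM.
move=> K HK; have := HF _ (HG _ HK).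
by rewrite (_ : (fun r => F r * (G r * K r)) = (fun r => F r * G r * K r)) //;
  apply/funext => r; rewrite mulrA.
Qed.

Lemma poisson_algebraD F G : poisson_algebra F -> poisson_algebra G ->
  poisson_algebra (fun r => F r + G r).
Proof.
move=> [lF HF] [lG HG]; split; first exact: line_boundedD.
move=> K HK; have [lFK EF] := HF _ HK; have [lGK EG] := HG _ HK.
split; first by apply: line_boundedM; [exact: line_boundedD|case: HK].
move=> w w0; have lw := line_bounded_ce w0.
rewrite mulrDl mulrDr -EF // -EG // -poisson_valueD; [|exact: line_boundedM..].
by apply: eq_cint => s; ring.
Qed.

Lemma poisson_algebra_sum I (s : seq I) (P : pred I) (F : I -> R[i] -> R[i]) :
  (forall i, P i -> poisson_algebra (F i)) ->
  poisson_algebra (fun r => \sum_(i <- s | P i) F i r).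
Proof.
move=> HF; elim: s => [|i s IH].
  by under eq_fun do rewrite big_nil; exact: poisson_algebra_cst.
under eq_fun do rewrite big_cons.
case Pi: (P i) => //; apply: poisson_algebraD => //; exact: HF.
Qed.

Lemma poisson_algebra_prod I (s : seq I) (P : pred I) (F : I -> R[i] -> R[i]) :
  (forall i, P i -> poisson_algebra (F i)) ->
  poisson_algebra (fun r => \prod_(i <- s | P i) F i r).
Proof.
move=> HF; elim: s => [|i s IH].
  by under eq_fun do rewrite big_nil; exact: poisson_algebra_cst.
under eq_fun do rewrite big_cons.
case Pi: (P i) => //; apply: poisson_algebraM => //; exact: HF.
Qed.

(** Fubini between the Poisson integral and the integral over the parameter. The bounds concern only
    the line and the point [z0], the places where membership inspects a function. *)
Lemma poisson_algebra_int (q : R -> R[i]) (F : R -> R[i] -> R[i]) (B : R) :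
  cintble q -> (forall t, poisson_algebra (F t)) ->
  (forall t s, cmod (F t (s +i* b)) <= B) -> (forall t, cmod (F t z0) <= B) ->
  cmeas (fun z : R * R => F z.1 (z.2 +i* b)) -> cmeas (fun t => F t z0) ->
  poisson_algebra (fun r => cint (fun t => q t * F t r)).
Proof.
move=> iq HF FB F0B mF mF0; have mq := cintble_meas iq.
have iaq := rintble_cmod iq.
have mFt t : cmeas (fun s => F t (s +i* b)) by case: (HF t) => -[].
have mFs s : cmeas (fun t => F t (s +i* b)).
  exact: (cmeas_comp mF (measurable_pair2 s)).
have iqF s : cintble (fun t => q t * F t (s +i* b)).
  apply: (@cintble_le _ _ (fun t => B * cmod (q t))); last exact: rintbleZ.
    exact: cmeasM.
  by move=> t; rewrite cmodM mulrC ler_wpM2r ?cmod_ge0.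
have iqF0 : cintble (fun t => q t * F t z0).
  apply: (@cintble_le _ _ (fun t => B * cmod (q t))); last exact: rintbleZ.
    exact: cmeasM.
  by move=> t; rewrite cmodM mulrC ler_wpM2r ?cmod_ge0.
have lQ : line_bounded (fun r => cint (fun t => q t * F t r)).
  split.
    apply: (@cmeas_cint _ _ _ (fun z : R * R => q z.2 * F z.2 (z.1 +i* b))).
    apply: cmeasM; first by apply: cmeas_comp mq _.
    apply: (@cmeas_comp _ _ _ _ _ (fun z : R * R => F z.1 (z.2 +i* b)) (fun z => (z.2, z.1)) mF).
    by apply: measurable_fun_pair.
  exists (rint (fun t => B * cmod (q t))) => s.
  apply: ler_cmod_cint => //; first exact: rintbleZ.
  by move=> t; rewrite cmodM mulrC ler_wpM2r ?cmod_ge0.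
split => // G HG; have [lG GE] := HG; split; first exact: line_boundedM.
move=> w w0; have lw := line_bounded_ce w0.
have lH := line_boundedM lw lG; have [mH [C HC]] := lH.
pose H (s : R) := ce ((s0 + s) +i* b) w * G ((s0 + s) +i* b).
have mHs : cmeas H.
  apply: (@cmeas_comp _ _ _ _ _ (fun s : R => ce (s +i* b) w * G (s +i* b)) (fun s => s0 + s)) => //.
  exact: measurable_funD.
have HsC s : cmod (H s) <= C by exact: HC.
transitivity (cint (fun s => cint (fun t =>
    ((poisson h s)%:C * H s) * (q t * F t ((s0 + s) +i* b))))).
  by apply: eq_cint => s; rewrite cintZ // /H; ring.
rewrite (@cint_swap _ (fun z => ((poisson h z.1)%:C * H z.1) * (q z.2 * F z.2 ((s0 + z.1) +i* b)))
  (fun s => C * poisson h s) (fun t => B * cmod (q t))); last first.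
- exact: rintbleZ.
- by apply: rintbleZ; exact: rintble_poisson.
- move=> s t /=; rewrite !cmodM cmod_real (ger0_norm (poisson_ge0 _ h0)) -cmodM.
  apply: ler_pM; rewrite ?mulr_ge0 ?cmod_ge0 ?poisson_ge0 //.
    by rewrite mulrC ler_wpM2r // poisson_ge0.
  by rewrite mulrC ler_wpM2r // cmod_ge0.
- apply: cmeasM; apply: cmeasM.
  + apply: cmeas_real; exact: (measurableT_comp (measurable_poisson h)).
  + exact: (cmeas_comp mHs).
  + exact: (cmeas_comp mq).
  + apply: (@cmeas_comp _ _ _ _ _ (fun z : R * R => F z.1 (z.2 +i* b))
      (fun z : R * R => (z.2, s0 + z.1)) mF).
    by apply: measurable_fun_pair => //; exact: measurable_funD.
rewrite (@eq_cint _ _ (fun t => (ce z0 w * G z0) * (q t * F t z0))); last first.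
  move=> t /=; have [_ /(_ _ w0) FE] := (HF t).2 _ HG.
  transitivity (q t * poisson_value (fun r => ce r w * (F t r * G r))); last first.
    by rewrite FE; ring.
  rewrite /poisson_value -cintZ; first by apply: eq_cint => s; rewrite /H; ring.
  apply: (@cintble_poisson (fun r => ce r w * (F t r * G r))).
  by apply: line_boundedM => //; apply: line_boundedM => //; case: (HF t).
by rewrite cintZ //; ring.
Qed.

(** Poisson averaging does not increase the supremum on the line, so both sides of the reproducing
    identity pass to a limit that is uniform on the line and at [z0]. *)
Lemma poisson_algebra_lim (F : nat -> R[i] -> R[i]) (G : R[i] -> R[i]) (e : nat -> R) :
  (forall n, poisson_algebra (F n)) -> e n @[n --> \oo] --> 0 ->
  (forall n s, cmod (F n (s +i* b) - G (s +i* b)) <= e n) ->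
  (forall n, cmod (F n z0 - G z0) <= e n) ->
  poisson_algebra G.
Proof.
move=> HF /cvgrPdist_lt ce0' FG FG0.
have small (d : R) : 0 < d -> exists N, forall n, (N <= n)%N -> e n < d.
  move=> /ce0'[N _ HN]; exists N => n /HN /=; rewrite sub0r normrN.
  exact: le_lt_trans (ler_norm _).
have lG : line_bounded G.
  split.
    apply: (@cmeas_cvg _ _ _ (fun n s => F n (s +i* b))) => [n|s d d0].
      by case: (HF n) => -[].
    by have [N HN] := small d d0; exists N => n /HN; exact: le_lt_trans.
  have [N HN] := small 1 ltr01; case: (HF N) => -[_ [B FB]] _.
  exists (B + 1) => s; rewrite -[G _](subKr (F N (s +i* b))).
  by rewrite (le_trans (ler_cmodB _ _)) // lerD // (le_trans (FG N s)) // ltW // HN.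
split => // K HK; have [lK _] := HK; split; first exact: line_boundedM.
move=> w w0; have lw := line_bounded_ce w0; have [_ [C KC]] := lK.
have C0 : 0 <= C by exact: le_trans (cmod_ge0 _) (KC 0).
set D := C + cmod (ce z0 w * K z0).
have D0 : 0 <= D by rewrite addr_ge0 // cmod_ge0.
set lhs := poisson_value _; set rhs := ce z0 w * _.
suff H n : cmod (lhs - rhs) <= e n * D.
  apply/eqP; rewrite -subr_eq0 -cmod_eq0 eq_le cmod_ge0 andbT.
  apply/ler_addgt0Pr => d d0; rewrite add0r.
  have [N HN] := small (d / (D + 1)) (divr_gt0 d0 (ltr_wpDl D0 ltr01)).
  apply: (le_trans (H N)); apply: (@le_trans _ _ (d / (D + 1) * D)).
    by rewrite ler_wpM2r // ltW // HN.
  by rewrite -mulrA ler_piMr ?(ltW d0) // mulrC ler_pdivrMr ?mul1r ?lerDl // ltr_wpDl.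
have [lFn HFn] := HF n; have [_ /(_ _ w0) En] := HFn _ HK.
have e0 : 0 <= e n by exact: le_trans (cmod_ge0 _) (FG0 n).
have -> : lhs - rhs = - poisson_value (fun r => ce r w * ((F n r - G r) * K r)) +
    (F n z0 - G z0) * (ce z0 w * K z0).
  have ldiff : line_bounded (fun r => F n r - G r).
    have -> : (fun r => F n r - G r) = (fun r => F n r + (fun=> -1) r * G r).
      by apply/funext => r; rewrite mulN1r.
    apply: line_boundedD => //; apply: line_boundedM => //.
    by split; [exact: cmeas_cst|exists (cmod (-1 : R[i]))].
  have -> : (F n z0 - G z0) * (ce z0 w * K z0) = ce z0 w * (F n z0 * K z0) - rhs.
    by rewrite /rhs; ring.
  rewrite -En (_ : poisson_value (fun r => ce r w * (F n r * K r)) =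
    poisson_value (fun r => ce r w * ((F n r - G r) * K r)) + lhs); first by ring.
  rewrite /lhs -poisson_valueD; last 2 first.
  - by apply: line_boundedM => //; exact: line_boundedM.
  - by apply: line_boundedM => //; exact: line_boundedM.
  by apply: eq_cint => s; ring.
rewrite (le_trans (ler_cmodD _ _)) // cmodN /D mulrDr lerD //; last first.
  by rewrite cmodM ler_wpM2r // cmod_ge0.
apply: cmod_poisson_value.
  apply: line_boundedM => //; apply: line_boundedM => //.
  have -> : (fun r => F n r - G r) = (fun r => F n r + (fun=> -1) r * G r).
    by apply/funext => r; rewrite mulN1r.
  apply: line_boundedD => //; apply: line_boundedM => //.
  by split; [exact: cmeas_cst|exists (cmod (-1 : R[i]))].
move=> s; rewrite !cmodM -[leRHS]mul1r ler_pM ?mulr_ge0 ?cmod_ge0 //.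
  by rewrite cmod_ce_le1.
by rewrite ler_pM ?cmod_ge0.
Qed.

End PoissonClass.

Section HeightShift.
Variable R : realType.
Notation mu := (@lebesgue_measure R).

(** Jensen bounds [|F|^2] at height [b + h] by the Poisson average of [|F|^2] at height [b];
    integrating over the base point and exchanging the integrals leaves the mass 1 of the kernel. *)
Lemma height_shift (b h : R) (F : R[i] -> R[i]) : 0 <= b -> 0 < h ->
  (forall s0, poisson_algebra s0 b h F) ->
  (\int[mu]_s (cmod (F (s +i* (b + h))) ^+ 2)%:E <=
   \int[mu]_s (cmod (F (s +i* b)) ^+ 2)%:E)%E.
Proof.
move=> b0 h0 HF; have [[mF [B FB]] _] := HF 0.
have mc : measurable_fun setT (fun s : R => cmod (F (s +i* b))) by exact: measurable_cmod.
pose K (z : R * R) : \bar R := (poisson h z.2 * cmod (F ((z.1 + z.2) +i* b)) ^+ 2)%:E.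
have mcs s0 : measurable_fun setT (fun s : R => cmod (F ((s0 + s) +i* b))).
  apply: (measurableT_comp (f := fun s : R => cmod (F (s +i* b))) (g := fun s => s0 + s)) => //.
  exact: measurable_funD.
have mK : measurable_fun setT K.
  apply/measurable_EFinP; apply: measurable_funM.
    exact: (measurableT_comp (measurable_poisson h)).
  apply: measurable_funX.
  apply: (measurableT_comp (f := fun s : R => cmod (F (s +i* b))) (g := fun z : R * R => z.1 + z.2)) => //.
  exact: measurable_funD.
have K0 z : (0 <= K z)%E by rewrite lee_fin mulr_ge0 ?sqr_ge0 ?poisson_ge0.
have pointwise s0 : ((cmod (F (s0 +i* (b + h))) ^+ 2)%:E <= \int[mu]_s K (s0, s))%E.
  rewrite -(poisson_algebra_value h0 (HF s0)).
  have kB s : `|cmod (F ((s0 + s) +i* b))| <= B by rewrite ger0_norm ?cmod_ge0.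
  have i2 : rintble (fun s => poisson h s * cmod (F ((s0 + s) +i* b)) ^+ 2).
    apply: (@rintble_poissonM _ _ _ (B ^+ 2)) => //; first exact: measurable_funX.
    by move=> s; rewrite normrX lerXn2r ?nnegrE // (le_trans (normr_ge0 _) (kB s)).
  rewrite rintE // lee_fin; apply: le_trans (sqr_rint_poisson h0 (mcs s0) kB).
  rewrite ler_sqr ?nnegrE ?cmod_ge0 //; last first.
    by apply: rint_ge0 => s; rewrite mulr_ge0 ?cmod_ge0 ?poisson_ge0.
  apply: ler_cmod_cint.
  - exact: (cintble_poisson s0 h0 (HF s0).1).
  - exact: (rintble_poissonM h0 (mcs s0) kB).
  - by move=> s; rewrite cmodM cmod_real (ger0_norm (poisson_ge0 _ h0)).
have mFh : measurable_fun setT (fun s : R => (cmod (F (s +i* (b + h))) ^+ 2)%:E).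
  apply/measurable_EFinP; apply: measurable_funX; apply: measurable_cmod.
  rewrite (_ : (fun s : R => _) = fun s0 => cint (fun s => (poisson h s)%:C * F ((s0 + s) +i* b))); last first.
    by apply/funext => s0; rewrite -(poisson_algebra_value h0 (HF s0)).
  apply: (@cmeas_cint _ _ _ (fun z : R * R => (poisson h z.2)%:C * F ((z.1 + z.2) +i* b))).
  apply: cmeasM.
    by apply: cmeas_real; exact: (measurableT_comp (measurable_poisson h)).
  apply: (@cmeas_comp _ _ _ _ _ (fun s : R => F (s +i* b)) (fun z : R * R => z.1 + z.2)) => //.
  exact: measurable_funD.
apply: (@le_trans _ _ (\int[mu]_s0 \int[mu]_s K (s0, s))%E).
  apply: ge0_le_integral => //.
  - by move=> s _; rewrite lee_fin sqr_ge0.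
  - exact: (@measurable_fun_fubini_tonelli_F _ _ _ _ _ mu K mK K0).
rewrite (fubini_tonelli (m1 := mu) (m2 := mu)) //.
set I := (\int[mu]_s (cmod (F (s +i* b)) ^+ 2)%:E)%E.
have m2 : measurable_fun setT (fun s : R => (cmod (F (s +i* b)) ^+ 2)%:E).
  by apply/measurable_EFinP; exact: measurable_funX.
have inner s : (\int[mu]_s0 K (s0, s) = I * (poisson h s)%:E)%E.
  rewrite /K /=; under eq_integral do rewrite EFinM.
  rewrite ge0_integralZl_EFin //; last 3 first.
  - by move=> x _; rewrite lee_fin sqr_ge0.
  - apply/measurable_EFinP; apply: measurable_funX.
    by under eq_fun do rewrite addrC; exact: (mcs s).
  - exact: poisson_ge0.
  rewrite muleC; congr (_ * _)%E.
  rewrite /I (@ge0_integral_affine _ 1 s) ?oner_eq0 //; last by move=> x; rewrite lee_fin sqr_ge0.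
  by rewrite normr1 mul1e; apply: eq_integral => x _; rewrite mul1r.
under eq_integral do rewrite inner.
rewrite ge0_integralZl //.
- by rewrite rintE ?rint_poisson ?mule1 //; exact: rintble_poisson.
- by apply/measurable_EFinP; exact: measurable_poisson.
- by move=> s _; rewrite lee_fin poisson_ge0.
- by apply: integral_ge0 => s _; rewrite lee_fin sqr_ge0.
Qed.

End HeightShift.

(** * Absolutely continuous functions *)

Section AbsolutelyContinuous.
Variable R : realType.
Notation mu := (@lebesgue_measure R).
Implicit Types f g : R -> R[i].

Let derive0_near (u : R -> R) (x e : R) : is_derive x 1 u 0 -> 0 < e ->
  exists2 d : R, 0 < d & forall y, `|y - x| < d -> `|u y - u x| <= e * `|y - x|.
Proof.
move=> [du Du] e0.
have : (fun h => h^-1 *: (u (h *: 1 + x) - u x)) @ 0^' --> 'D_1 u x by exact: du.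
rewrite Du => /cvgrPdist_le/(_ _ e0) [d /= d0 Hd]; exists d => // y yx.
have [->|nyx] := eqVneq y x; first by rewrite !subrr normr0 mulr0.
have n0 : y - x != 0 by rewrite subr_eq0.
have := Hd (y - x); rewrite /= sub0r normrN => /(_ yx n0).
rewrite sub0r normrN /GRing.scale /= mulr1 subrK normrM normfV.
by rewrite mulrC ler_pdivrMr // normr_gt0.
Qed.

Lemma Cderive0_near f (x e : R) : is_Cderive x f 0 -> 0 < e ->
  exists2 d : R, 0 < d & forall y, `|y - x| < d -> cmod (f y - f x) <= e * `|y - x|.
Proof.
move=> [dr di] e0; have e2 : 0 < e / 2 by rewrite divr_gt0.
have [d1 d10 H1] := derive0_near dr e2; have [d2 d20 H2] := derive0_near di e2.
exists (Num.min d1 d2) => [|y]; first by rewrite lt_min d10.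
rewrite lt_min => /andP[/H1 h1 /H2 h2]; apply: (le_trans (cmod_le_Re_Im _)).
rewrite cReD cReN cImD cImN; move: h1 h2; lra.
Qed.

Section ZeroDerivative.
Variables (a b : R) (f : R -> R[i]) (O : set R) (e : R).
Hypotheses (ab : a < b) (oO : open O) (e0 : 0 < e).
Hypothesis Hf : forall x, a <= x <= b -> ~ O x ->
  exists2 d : R, 0 < d & forall y, `|y - x| < d -> cmod (f y - f x) <= e * `|y - x|.

(** Up to [x], the increment of [f] is paid for by the slope [e] and by the increments over finitely
    many disjoint intervals whose total length is charged to the part of [O] left of [x]. The list
    runs from right to left, a new interval being put at its head. *)
Let good (x : R) := a <= x <= b /\ exists l : seq (R * R),
  [/\ forall p, p \in l -> [/\ a <= p.1, p.1 <= p.2 & p.2 <= x],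
      pairwise (fun p p' => p'.2 <= p.1) l,
      ((\sum_(p <- l) (p.2 - p.1))%:E <= mu (O `&` `]a, x[))%E &
      cmod (f x - f a) <= e * (x - a) + \sum_(p <- l) cmod (f p.2 - f p.1)].

Let good_left : good a.
Proof.
split; first by rewrite lexx ltW.
exists [::]; split => //; rewrite ?big_nil //.
by rewrite !subrr mulr0 addr0 cmod0.
Qed.

Let good_small (x y : R) : good x -> x <= y -> y <= b ->
  cmod (f y - f x) <= e * (y - x) -> good y.
Proof.
move=> [/andP[ax xb] [l [l1 l2 l3 l4]]] xy yb fxy; split.
  by rewrite yb (le_trans ax xy).
exists l; split => //.
- by move=> p /l1[? ? ?]; split => //; exact: le_trans xy.
- apply: (le_trans l3); apply: le_measure; rewrite ?inE.
  + by apply: measurableI => //; exact: open_measurable.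
  + by apply: measurableI => //; exact: open_measurable.
  + by apply: setIS; apply: subset_itvl; rewrite bnd_simp.
- rewrite (_ : f y - f a = (f y - f x) + (f x - f a)); last by ring.
  by apply: (le_trans (ler_cmodD _ _)); lra.
Qed.

(** Inside [O] nothing is known about the slope, so the whole interval is recorded; its length is
    available because [O] contains it and it is disjoint from the part already used. *)
Let good_open (x y : R) : good x -> x <= y -> y <= b ->
  `]x, y[ `<=` O -> good y.
Proof.
move=> [/andP[ax xb] [l [l1 l2 l3 l4]]] xy yb xyO; split.
  by rewrite yb (le_trans ax xy).
exists ((x, y) :: l); split.
- by move=> p; rewrite inE => /predU1P[->|/l1[? ? ?]]; split => //=; exact: le_trans xy.
- rewrite /= l2 andbT; apply/allP => p /l1[_ _]; exact.
- rewrite big_cons /= EFinD.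
  have mO := open_measurable oO.
  apply: (@le_trans _ _ (mu (`]x, y[ `|` (O `&` `]a, x[)))%E).
    rewrite measureU //; last 2 first.
    + exact: measurableI.
    + apply/seteqP; split => // z /=; rewrite !in_itv /= => -[/andP[z1 _] [_ /andP[_ z2]]].
      by move: (lt_trans z1 z2); rewrite ltxx.
    have ml : mu `]x, y[ = (y - x)%:E.
      rewrite lebesgue_measure_itv /= lte_fin; case: ltP => // yx.
      by have -> : y = x by [apply/le_anti; rewrite yx]; rewrite subrr.
    by apply: leeD; [rewrite -ml|].
  apply: le_measure; rewrite ?inE.
  + by apply: measurableU => //; exact: measurableI.
  + exact: measurableI.
  + move=> z [/= zxy|[Oz /= zax]].
      split; first exact: xyO.
      by move: zxy; rewrite /= !in_itv /= => /andP[xz ->]; rewrite (le_lt_trans ax xz).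
    split => //; move: zax; rewrite /= !in_itv /= => /andP[-> zx].
    exact: lt_le_trans zx xy.
- rewrite big_cons /= (_ : f y - f a = (f y - f x) + (f x - f a)); last by ring.
  apply: (le_trans (ler_cmodD _ _)).
  have : e * (x - a) <= e * (y - a) by rewrite ler_pM2l // lerD2r.
  by move: l4; lra.
Qed.

(** One of the two points has to be [c] itself, because the slope condition only compares values
    with the value at [c]. *)
Let good_step (c : R) : a <= c <= b -> exists2 d : R, 0 < d & forall x y,
  x <= c -> c <= y -> y <= b -> c - d < x -> y < c + d -> good x -> (x = c \/ y = c) ->
  good y.
Proof.
move=> cab; have [Oc|nOc] := pselect (O c).
  have [d d0 dO] : exists2 d : R, 0 < d & ball c d `<=` O.
    by have /nbhs_ballP[d d0 dO] := open_nbhs_nbhs (conj oO Oc); exists d.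
  exists d => // x y xc cy yb xd yd gx _; apply: (good_open gx) => //.
    exact: le_trans cy.
  move=> z /=; rewrite in_itv /= => /andP[xz zy]; apply: dO.
  by rewrite /ball /= ltr_norml; lra.
have [d d0 Hd] := Hf cab nOc; exists d => // x y xc cy yb xd yd gx [E|E].
  subst x; apply: (good_small gx) => //.
  by rewrite -(ger0_norm (_ : 0 <= y - c)) ?subr_ge0 //; apply: Hd; rewrite ltr_norml; lra.
subst y; apply: (good_small gx) => //.
rewrite -cmodN opprB -(ger0_norm (_ : 0 <= c - x)) ?subr_ge0 // distrC.
by apply: Hd; rewrite ltr_norml; lra.
Qed.

(** At the supremum of the good points the local step is used twice: first to reach the supremum
    from the left, then to pass beyond it unless it is [b]. *)
Let good_right : good b.
Proof.
pose S := [set x | good x]; pose c := sup S.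
have Sa : S a by exact: good_left.
have Sb : ubound S b by move=> x [/andP[]].
have hS : has_sup S by split; [exists a|exists b].
have ac : a <= c by apply: ub_le_sup => //; exists b.
have cb : c <= b by apply: ge_sup => //; exists a.
have cab : a <= c <= b by rewrite ac.
have [d d0 Hd] := good_step cab.
have [x Sx xd] := sup_adherent d0 hS.
have xc : x <= c by apply: ub_le_sup => //; exists b.
have gc : good c.
  by apply: (Hd x c) => //; [rewrite ltrDl|right].
move: cb; rewrite le_eqVlt => /predU1P[<- //|cb].
pose y := Num.min b (c + d / 2).
have cy : c < y by rewrite lt_min cb ltrDl divr_gt0.
have gy : good y.
  apply: (Hd c y) => //; rewrite ?ge_min ?lexx ?(ltW cy) //; [lra| |by left].
  by rewrite gt_min; apply/orP; right; rewrite ltrD2l; lra.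
have : y <= c by apply: ub_le_sup => //; exists b.
by rewrite leNgt cy.
Qed.

Lemma intervals_in_open : exists (m : nat) (s t : 'I_m -> R),
  [/\ forall i, [/\ a <= s i, s i <= t i & t i <= b],
      trivIset setT (fun i => `]s i, t i[%classic),
      ((\sum_(i < m) (t i - s i))%:E <= mu O)%E &
      cmod (f b - f a) <= e * (b - a) + \sum_(i < m) cmod (f (t i) - f (s i))].
Proof.
have [_ [l [l1 l2 l3 l4]]] := good_right.
pose x0 : R * R := (0, 0).
exists (size l), (fun i => (nth x0 l i).1), (fun i => (nth x0 l i).2); split.
- by move=> i; apply: l1; exact: mem_nth.
- have H (i j : 'I_(size l)) : (i < j)%N ->
      `](nth x0 l i).1, (nth x0 l i).2[%classic `&` `](nth x0 l j).1, (nth x0 l j).2[%classic = set0.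
    move=> ij; apply/seteqP; split => // z /=; rewrite !in_itv /= => -[/andP[z1 _] /andP[_ z2]].
    have := pairwiseP x0 l2 i j; rewrite !inE => /(_ (ltn_ord i) (ltn_ord j) ij) H.
    by move: (lt_le_trans z2 H) => /(lt_trans z1); rewrite ltxx.
  apply/trivIsetP => i j _ _ ij; have [lij|lji|/val_inj eij] := ltngtP i j.
  + exact: H.
  + by rewrite setIC; exact: H.
  + by rewrite eij eqxx in ij.
- rewrite (big_nth x0) big_mkord in l3; apply: (le_trans l3).
  apply: le_measure; rewrite ?inE; [|exact: open_measurable|exact: subIsetl].
  by apply: measurableI => //; exact: open_measurable.
- by rewrite (big_nth x0) big_mkord in l4.
Qed.

End ZeroDerivative.

(* A Cousin-type covering argument: near a.e. point f varies by at most e times the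
   length, and the exceptional null set is covered by an open set of small measure,
   over which absolute continuity bounds the variation. *)
Lemma AC_zero_derive (a b : R) f : a < b -> abs_continuous a b f ->
  {ae mu, forall x, a < x < b -> is_Cderive x f 0} -> f b = f a.
Proof.
move=> ab acf [N [mN N0 fN]].
apply/eqP; rewrite -subr_eq0 -cmod_eq0 eq_le cmod_ge0 andbT.
apply/ler_addgt0Pr => eps eps0; rewrite add0r.
have e2 : 0 < eps / 2 by rewrite divr_gt0.
have [d d0 Hd] := acf _ e2.
(* The endpoints join the exceptional set because the derivative is assumed only in the open
   interval. *)
pose M := N `|` ([set a] `|` [set b]).
have mM : measurable M by apply: measurableU => //; exact: measurableU.
have M0 : mu M = 0.
  rewrite /M measureU0 //; first exact: measurableU.
  by rewrite measureU0 //; exact: lebesgue_measure_set1.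
have [|O [oO MO OM]] := lebesgue_regularity_outer mM _ d0.
  by apply: le_lt_trans (ltry 0); rewrite le_eqVlt; apply/orP; left; apply/eqP; exact: M0.
have Od : (mu O < d%:E)%E.
  have mO := open_measurable oO.
  have -> : O = (O `\` M) `|` M by rewrite setUC setDUK.
  by rewrite measureU0 //; exact: measurableD.
have ba0 : 0 < b - a by rewrite subr_gt0.
have e0 : 0 < eps / 2 / (b - a) by rewrite divr_gt0.
have [|m [s [t [st tr len var]]]] := @intervals_in_open a b f O _ ab oO e0.
  move=> x /andP[ax xb] nOx; apply: Cderive0_near => //.
  have nM : ~ M x by move=> /MO.
  have : ~ N x by move=> Nx; apply: nM; left.
  apply: contra_notP => nd; apply: fN => /= H; apply: nd; apply: H.
  rewrite !lt_neqAle ax xb !andbT; apply/andP; split; apply/eqP => E; apply: nM; right.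
    by left; rewrite /= E.
  by right.
apply: (le_trans var); rewrite divfK ?gt_eqF //.
have : \sum_(i < m) (t i - s i) < d by rewrite -lte_fin; exact: le_lt_trans Od.
by move=> /(Hd m s t st tr); lra.
Qed.

End AbsolutelyContinuous.

Section AbsolutelyContinuousAlgebra.
Variable R : realType.
Notation mu := (@lebesgue_measure R).
Implicit Types (f g : R -> R[i]) (a b : R).

Lemma AC_subitv a b a' b' f : a <= a' -> b' <= b ->
  abs_continuous a b f -> abs_continuous a' b' f.
Proof.
move=> aa bb acf e e0; have [d d0 Hd] := acf e e0; exists d => // m s t st.
apply: Hd => i; have [h1 h2 h3] := st i; split => //.
- exact: le_trans h1.
- exact: le_trans bb.
Qed.

Lemma AC_interval a b f e : abs_continuous a b f -> 0 < e ->
  exists2 d, 0 < d & forall s t, a <= s -> s <= t -> t <= b -> t - s < d ->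
    cmod (f t - f s) < e.
Proof.
move=> acf e0; have [d d0 Hd] := acf e e0; exists d => // s t as_ st tb tsd.
have := Hd 1%N (fun=> s) (fun=> t); rewrite !big_ord1; apply => //.
by apply/trivIsetP => i j _ _; rewrite (ord1 i) (ord1 j) eqxx.
Qed.

Lemma AC_lipschitz a b f (K : R) :
  (forall x y, a <= x -> x <= y -> y <= b -> cmod (f y - f x) <= K * (y - x)) ->
  abs_continuous a b f.
Proof.
move=> fK e e0; have K1 : 0 < `|K| + 1 by rewrite ltr_wpDl.
exists (e / (`|K| + 1)) => [|m s t st _ sd]; first by rewrite divr_gt0.
apply: (@le_lt_trans _ _ (\sum_(i < m) (`|K| + 1) * (t i - s i))).
  apply: ler_sum => i _; have [h1 h2 h3] := st i.
  apply: (le_trans (fK _ _ h1 h2 h3)); rewrite ler_wpM2r ?subr_ge0 //.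
  by have := ler_norm K; lra.
by rewrite -mulr_sumr mulrC -ltr_pdivlMr.
Qed.

Lemma AC_cst a b (c : R[i]) : abs_continuous a b (fun=> c).
Proof. by apply: (@AC_lipschitz _ _ _ 0) => x y _ _ _; rewrite subrr cmod0 mul0r. Qed.

Lemma ACD a b f g : abs_continuous a b f -> abs_continuous a b g ->
  abs_continuous a b (fun x => f x + g x).
Proof.
move=> acf acg e e0; have e2 : 0 < e / 2 by rewrite divr_gt0.
have [d1 d10 H1] := acf _ e2; have [d2 d20 H2] := acg _ e2.
exists (Num.min d1 d2) => [|m s t st tr]; first by rewrite lt_min d10.
rewrite lt_min => /andP[/(H1 m s t st tr) h1 /(H2 m s t st tr) h2].
apply: (@le_lt_trans _ _ (\sum_(i < m) (cmod (f (t i) - f (s i)) + cmod (g (t i) - g (s i))))).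
  apply: ler_sum => i _; apply: le_trans (ler_cmodD _ _).
  by rewrite (_ : f (t i) + g (t i) - _ = f (t i) - f (s i) + (g (t i) - g (s i))) //; ring.
by rewrite big_split /=; move: h1 h2; lra.
Qed.

Lemma AC_bounded a b f : abs_continuous a b f ->
  exists B, forall x, a <= x <= b -> cmod (f x) <= B.
Proof.
move=> acf; have [d d0 Hd] := AC_interval acf ltr01.
(* Steps of length [d / 2] change [f] by less than 1 each, so the number of steps bounds the total
   change. *)
have step n : forall x, a <= x <= b -> x - a <= n%:R * (d / 2) -> cmod (f x - f a) <= n%:R.
  elim: n => [|n IH] x /andP[ax xb] xn.
    have -> : x = a by apply/le_anti; rewrite ax andbT; move: xn; lra.
    by rewrite subrr cmod0.
  pose y := Num.max a (x - d / 2).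
  have ay : a <= y by rewrite le_max lexx.
  have yx : y <= x by rewrite ge_max ax /=; lra.
  have yb : y <= b by exact: le_trans xb.
  have yn : y - a <= n%:R * (d / 2).
    rewrite lerBlDr ge_max; move: xn; rewrite -natr1 mulrDl mul1r => xn.
    apply/andP; split; last by lra.
    by rewrite lerDr mulr_ge0 // divr_ge0 // ltW.
  have yd : x - y < d.
    have : x - d / 2 <= y by rewrite le_max lexx orbT.
    by lra.
  have h1 := IH y; rewrite ay yb in h1; have {}h1 := h1 isT yn.
  have h2 := ltW (Hd y x ay yx xb yd).
  rewrite (_ : f x - f a = (f x - f y) + (f y - f a)); last by ring.
  by apply: (le_trans (ler_cmodD _ _)); rewrite -natr1; lra.
have [ab|ba] := leP a b; last first.
  by exists 0 => x /andP[ax xb]; move: (le_trans ax xb); rewrite leNgt ba.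
pose n := (Num.trunc ((b - a) / (d / 2))).+1.
exists (cmod (f a) + n%:R) => x xab.
rewrite -(subrK (f a) (f x)) addrC; apply: (le_trans (ler_cmodD _ _)).
rewrite lerD2l; apply: step => //.
have : (b - a) / (d / 2) < n%:R by rewrite truncnS_gt.
rewrite ltr_pdivrMr ?divr_gt0 // => /ltW; apply: le_trans.
by case/andP: xab => _ xb; rewrite lerD2r.
Qed.

Lemma ACM a b f g : abs_continuous a b f -> abs_continuous a b g ->
  abs_continuous a b (fun x => f x * g x).
Proof.
move=> acf acg e e0.
have [B fB] := AC_bounded acf; have [C gC] := AC_bounded acg.
pose K := `|B| + `|C| + 1.
have K0 : 0 < K by rewrite /K; have := normr_ge0 B; have := normr_ge0 C; lra.
have fK x : a <= x <= b -> cmod (f x) <= K.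
  by move=> /fB; have := ler_norm B; have := normr_ge0 C; rewrite /K; lra.
have gK x : a <= x <= b -> cmod (g x) <= K.
  by move=> /gC; have := ler_norm C; have := normr_ge0 B; rewrite /K; lra.
have e2 : 0 < e / (2 * K) by rewrite divr_gt0 // mulr_gt0.
have [d1 d10 H1] := acf _ e2; have [d2 d20 H2] := acg _ e2.
exists (Num.min d1 d2) => [|m s t st tr]; first by rewrite lt_min d10.
rewrite lt_min => /andP[/(H1 m s t st tr) h1 /(H2 m s t st tr) h2].
apply: (@le_lt_trans _ _ (\sum_(i < m)
   (K * cmod (f (t i) - f (s i)) + K * cmod (g (t i) - g (s i))))).
  apply: ler_sum => i _; have [p1 p2 p3] := st i.
  rewrite (_ : f (t i) * g (t i) - _ =
    g (s i) * (f (t i) - f (s i)) + f (t i) * (g (t i) - g (s i))); last by ring.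
  apply: (le_trans (ler_cmodD _ _)); rewrite !cmodM; apply: lerD.
    by apply: ler_wpM2r; rewrite ?cmod_ge0 // gK // p1 (le_trans p2).
  by apply: ler_wpM2r; rewrite ?cmod_ge0 // fK // p3 (le_trans p1).
rewrite big_split /= -!mulr_sumr.
move: h1 h2; rewrite !ltr_pdivlMr ?mulr_gt0 //; lra.
Qed.

Lemma ACZ a b (c : R[i]) f : abs_continuous a b f ->
  abs_continuous a b (fun x => c * f x).
Proof. by move=> acf; apply: ACM => //; exact: AC_cst. Qed.

Lemma ACB a b f g : abs_continuous a b f -> abs_continuous a b g ->
  abs_continuous a b (fun x => f x - g x).
Proof.
move=> acf acg; apply: ACD => //; move: (ACZ (-1) acg).
by under eq_fun do rewrite mulN1r.
Qed.

Lemma AC_reflect (L : R) f : abs_continuous 0 L f ->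
  abs_continuous 0 L (fun x => f (L - x)).
Proof.
move=> acf e e0; have [d d0 Hd] := acf e e0; exists d => // m s t st tr sd.
rewrite (eq_bigr (fun i => cmod (f (L - s i) - f (L - t i)))); last first.
  by move=> i _; rewrite -cmodN opprB.
apply: (Hd m (fun i => L - t i) (fun i => L - s i)).
- by move=> i; have [h1 h2 h3] := st i; split; lra.
- apply/trivIsetP => i j _ _ ij; have /trivIsetP/(_ i j I I ij) E := tr.
  apply/seteqP; split => // x /=; rewrite !in_itv /= => -[h1 h2].
  suff : (`]s i, t i[ `&` `]s j, t j[)%classic (L - x) by rewrite E.
  by split; rewrite /= in_itv /=; lra.
- by rewrite (eq_bigr (fun i => t i - s i)) // => i _; ring.
Qed.

End AbsolutelyContinuousAlgebra.

Section ComplexDerivative.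
Variable R : realType.
Implicit Types (f g : R -> R[i]) (x : R).

Lemma Cderive_eq x f (l l' : R[i]) : is_Cderive x f l -> l = l' -> is_Cderive x f l'.
Proof. by move=> H <-. Qed.

Lemma Cderive_cst x (c : R[i]) : is_Cderive x (fun=> c) 0.
Proof. by split; exact: is_derive_cst. Qed.

Lemma CderiveD x f g (k l : R[i]) : is_Cderive x f k -> is_Cderive x g l ->
  is_Cderive x (fun t => f t + g t) (k + l).
Proof.
move=> [fr fi] [gr gi]; split.
- rewrite cReD; under eq_fun do rewrite cReD; exact: is_deriveD.
- rewrite cImD; under eq_fun do rewrite cImD; exact: is_deriveD.
Qed.

Lemma CderiveM x f g (k l : R[i]) : is_Cderive x f k -> is_Cderive x g l ->
  is_Cderive x (fun t => f t * g t) (k * g x + f x * l).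
Proof.
move=> [fr fi] [gr gi]; split.
- under eq_fun do rewrite cReM.
  apply: (is_derive_eq (is_deriveB (is_deriveM fr gr) (is_deriveM fi gi))).
  by rewrite /GRing.scale /= cReD !cReM; ring.
- under eq_fun do rewrite cImM.
  apply: (is_derive_eq (is_deriveD (is_deriveM fr gi) (is_deriveM fi gr))).
  by rewrite /GRing.scale /= cImD !cImM; ring.
Qed.

Lemma CderiveZ x (c : R[i]) f (l : R[i]) : is_Cderive x f l ->
  is_Cderive x (fun t => c * f t) (c * l).
Proof.
by move=> H; apply: (Cderive_eq (CderiveM (Cderive_cst x c) H)); ring.
Qed.

Lemma CderiveB x f g (k l : R[i]) : is_Cderive x f k -> is_Cderive x g l ->
  is_Cderive x (fun t => f t - g t) (k - l).
Proof.
move=> Hf /(CderiveZ (-1)); rewrite mulN1r; under eq_fun do rewrite mulN1r.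
exact: CderiveD.
Qed.

Lemma Cderive_reflect x (L : R) f (l : R[i]) : is_Cderive (L - x) f l ->
  is_Cderive x (fun t => f (L - t)) (- l).
Proof.
have d1 : is_derive x 1 (fun t : R => L - t) (-1).
  by apply: is_derive_eq; ring.
move=> [fr fi]; split.
- have H := @is_derive1_comp R (fun t => complex.Re (f t)) (fun t => L - t) x _ _ fr d1.
  by apply: (is_derive_eq H); rewrite mulrN1 cReN.
- have H := @is_derive1_comp R (fun t => complex.Im (f t)) (fun t => L - t) x _ _ fi d1.
  by apply: (is_derive_eq H); rewrite mulrN1 cImN.
Qed.

Lemma Cderive_ce x (rho : R[i]) :
  is_Cderive x (ce rho) ((0 +i* 1) * rho * ce rho x).
Proof.
have de := is_derive_expRM (- complex.Im rho) x.
have dc := is_derive_cosM (complex.Re rho) x.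
have ds := is_derive_sinM (complex.Re rho) x.
split.
- have -> : (fun t => complex.Re (ce rho t)) =
      fun t => expR (- complex.Im rho * t) * cos (complex.Re rho * t).
    by apply/funext => t; rewrite ce.unlock cis.unlock cReM /= mul0r subr0 mulNr.
  apply: (is_derive_eq (is_deriveM de dc)).
  rewrite ce.unlock cis.unlock /GRing.scale /= !cReM !cImM /= !mulNr; ring.
- have -> : (fun t => complex.Im (ce rho t)) =
      fun t => expR (- complex.Im rho * t) * sin (complex.Re rho * t).
    by apply/funext => t; rewrite ce.unlock cis.unlock cImM /= mul0r addr0 mulNr.
  apply: (is_derive_eq (is_deriveM de ds)).
  rewrite ce.unlock cis.unlock /GRing.scale /= !cImM !cReM /= !mulNr; ring.
Qed.

Let lipschitz_of_derive (u du : R -> R) (a b K : R) :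
  (forall x, is_derive x 1 u (du x)) -> (forall x, a <= x <= b -> `|du x| <= K) ->
  forall x y, a <= x -> x <= y -> y <= b -> `|u y - u x| <= K * (y - x).
Proof.
move=> Hu HK x y ax xy yb.
move: xy; rewrite le_eqVlt => /predU1P[->|xy]; first by rewrite !subrr normr0 mulr0.
have [|c] := @MVT R u du x y xy (fun z _ => Hu z).
- apply: derivable_within_continuous => z _; by case: (Hu z).
- rewrite in_itv /= => /andP[xc cy] ->; rewrite normrM (gtr0_norm (_ : 0 < y - x)) ?subr_gt0 //.
  rewrite ler_wpM2r ?subr_ge0 ?(ltW xy) // HK //.
  by rewrite (le_trans ax (ltW xc)) (le_trans (ltW cy) yb).
Qed.

Lemma AC_of_Cderive (a b K : R) f (df : R -> R[i]) :
  (forall x, is_Cderive x f (df x)) -> (forall x, a <= x <= b -> cmod (df x) <= K) ->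
  abs_continuous a b f.
Proof.
(* The factor 2 comes from applying the mean value theorem to real and imaginary parts
   separately. *)
move=> Hf HK; apply: (@AC_lipschitz _ _ _ _ (2 * K)) => x y ax xy yb.
apply: (le_trans (cmod_le_Re_Im _)); rewrite cReD cReN cImD cImN mulrAC mulr2n mulrDl mul1r mulrDl.
apply: lerD.
- rewrite mulrC; apply: (lipschitz_of_derive (fun z => (Hf z).1) _ ax xy yb) => z /HK.
  exact: le_trans (ler_Re_cmod _).
- rewrite mulrC; apply: (lipschitz_of_derive (fun z => (Hf z).2) _ ax xy yb) => z /HK.
  exact: le_trans (ler_Im_cmod _).
Qed.

Lemma AC_ce (a b : R) rho : abs_continuous a b (ce rho).
Proof.
apply: (@AC_of_Cderive _ _ (cmod ((0 +i* 1) * rho) *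
  expR (`|complex.Im rho| * (`|a| + `|b|))) _ _ (fun x => Cderive_ce x rho)).
move=> x /andP[ax xb]; rewrite cmodM ler_wpM2l ?cmod_ge0 // cmod_ce ler_expR.
have xm : `|x| <= `|a| + `|b|.
  rewrite ler_norml; have := ler_norm (- a); have := ler_norm b; rewrite normrN.
  by have := normr_ge0 a; have := normr_ge0 b; lra.
rewrite -mulNr; apply: (le_trans (ler_norm _)); rewrite normrM normrN.
by rewrite ler_wpM2l.
Qed.

End ComplexDerivative.

(** * Indefinite integrals and the fundamental theorem of calculus *)

Section IndefiniteIntegral.
Variable R : realType.
Notation mu := (@lebesgue_measure R).
Implicit Types (f g : R -> R[i]) (h : R -> R).

Lemma rintble_sum I (s : seq I) (P : pred I) (F : I -> R -> R) :
  (forall i, P i -> rintble (F i)) -> rintble (fun x => \sum_(i <- s | P i) F i x).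
Proof.
move=> mF; elim: s => [|i s IH].
  by under eq_fun do rewrite big_nil; exact: rintble0.
under eq_fun do rewrite big_cons.
case Pi: (P i) => //; apply: rintbleD => //; exact: mF.
Qed.

Lemma rint_sum I (s : seq I) (P : pred I) (F : I -> R -> R) :
  (forall i, P i -> rintble (F i)) ->
  rint (fun x => \sum_(i <- s | P i) F i x) = \sum_(i <- s | P i) rint (F i).
Proof.
move=> mF; elim: s => [|i s IH].
  by under eq_fun do rewrite big_nil; rewrite big_nil rint0.
under eq_fun do rewrite big_cons.
rewrite big_cons; case Pi: (P i) => //; rewrite rintD ?IH //; first exact: mF.
by apply: rintble_sum.
Qed.

(** Integrating from minus infinity avoids oriented integrals; it is the differences of values that
    give integrals over intervals. *)
Definition cumul g (x : R) : R[i] := cint (fun t => if t < x then g t else 0).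

Lemma cintble_if g (P : R -> bool) : measurable_fun setT P -> cintble g ->
  cintble (fun t => if P t then g t else 0).
Proof.
move=> mP ig; apply: (@cintble_le _ _ (fun t => cmod (g t))); last exact: rintble_cmod.
  by apply: cmeas_if => //; exact: cintble_meas.
by move=> t; case: ifP => // _; rewrite cmod0 cmod_ge0.
Qed.

Lemma rintble_if h (P : R -> bool) : measurable_fun setT P -> rintble h ->
  rintble (fun t => if P t then h t else 0).
Proof.
move=> mP ih; apply: (@rintble_le _ _ (fun t => `|h t|)); last exact: integrable_norm.
  by apply: measurable_fun_ifT => //; exact: rintble_meas.
by move=> t; case: ifP => // _; rewrite normr0.
Qed.

Lemma cumul_sub g (s t : R) : cintble g -> s <= t ->
  cumul g t - cumul g s = cint (fun x => if s <= x < t then g x else 0).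
Proof.
move=> ig st; rewrite /cumul -cintB; [|by apply: cintble_if => //; exact: measurable_fun_ltr..].
apply: eq_cint => x; have [xs|sx] := ltP x s.
  by rewrite (lt_le_trans xs st) subrr.
by rewrite subr0.
Qed.

Let sum_indicator_le1 (m : nat) (s t : 'I_m -> R) (x : R) :
  trivIset setT (fun i => `]s i, t i[%classic) ->
  \sum_(i < m) (if s i <= x < t i then 1 else 0) <= 1 :> R.
Proof.
move=> tr; have [/existsP[i si]|/existsPn no] := boolP [exists i, s i <= x < t i]; last first.
  by rewrite big1 // => i _; rewrite ifF //; apply/negbTE; exact: no.
rewrite (bigD1 i) //= si big1 ?addr0 // => j ji; rewrite ifF //.
apply/negP => sj; have /trivIsetP/(_ i j I I) := tr; rewrite eq_sym ji => /(_ isT) E.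
(* Only the open intervals are known to be disjoint. If two half-open ones share [x], a point
   slightly to the right of [x] lies in both open ones. *)
pose y := (x + Num.min (t i) (t j)) / 2.
have xm : x < Num.min (t i) (t j) by rewrite lt_min; case/andP: si => _ ->; case/andP: sj.
have mi : Num.min (t i) (t j) <= t i by rewrite ge_min lexx.
have mj : Num.min (t i) (t j) <= t j by rewrite ge_min lexx orbT.
suff : (`]s i, t i[ `&` `]s j, t j[)%classic y by rewrite E.
by split; rewrite /= in_itv /= /y; lra.
Qed.

Let measurable_co (a b : R) : measurable_fun setT (fun x : R => a <= x < b).
Proof. by apply: measurable_and; [exact: measurable_fun_ler|exact: measurable_fun_ltr]. Qed.

Lemma rint_co (a b : R) : a <= b ->
  rintble (fun x => if a <= x < b then 1 else 0) /\
  rint (fun x => if a <= x < b then 1 else 0) = b - a.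
Proof.
move=> ab.
have E : {ae mu, forall x : R, (if a <= x < b then 1 else 0) = (if a < x < b then 1 else 0) :> R}.
  by apply: ae_imp (ae_neq a) => x xa; rewrite [a < x]lt_neqAle [a == x]eq_sym xa.
split; last first.
  rewrite (eq_rint_ae _ _ E); [|by apply: measurable_fun_ifT => //; exact: measurable_co|
    exact: rintble_meas (rintble_itv _ _)].
  by rewrite rint_itv max_r // subr_ge0.
apply: (rintble_le _ _ (rintble_itv (a - 1) b)).
  by apply: measurable_fun_ifT => //; exact: measurable_co.
move=> x; case: ifPn => H; last by rewrite normr0; case: ifP.
by rewrite normr1 ifT //; lra.
Qed.

(* Square integrability makes this elementary: |g| <= M + |g|^2 / M. *)
Lemma AC_cumul (a b : R) g : cintble g -> rintble (fun x => cmod (g x) ^+ 2) ->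
  abs_continuous a b (cumul g).
Proof.
move=> ig ig2 e e0; set Q := rint (fun x => cmod (g x) ^+ 2).
have Q0 : 0 <= Q by apply: rint_ge0 => x; exact: sqr_ge0.
(* This threshold makes [Q / M] at most [e / 2]; intervals of total length below [e / (2 * M)] then
   contribute less than [e / 2] through the bounded part. *)
pose M := 2 * (Q + 1) / e; have M0 : 0 < M by rewrite divr_gt0 // mulr_gt0 //; lra.
exists (e / (2 * M)) => [|m s t st tr sd]; first by rewrite divr_gt0 // mulr_gt0.
have iag := rintble_cmod ig.
have mP i := measurable_co (s i) (t i).
have b1 i : cmod (cumul g (t i) - cumul g (s i)) <=
    rint (fun x => if s i <= x < t i then cmod (g x) else 0).
  have [h1 h2 h3] := st i; rewrite cumul_sub //; apply: ler_cmod_cint.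
  - by apply: cintble_if.
  - by apply: rintble_if.
  - by move=> x; case: ifP => // _; rewrite cmod0.
have i1 i : rintble (fun x => M * (if s i <= x < t i then 1 else 0)).
  by apply: rintbleZ; have [_ h2 _] := st i; have [] := rint_co h2.
have i2 i : rintble (fun x => if s i <= x < t i then cmod (g x) else 0).
  exact: rintble_if.
apply: (@le_lt_trans _ _ (\sum_(i < m) rint (fun x => if s i <= x < t i then cmod (g x) else 0))).
  by apply: ler_sum => i _.
rewrite -rint_sum //.
apply: (@le_lt_trans _ _ (rint (fun x => (\sum_(i < m) M * (if s i <= x < t i then 1 else 0)) +
    M^-1 * cmod (g x) ^+ 2))).
  apply: ler_rint; first exact: rintble_sum.
    by apply: rintbleD; [exact: rintble_sum|exact: rintbleZ].
  move=> x; rewrite (eq_bigr (fun i => cmod (g x) * (if s i <= x < t i then 1 else 0))); last first.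
    by move=> i _; case: ifP => _; rewrite ?mulr1 ?mulr0.
  rewrite -!mulr_sumr; set S := \sum_(i < m) _.
  have S1 : S <= 1 by exact: sum_indicator_le1.
  have S0 : 0 <= S by apply: sumr_ge0 => i _; case: ifP.
  have : cmod (g x) <= M + M^-1 * cmod (g x) ^+ 2.
    have [gM|Mg] := leP (cmod (g x)) M.
      by rewrite (le_trans gM) // lerDl mulr_ge0 ?invr_ge0 ?(ltW M0) // sqr_ge0.
    rewrite -[leLHS]add0r lerD ?(ltW M0) // expr2 mulrA ler_peMl ?cmod_ge0 //.
    by rewrite mulrC ler_pdivlMr // mul1r ltW.
  have : 0 <= M^-1 * cmod (g x) ^+ 2 by rewrite mulr_ge0 ?invr_ge0 ?(ltW M0) // sqr_ge0.
  move: (cmod (g x)) (M^-1 * _) => u v; move: S0 S1 M0; nra.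
rewrite rintD; [|exact: rintble_sum|exact: rintbleZ].
rewrite rint_sum // rintZ // -/Q.
rewrite (eq_bigr (fun i => M * (t i - s i))); last first.
  move=> i _; have [_ h2 _] := st i; have [ir rE] := rint_co h2.
  by rewrite rintZ // rE.
rewrite -mulr_sumr.
have h1 : M * \sum_(i < m) (t i - s i) < e / 2.
  rewrite -ltr_pdivlMl // (_ : M^-1 * (e / 2) = e / (2 * M)) //.
  by field; rewrite gt_eqF.
have h2 : M^-1 * Q <= e / 2.
  rewrite ler_pdivrMl // /M (_ : _ * (e / 2) = Q + 1); last by field; rewrite gt_eqF.
  by rewrite lerDl.
by lra.
Qed.

Let rcumulE h (x : R) : rintble h ->
  rint (fun t => if t < x then h t else 0) = (\int[mu]_(t in `]-oo, x]) h t)%R.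
Proof.
move=> ih; rewrite -Rintegral_itv_bndo_bndc; last first.
  exact: (@integrableS _ _ _ _ setT).
rewrite rint.unlock Rintegral_mkcond; apply: eq_Rintegral => t _.
rewrite patchE; case: ifPn => tx; first by rewrite mem_set //= in_itv.
by rewrite memNset //= in_itv /=; exact/negP.
Qed.

Let is_derive_of (F : R -> R) (x l : R) :
  derivable F x 1 /\ F^`()%classic x = l -> is_derive x 1 F l.
Proof. by move=> [dF E]; split => //; rewrite -derive1E. Qed.

Lemma ae_Cderive_cumul g : cintble g -> {ae mu, forall x, is_Cderive x (cumul g) (g x)}.
Proof.
move=> ig.
have der h : rintble h ->
    {ae mu, forall x : R, is_derive x 1
      (fun x : R => rint (fun t => if t < x then h t else 0)) (h x)}.
  move=> ih; have := FTC1Ny (fun y => @integrableS _ _ _ mu setT _ _ measurableT (@measurable_itv _ _) (@subsetT _ _) ih) (rintble_locally ih).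
  apply: ae_imp => x /is_derive_of.
  by under [in X in _ -> X]eq_fun do rewrite rcumulE //.
have := ae_and (der _ ig.1) (der _ ig.2); apply: ae_imp => x [dr di]; split.
- rewrite (_ : (fun t => _) = fun x => rint (fun t => if t < x then complex.Re (g t) else 0)) //.
  apply/funext => y; rewrite Re_cint; apply: eq_rint => t; by case: ifP.
- rewrite (_ : (fun t => _) = fun x => rint (fun t => if t < x then complex.Im (g t) else 0)) //.
  apply/funext => y; rewrite Im_cint; apply: eq_rint => t; by case: ifP.
Qed.

Lemma Cderive_cumul g (x : R) : cintble g ->
  {for x, continuous (fun t => complex.Re (g t))} ->
  {for x, continuous (fun t => complex.Im (g t))} ->
  is_Cderive x (cumul g) (g x).
Proof.
move=> ig cr ci.
have der h : rintble h -> {for x, continuous h} ->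
    is_derive x 1 (fun x : R => rint (fun t => if t < x then h t else 0)) (h x).
  move=> ih ch; have x1 : x < x + 1 by rewrite ltrDl.
  have := @continuous_FTC1 R h -oo%O x (x + 1) x1 (@integrableS _ _ _ mu setT _ _ measurableT (@measurable_itv _ _) (@subsetT _ _) ih).
  move=> /= /(_ (ltNyr x) ch) /is_derive_of.
  by under [in X in _ -> X]eq_fun do rewrite rcumulE //.
split.
- rewrite (_ : (fun t => _) = fun x => rint (fun t => if t < x then complex.Re (g t) else 0)).
    exact: der ig.1 cr.
  apply/funext => y; rewrite Re_cint; apply: eq_rint => t; by case: ifP.
- rewrite (_ : (fun t => _) = fun x => rint (fun t => if t < x then complex.Im (g t) else 0)).
    exact: der ig.2 ci.
  apply/funext => y; rewrite Im_cint; apply: eq_rint => t; by case: ifP.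
Qed.

(** The difference [f - cumul g] is absolutely continuous with derivative 0 almost everywhere, hence
    constant. *)
Lemma AC_FTC (L : R) f g : abs_continuous 0 L f ->
  {ae mu, forall x, 0 < x < L -> is_Cderive x f (g x)} ->
  cintble g -> rintble (fun x => cmod (g x) ^+ 2) ->
  forall x, 0 <= x <= L -> f x = f 0 + (cumul g x - cumul g 0).
Proof.
move=> acf df ig ig2 x /andP[x0 xL].
suff : f x - cumul g x = f 0 - cumul g 0.
  by move=> E; rewrite -(subrK (cumul g x) (f x)) E; ring.
move: x0; rewrite le_eqVlt => /predU1P[<- //|x0].
apply: (@AC_zero_derive _ 0 x (fun t => f t - cumul g t)) => //.
  by apply: ACB; [exact: AC_subitv acf|exact: AC_cumul].
have := ae_and df (ae_Cderive_cumul ig); apply: ae_imp => y [d1 d2] /andP[y0 yx].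
rewrite -(subrr (g y)); apply: CderiveB => //; apply: d1.
by rewrite y0 (lt_le_trans yx).
Qed.

End IndefiniteIntegral.

Section GeometricLimit.
Variable R : realType.

(** With [w n] the tail of the geometric series, the intervals of radius [w n] around [r n] are
    nested; the supremum of their left ends lies in all of them. *)
Let real_geometric_limit (r : nat -> R) (A k : R) : 0 <= A -> 0 <= k -> k < 1 ->
  (forall n, `|r n.+1 - r n| <= A * k ^+ n) ->
  exists l, forall n, `|r n - l| <= A * k ^+ n / (1 - k).
Proof.
move=> A0 k0 k1 Hr; have k10 : 0 < 1 - k by rewrite subr_gt0.
pose w n := A * k ^+ n / (1 - k).
have w0 n : 0 <= w n by rewrite divr_ge0 ?(ltW k10) // mulr_ge0 // exprn_ge0.
have wS n : w n = A * k ^+ n + w n.+1.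
  by rewrite /w exprS; field; rewrite gt_eqF.
have lo n m : (n <= m)%N -> r n - w n <= r m - w m.
  elim: m => [|m IH]; first by rewrite leqn0 => /eqP ->.
  rewrite leq_eqVlt => /predU1P[-> //|/IH]; move=> /le_trans; apply.
  by have := Hr m; have := wS m; rewrite ler_norml => -> /andP[]; lra.
have hi n m : (n <= m)%N -> r m + w m <= r n + w n.
  elim: m => [|m IH]; first by rewrite leqn0 => /eqP ->.
  rewrite leq_eqVlt => /predU1P[-> //|/IH]; apply: le_trans.
  by have := Hr m; have := wS m; rewrite ler_norml => -> /andP[]; lra.
have lh n m : r n - w n <= r m + w m.
  have h1 := lo _ _ (leq_maxl n m); have h2 := hi _ _ (leq_maxr n m).
  by have := w0 (maxn n m); lra.
exists (sup (range (fun n => r n - w n))) => n.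
have hs : has_sup (range (fun n => r n - w n)).
  by split; [exists (r 0%N - w 0%N), 0%N|exists (r 0%N + w 0%N) => _ [m _ <-]].
have l1 : r n - w n <= sup (range (fun n => r n - w n)).
  by apply: ub_le_sup; [case: hs|exists n].
have l2 : sup (range (fun n => r n - w n)) <= r n + w n.
  by apply: ge_sup; [case: hs|move=> _ [m _ <-]].
by rewrite -/(w n) ler_norml; lra.
Qed.

Lemma geometric_limit (c : nat -> R[i]) (A k : R) : 0 <= A -> 0 <= k -> k < 1 ->
  (forall n, cmod (c n.+1 - c n) <= A * k ^+ n) ->
  exists l, forall n, cmod (c n - l) <= 2 * (A * k ^+ n / (1 - k)).
Proof.
move=> A0 k0 k1 Hc.
have [n|lr Hr] := @real_geometric_limit (fun n => complex.Re (c n)) A k A0 k0 k1.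
  by rewrite -cReN -cReD; exact: le_trans (ler_Re_cmod _) (Hc n).
have [n|li Hi] := @real_geometric_limit (fun n => complex.Im (c n)) A k A0 k0 k1.
  by rewrite -cImN -cImD; exact: le_trans (ler_Im_cmod _) (Hc n).
exists (lr +i* li) => n; apply: (le_trans (cmod_le_Re_Im _)).
by rewrite cReD cReN cImD cImN /= mulr2n mulrDl mul1r; exact: lerD.
Qed.

End GeometricLimit.

(** * Volterra equations *)

Definition ii (R : realType) : R[i] := 0 +i* 1.
Arguments ii : simpl never.

(** This is [exp (i rho z) * sin (rho z) / rho]: the exponential factor cancels the growth of the
    sine in the upper half-plane. *)
Definition kern (R : realType) (rho : R[i]) (z : R) : R[i] :=
  (ce rho (2 * z) - 1) / (2 * ii R * rho).

Section Kernel.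
Variable R : realType.
Implicit Types (rho : R[i]) (b : R).

Lemma cmod_ii : cmod (ii R) = 1.
Proof. by rewrite /ii /ComplexField.Normc.normc expr0n add0r expr1n sqrtr1. Qed.

Lemma sqr_ii : ii R * ii R = -1.
Proof. by apply: complex_eqP; rewrite /ii /=; ring. Qed.

Lemma ii_neq0 : ii R != 0.
Proof. by rewrite -cmod_eq0 cmod_ii oner_eq0. Qed.

Lemma ler_Im_rho b rho : b <= complex.Im rho -> b <= cmod rho.
Proof. by move=> h; apply: (le_trans h); exact: le_trans (ler_norm _) (ler_Im_cmod _). Qed.

Lemma rho_neq0 b rho : 0 < b -> b <= complex.Im rho -> rho != 0.
Proof. by move=> b0 /ler_Im_rho h; rewrite -cmod_gt0; exact: lt_le_trans h. Qed.

Lemma cmod2 : cmod (2 : R[i]) = 2.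
Proof. exact: (cmod_nat R 2). Qed.

Lemma cmod_kern b rho (z : R) : 0 < b -> b <= complex.Im rho -> 0 <= z ->
  cmod (kern rho z) <= (cmod rho)^-1.
Proof.
move=> b0 brho z0; have r0 := rho_neq0 b0 brho.
have rc : 0 < cmod rho by rewrite cmod_gt0.
rewrite /kern cmodM cmodV !cmodM cmod_ii cmod2 mulr1 invfM mulrA ler_piMl ?invr_ge0 ?cmod_ge0 //.
rewrite ler_pdivrMr // mul1r; apply: (le_trans (ler_cmodB _ _)); rewrite cmod1.
have : cmod (ce rho (2 * z)) <= 1.
  by apply: cmod_ce_le1; [exact: le_trans (ltW b0) brho|exact: mulr_ge0].
by lra.
Qed.

Lemma cmeas_rho d (T : measurableType d) (p : T -> R) (tau : R) :
  measurable_fun setT p -> cmeas (fun z => p z +i* tau).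
Proof. by move=> mp; apply: cmeas_pair => //; exact: measurable_cst. Qed.

Lemma cmeas_kern d (T : measurableType d) (f : T -> R[i]) (g : T -> R) :
  cmeas f -> measurable_fun setT g -> cmeas (fun z => kern (f z) (g z)).
Proof.
move=> mf mg; apply: cmeasM.
  apply: cmeasB; last exact: cmeas_cst.
  by apply: cmeas_ce => //; exact: measurable_funM.
by apply: cmeas_inv; apply: cmeasM => //; exact: cmeas_cst.
Qed.

Lemma Cderive_ceM (a x : R) rho :
  is_Cderive x (fun t => ce rho (a * t)) (a%:C * ii R * rho * ce rho (a * x)).
Proof.
have -> : (fun t => ce rho (a * t)) = ce (a%:C * rho).
  apply/funext => t; rewrite ce.unlock cReM cImM /= !mul0r subr0 addr0.
  by congr ((expR (- _))%:C * cis _); ring.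
have -> : ce rho (a * x) = ce (a%:C * rho) x.
  rewrite ce.unlock cReM cImM /= !mul0r subr0 addr0.
  by congr ((expR (- _))%:C * cis _); ring.
by apply: (Cderive_eq (Cderive_ce x (a%:C * rho))); rewrite -/(ii R); ring.
Qed.

(** Exhibits the kernel, whose formula contains [1 / rho], as an integral of exponentials, so that
    its Poisson reproduction follows from theirs. The test [0 < t] in the second factor keeps that
    factor bounded for all [t]. *)
Lemma kern_int b rho (z : R) : 0 < b -> b <= complex.Im rho -> 0 <= z ->
  kern rho z = cint (fun t => (if 0 < t < z then 1 else 0) *
                              (if 0 < t then ce rho (2 * t) else 0)).
Proof.
move=> b0 brho z0; have r0 := rho_neq0 b0 brho; have i0 := ii_neq0.
have I0 : 0 <= complex.Im rho by exact: le_trans (ltW b0) brho.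
have n2 : (2 : R[i]) != 0 by rewrite pnatr_eq0.
pose g (t : R) : R[i] := if 0 < t < z then ce rho (2 * t) else 0.
have mit : measurable_fun setT (fun t : R => 0 < t < z).
  by apply: measurable_and; exact: measurable_fun_ltr.
have mce : cmeas (fun t : R => ce rho (2 * t)).
  by apply: cmeas_ce.
have gb t : cmod (g t) <= (if 0 < t < z then 1 else 0).
  rewrite /g; case: ifPn => [/andP[t0 _]|_]; last by rewrite cmod0.
  by rewrite cmod_ce_le1 // mulr_ge0 // ltW.
have ig : cintble g.
  apply: (cintble_le _ gb (rintble_itv 0 z)); exact: cmeas_if.
have ig2 : rintble (fun t => cmod (g t) ^+ 2).
  apply: (rintble_le _ _ (rintble_itv 0 z)).
    by apply: measurable_funX; apply: measurable_cmod; exact: cintble_meas.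
  move=> t; rewrite ger0_norm ?sqr_ge0 //; have := gb t; have := cmod_ge0 (g t).
  by case: ifP => _; nra.
have d2 x : is_Cderive x (fun t => (2 * ii R * rho)^-1 * ce rho (2 * t)) (ce rho (2 * x)).
  apply: (Cderive_eq (CderiveZ _ (Cderive_ceM 2 x rho))).
  rewrite (_ : 2%:C = 2) ?rmorph_nat //; field; by rewrite r0 i0.
have ac : abs_continuous 0 z (fun t => (2 * ii R * rho)^-1 * ce rho (2 * t)).
  apply: (@AC_of_Cderive _ _ _ 1 _ _ d2) => x /andP[x0 _].
  by rewrite cmod_ce_le1 // mulr_ge0.
have H := AC_FTC ac _ ig ig2 (_ : 0 <= z <= z).
have {H} := H _ _; rewrite z0 lexx => /(_ _ isT) H.
transitivity (cumul g z - cumul g 0).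
  apply: (addrI ((2 * ii R * rho)^-1 * ce rho (2 * 0))).
  rewrite -H; last first.
    by exists set0; split => //; rewrite ?measure0 // => x /=; apply: contra_notP => _ xz; rewrite /g xz.
  by rewrite mulr0 ce0 /kern; field; rewrite r0 i0.
have -> : cumul g 0 = 0.
  rewrite -(cint0 R); apply: eq_cint => t; rewrite /g.
  by case: (ltP t 0) => // t0; rewrite ltNge (ltW t0).
rewrite subr0; apply: eq_cint => t; rewrite /g.
by case: (ltP 0 t) => t0; case: (ltP t z) => tz //=; rewrite ?mul1r ?mul0r.
Qed.

End Kernel.

(** This is [exp (i rho z) * cos (rho z)] divided by [- i rho]: the kernel obtained when the
    Volterra equation for [y] is differentiated and rescaled in the same way as [y']. *)
Definition dkern (R : realType) (rho : R[i]) (z : R) : R[i] :=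
  (ce rho (2 * z) + 1) / - (2 * ii R * rho).

Lemma cmod_dkern (R : realType) b (rho : R[i]) (z : R) : 0 < b -> b <= complex.Im rho -> 0 <= z ->
  cmod (dkern rho z) <= (cmod rho)^-1.
Proof.
move=> b0 brho z0; have r0 := rho_neq0 b0 brho.
have rc : 0 < cmod rho by rewrite cmod_gt0.
rewrite /dkern cmodM cmodV cmodN !cmodM cmod_ii cmod2 mulr1 invfM mulrA ler_piMl ?invr_ge0 ?cmod_ge0 //.
rewrite ler_pdivrMr // mul1r; apply: (le_trans (ler_cmodD _ _)); rewrite cmod1.
have : cmod (ce rho (2 * z)) <= 1.
  by apply: cmod_ce_le1; [exact: le_trans (ltW b0) brho|exact: mulr_ge0].
by lra.
Qed.

Lemma cmeas_dkern (R : realType) d (T : measurableType d) (f : T -> R[i]) (g : T -> R) :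
  cmeas f -> measurable_fun setT g -> cmeas (fun z => dkern (f z) (g z)).
Proof.
move=> mf mg; apply: cmeasM.
  apply: cmeasD; last exact: cmeas_cst.
  by apply: cmeas_ce => //; exact: measurable_funM.
by apply: cmeas_inv; apply: cmeasN; apply: cmeasM => //; exact: cmeas_cst.
Qed.

Section KernelPoisson.
Variables (R : realType) (s0 b h : R).
Hypotheses (b0 : 0 < b) (h0 : 0 < h).

Lemma poisson_algebra_kern (z : R) : 0 <= z -> poisson_algebra s0 b h (fun r => kern r z).
Proof.
move=> z0; have bh : 0 <= b + h by rewrite addr_ge0 // ltW.
pose F (t : R) (r : R[i]) := if 0 < t then ce r (2 * t) else 0.
have HF : poisson_algebra s0 b h (fun r => cint (fun t =>
    (if 0 < t < z then 1 else 0) * F t r)).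
  apply: (@poisson_algebra_int _ _ _ _ (ltW b0) h0 _ _ 1).
  - apply: (@cintble_le _ _ (fun t => if 0 < t < z then 1 else 0)).
    + by apply: cmeas_if; [apply: measurable_and; exact: measurable_fun_ltr|exact: cmeas_cst..].
    + by move=> t; case: ifP => _; rewrite ?cmod1 ?cmod0.
    + exact: rintble_itv.
  - move=> t; rewrite /F; case: ltP => t0; last exact: (poisson_algebra_cst _ (ltW b0) h0).
    by apply: poisson_algebra_ce => //; [exact: ltW|rewrite mulr_ge0 // ltW].
  - move=> t s; rewrite /F; case: ltP => t0; last by rewrite cmod0.
    by rewrite cmod_ce_le1 //= ?(ltW b0) // mulr_ge0 // ltW.
  - move=> t; rewrite /F; case: ltP => t0; last by rewrite cmod0.
    by rewrite cmod_ce_le1 //= mulr_ge0 // ltW.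
  - apply: cmeas_if; [exact: measurable_fun_ltr| |exact: cmeas_cst].
    by apply: cmeas_ce; [exact: cmeas_rho|exact: measurable_funM].
  - apply: cmeas_if; [exact: measurable_fun_ltr| |exact: cmeas_cst].
    by apply: cmeas_ce.
(* The integral formula holds only for [Im rho >= b]. A constant sequence with error 0 transfers
   membership along an equality that is valid on the line and at [z0]. *)
apply: (@poisson_algebra_lim _ _ _ _ (ltW b0) h0 (fun=> _) _ (fun=> 0) (fun=> HF)).
- exact: cvg_cst.
- by move=> n s /=; rewrite -(kern_int b0) ?subrr ?cmod0.
- by move=> n /=; rewrite -(kern_int b0) ?subrr ?cmod0 //= lerDl ltW.
Qed.

(** [1 / rho] is the limit of [(1 - exp (2 i rho n)) / rho], a multiple of [kern rho n], with error
    at most [exp (- 2 b n) / b]. *)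
Lemma poisson_algebra_inv : poisson_algebra s0 b h (fun r => r^-1).
Proof.
have bnd n r : b <= complex.Im r ->
    cmod (- (2 * ii R) * kern r n%:R - r^-1) <= expR (- (2 * b * n%:R)) / b.
  move=> br; have r0 := rho_neq0 b0 br; have i0 := ii_neq0 R.
  have -> : - (2 * ii R) * kern r n%:R - r^-1 = - (ce r (2 * n%:R) / r).
    by rewrite /kern; field; rewrite r0 i0.
  rewrite cmodN cmodM cmodV cmod_ce ler_pM ?expR_ge0 ?invr_ge0 ?cmod_ge0 //.
    by rewrite ler_expR lerN2 mulrCA -mulrA ler_wpM2l // ler_wpM2r.
  by rewrite lef_pV2 ?posrE ?cmod_gt0 // ler_Im_rho.
apply: (@poisson_algebra_lim _ _ _ _ (ltW b0) h0
  (fun n r => - (2 * ii R) * kern r n%:R) _ (fun n => expR (- (2 * b * n%:R)) / b)).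
- move=> n; apply: poisson_algebraM; first exact: poisson_algebra_cst (ltW b0) h0 _.
  exact: poisson_algebra_kern.
- rewrite -[X in _ --> X](mul0r b^-1); apply: cvgMl.
  have b2 : 0 < 2 * b by rewrite mulr_gt0.
  apply/cvgrPdist_lt => e e0.
  have [N _ HN] : \forall n \near \oo, (2 * b * e)^-1 < n%:R :> R by exact: nbhs_infty_gtr.
  exists N => // n /HN /= hn; rewrite sub0r normrN ger0_norm ?expR_ge0 //.
  have n0 : 0 < n%:R :> R by apply: lt_trans hn; rewrite invr_gt0 mulr_gt0.
  rewrite expRN invf_plt ?posrE ?expR_gt0 //.
  apply: (@lt_le_trans _ _ (1 + 2 * b * n%:R)); last exact: expR_ge1Dx.
  move: hn; rewrite invfM => hn.
  have : e^-1 < 2 * b * n%:R by rewrite mulrC -ltr_pdivrMr // mulrC.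
  by lra.
- by move=> n s; apply: bnd => /=.
- by move=> n; apply: bnd => /=; rewrite lerDl ltW.
Qed.

Lemma poisson_algebra_dkern (z : R) : 0 <= z -> poisson_algebra s0 b h (fun r => dkern r z).
Proof.
move=> z0.
have H : poisson_algebra s0 b h (fun r => (ce r (2 * z) + 1) * (- (2 * ii R)^-1 * r^-1)).
  apply: poisson_algebraM.
    apply: (poisson_algebraD (ltW b0) h0); last exact: (poisson_algebra_cst _ (ltW b0) h0).
    by apply: poisson_algebra_ce; rewrite ?(ltW b0) ?(ltW h0) //; rewrite mulr_ge0.
  apply: poisson_algebraM; first exact: (poisson_algebra_cst _ (ltW b0) h0).
  exact: poisson_algebra_inv.
rewrite (_ : (fun r => _) = (fun r => (ce r (2 * z) + 1) * (- (2 * ii R)^-1 * r^-1))) //.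
by apply/funext => r; rewrite /dkern invrN invfM; ring.
Qed.

End KernelPoisson.

Section Volterra.
Variables (R : realType) (q : R -> R[i]) (eps : R[i]).
Hypotheses (iq : cintble q) (eps1 : cmod eps <= 1).
Implicit Types (u : R[i] -> R -> R[i]) (rho : R[i]).

Let Q1 := rint (fun t => cmod (q t)).

(* [Num.max 0 x] only matters for x < 0, where it keeps the function bounded. *)
Definition vbase rho (x : R) : R[i] := 1 + eps * ce rho (2 * Num.max 0 x).

(* Writing [y = exp (- i rho x) u], the equation [- y'' + q y = rho^2 y] becomes the
   Volterra equation [u = vbase + vint kern u], whose kernel is bounded by
   [1 / |rho|]; [dsol] below is [y'] multiplied by [exp (i rho x) / (- i rho)]. *)
Definition vint (K : R[i] -> R -> R[i]) u rho (x : R) : R[i] :=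
  cint (fun t => q t * (if 0 < t < x then K rho (x - t) * u rho t else 0)).

Definition vstep u rho (x : R) : R[i] := vbase rho x + vint (@kern R) u rho x.

Definition viter n : R[i] -> R -> R[i] := iter n vstep vbase.

Definition line_meas u (tau : R) := cmeas (fun z : R * R => u (z.2 +i* tau) z.1).

Lemma line_meas_fixed u rho : line_meas u (complex.Im rho) -> cmeas (u rho).
Proof.
move=> /cmeas_comp /(_ (measurable_pair2 (complex.Re rho))) /=.
by case: rho.
Qed.

Lemma line_meas_vbase tau : line_meas vbase tau.
Proof.
apply: cmeasD; first exact: cmeas_cst.
apply: cmeasM; first exact: cmeas_cst.
apply: cmeas_ce; first exact: cmeas_rho.
by apply: measurable_funM => //; exact: measurable_maxr.
Qed.

Lemma line_meas_vint K u tau : line_meas K tau -> line_meas u tau ->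
  line_meas (vint K u) tau.
Proof.
move=> mK mu_.
apply: (@cmeas_cint _ _ _ (fun w : (R * R) * R => q w.2 *
  (if 0 < w.2 < w.1.1 then K (w.1.2 +i* tau) (w.1.1 - w.2) * u (w.1.2 +i* tau) w.2 else 0))).
have m11 : measurable_fun setT (fun w : (R * R) * R => w.1.1).
  exact: (measurableT_comp measurable_fst).
have m12 : measurable_fun setT (fun w : (R * R) * R => w.1.2).
  exact: (measurableT_comp measurable_snd).
have m2 : measurable_fun setT (fun w : (R * R) * R => w.2) by exact: measurable_snd.
apply: cmeasM; first exact: (cmeas_comp (cintble_meas iq) m2).
apply: cmeas_if; [by apply: measurable_and; exact: measurable_fun_ltr| |exact: cmeas_cst].
apply: cmeasM.
- apply: (@cmeas_comp _ _ _ _ _ (fun z : R * R => K (z.2 +i* tau) z.1)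
    (fun w : (R * R) * R => (w.1.1 - w.2, w.1.2)) mK).
  by apply: measurable_fun_pair => //; exact: measurable_funB.
- apply: (@cmeas_comp _ _ _ _ _ (fun z : R * R => u (z.2 +i* tau) z.1)
    (fun w : (R * R) * R => (w.2, w.1.2)) mu_).
  exact: measurable_fun_pair.
Qed.

Lemma line_meas_kern tau : line_meas (@kern R) tau.
Proof. by apply: cmeas_kern => //; exact: cmeas_rho. Qed.

Lemma line_meas_dkern tau : line_meas (@dkern R) tau.
Proof. by apply: cmeas_dkern => //; exact: cmeas_rho. Qed.

Lemma line_meas_viter n tau : line_meas (viter n) tau.
Proof.
elim: n => [|n IH]; first exact: line_meas_vbase.
apply: cmeasD; first exact: line_meas_vbase.
by apply: line_meas_vint => //; exact: line_meas_kern.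
Qed.

Section Bounds.
Variables (rho : R[i]) (K : R[i] -> R -> R[i]) (u : R[i] -> R -> R[i]) (C A : R).
Hypotheses (mK : line_meas K (complex.Im rho)) (mu_ : line_meas u (complex.Im rho)).
Hypotheses (KC : forall z, 0 <= z -> cmod (K rho z) <= C) (uA : forall x, cmod (u rho x) <= A).

Let C0 : 0 <= C. Proof. exact: le_trans (cmod_ge0 _) (KC (lexx 0)). Qed.
Let A0 : 0 <= A. Proof. exact: le_trans (cmod_ge0 _) (uA 0). Qed.

Let integrand_le x t :
  cmod (q t * (if 0 < t < x then K rho (x - t) * u rho t else 0)) <= C * A * cmod (q t).
Proof.
rewrite cmodM mulrC ler_wpM2r ?cmod_ge0 //.
case: ifPn => [/andP[_ tx]|_]; last by rewrite cmod0 mulr_ge0.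
by rewrite cmodM ler_pM ?cmod_ge0 // KC // subr_ge0 ltW.
Qed.

Lemma cintble_vint x :
  cintble (fun t => q t * (if 0 < t < x then K rho (x - t) * u rho t else 0)).
Proof.
apply: (cintble_le _ (integrand_le x)).
  apply: cmeasM; first exact: cintble_meas.
  apply: cmeas_if; [by apply: measurable_and; exact: measurable_fun_ltr| |exact: cmeas_cst].
  apply: cmeasM; last exact: line_meas_fixed.
  have mx : measurable_fun setT (fun t : R => x - t) by exact: measurable_funB.
  exact: (cmeas_comp (line_meas_fixed mK) mx).
by apply: rintbleZ; exact: rintble_cmod.
Qed.

Lemma cmod_vint x : cmod (vint K u rho x) <= C * A * Q1.
Proof.
rewrite -rintZ; last exact: rintble_cmod.
apply: ler_cmod_cint; [exact: cintble_vint| |exact: integrand_le].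
by apply: rintbleZ; exact: rintble_cmod.
Qed.

End Bounds.

Lemma vintB K u v rho x (C A B : R) :
  line_meas K (complex.Im rho) -> line_meas u (complex.Im rho) -> line_meas v (complex.Im rho) ->
  (forall z, 0 <= z -> cmod (K rho z) <= C) ->
  (forall x, cmod (u rho x) <= A) -> (forall x, cmod (v rho x) <= B) ->
  vint K u rho x - vint K v rho x = vint K (fun r t => u r t - v r t) rho x.
Proof.
move=> mK mu_ mv KC uA vB; rewrite /vint -cintB; last 2 first.
- exact: (cintble_vint mK mu_ KC uA).
- exact: (cintble_vint mK mv KC vB).
by apply: eq_cint => t; case: ifP => _; ring.
Qed.

Section Convergence.
Variables (b k : R).
Hypotheses (b0 : 0 < b) (k0 : 0 <= k) (k1 : k < 1) (Qk : Q1 <= k * b).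

Section FixedRho.
Variable rho : R[i].
Hypothesis brho : b <= complex.Im rho.

Let Irho0 : 0 <= complex.Im rho. Proof. exact: le_trans (ltW b0) brho. Qed.
Let rc : 0 < cmod rho. Proof. exact: lt_le_trans b0 (ler_Im_rho brho). Qed.

Let Qrho : (cmod rho)^-1 * Q1 <= k.
Proof.
rewrite mulrC ler_pdivrMr //; apply: (le_trans Qk).
by rewrite ler_wpM2l // ler_Im_rho.
Qed.

Lemma cmod_vbase x : cmod (vbase rho x) <= 2.
Proof.
apply: (le_trans (ler_cmodD _ _)); rewrite cmod1 cmodM.
have : cmod (ce rho (2 * Num.max 0 x)) <= 1.
  by apply: cmod_ce_le1 => //; rewrite mulr_ge0 // le_max lexx.
by move: eps1; have := cmod_ge0 eps; have := cmod_ge0 (ce rho (2 * Num.max 0 x)); nra.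
Qed.

Let bdd_viter n : exists A, forall x, cmod (viter n rho x) <= A.
Proof.
elim: n => [|n [A IH]]; first by exists 2; exact: cmod_vbase.
exists (2 + (cmod rho)^-1 * A * Q1) => x; apply: (le_trans (ler_cmodD _ _)).
rewrite lerD ?cmod_vbase //; apply: cmod_vint => //.
- exact: line_meas_kern.
- exact: line_meas_viter.
- by move=> z; exact: (cmod_kern b0 brho).
Qed.

(** As [|rho|^-1] times the integral of [|q|] is at most [k], the Volterra operator is a
    contraction. The geometric rate is uniform in [rho] and [x], as measurability and the passage to
    the limit in the Poisson class require. *)
Lemma viter_step n x : cmod (viter n.+1 rho x - viter n rho x) <= 2 * k * k ^+ n.
Proof.
elim: n x => [|n IH] x.
  rewrite /= /vstep addrC addKr expr0 mulr1.
  apply: (@le_trans _ _ ((cmod rho)^-1 * 2 * Q1)).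
    apply: cmod_vint; [exact: line_meas_kern|exact: line_meas_vbase|
      by move=> z; exact: (cmod_kern b0 brho)|exact: cmod_vbase].
  by rewrite mulrAC mulrC ler_wpM2l.
have [A uA] := bdd_viter n; have [B vB] := bdd_viter n.+1.
have -> : viter n.+2 rho x - viter n.+1 rho x =
    vint (@kern R) (viter n.+1) rho x - vint (@kern R) (viter n) rho x.
  by rewrite /viter !iterS /vstep -/(viter n.+1) -/(viter n); ring.
rewrite (vintB (C := (cmod rho)^-1) _ (line_meas_kern _) (line_meas_viter _ _)
  (line_meas_viter _ _) _ vB uA); last by move=> z; exact: (cmod_kern b0 brho).
apply: (@le_trans _ _ ((cmod rho)^-1 * (2 * k * k ^+ n) * Q1)).
  apply: cmod_vint => //; [exact: line_meas_kern| |by move=> z; exact: (cmod_kern b0 brho)].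
  by apply: cmeasB; exact: line_meas_viter.
rewrite mulrAC (_ : 2 * k * k ^+ n.+1 = k * (2 * k * k ^+ n)); last by rewrite exprS; ring.
by rewrite ler_wpM2r // mulr_ge0 ?exprn_ge0 // mulr_ge0.
Qed.

(** The limit is characterised by the explicit rate, so that choosing a point with this property
    yields uniform convergence at once. *)
Definition is_vsol (x : R) (l : R[i]) :=
  forall n, cmod (viter n rho x - l) <= 2 * (2 * k * k ^+ n / (1 - k)).

Lemma ex_vsol x : exists l, is_vsol x l.
Proof.
apply: geometric_limit => //; first exact: mulr_ge0.
by move=> n; exact: viter_step.
Qed.

End FixedRho.

Definition vsol rho x : R[i] := xget 0 (is_vsol rho x).

Lemma vsolP rho x : b <= complex.Im rho -> is_vsol rho x (vsol rho x).
Proof. by move=> brho; apply: (@xgetPex _ 0 (is_vsol rho x)); exact: ex_vsol. Qed.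

Definition dbase rho (x : R) : R[i] := 1 + - eps * ce rho (2 * Num.max 0 x).

Definition dsol rho x : R[i] := dbase rho x + vint (@dkern R) vsol rho x.

Let rate n := 2 * (2 * k * k ^+ n / (1 - k)).

Let cvg_rate : rate n @[n --> \oo] --> 0.
Proof.
rewrite /rate -[X in _ --> X](_ : 2 * (2 * k * 0 / (1 - k)) = 0); last by rewrite mulr0 mul0r mulr0.
apply: cvgMr; apply: cvgMl; apply: cvgMr; apply: cvg_expr.
by rewrite ger0_norm.
Qed.

Let rate_small (e : R) : 0 < e -> exists N, forall n, (N <= n)%N -> rate n < e.
Proof.
move=> e0; have /cvgrPdist_lt/(_ _ e0)[N _ HN] := cvg_rate.
by exists N => n /HN /=; rewrite sub0r normrN; exact: le_lt_trans (ler_norm _).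
Qed.

Lemma line_meas_vsol tau : b <= tau -> line_meas vsol tau.
Proof.
move=> bt; apply: (@cmeas_cvg _ _ _ (fun n z => viter n (z.2 +i* tau) z.1)).
  by move=> n; exact: line_meas_viter.
move=> z e e0; have [N HN] := rate_small e0; exists N => n /HN; apply: le_lt_trans.
by apply: vsolP.
Qed.

Let le_of_rate (a c : R) : (forall n, a <= c + rate n) -> a <= c.
Proof.
move=> H; apply/ler_addgt0Pr => e e0; have [N /(_ N (leqnn _)) HN] := rate_small e0.
by apply: (le_trans (H N)); rewrite lerD2l ltW.
Qed.

Section VsolProperties.
Variable rho : R[i].
Hypothesis brho : b <= complex.Im rho.

Let rc : 0 < cmod rho. Proof. exact: lt_le_trans b0 (ler_Im_rho brho). Qed.

Let Qrho : (cmod rho)^-1 * Q1 <= k.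
Proof.
rewrite mulrC ler_pdivrMr //; apply: (le_trans Qk).
by rewrite ler_wpM2l // ler_Im_rho.
Qed.

Lemma cmod_viter n x : cmod (viter n rho x) <= 2 / (1 - k).
Proof.
have k10 : 0 < 1 - k by rewrite subr_gt0.
elim: n x => [|n IH] y.
  apply: (le_trans (cmod_vbase _ _)) => //; rewrite ler_pdivlMr //.
  by move: k0; lra.
apply: (le_trans (ler_cmodD _ _)).
apply: (@le_trans _ _ (2 + (cmod rho)^-1 * (2 / (1 - k)) * Q1)).
  rewrite lerD ?cmod_vbase //; apply: cmod_vint => //.
  - exact: line_meas_kern.
  - exact: line_meas_viter.
  - by move=> z; exact: (cmod_kern b0 brho).
rewrite mulrAC; apply: (@le_trans _ _ (2 + k * (2 / (1 - k)))).
  by rewrite lerD2l ler_wpM2r // divr_ge0 // ltW.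
by rewrite le_eqVlt; apply/orP; left; apply/eqP; field; rewrite gt_eqF.
Qed.

Lemma cmod_vsol x : cmod (vsol rho x) <= 2 / (1 - k).
Proof.
apply: le_of_rate => n; rewrite -(subKr (viter n rho x) (vsol rho x)).
by apply: (le_trans (ler_cmodB _ _)); rewrite lerD ?cmod_viter //; exact: vsolP.
Qed.

Lemma vsolE x : vsol rho x = vbase rho x + vint (@kern R) vsol rho x.
Proof.
apply/eqP; rewrite -subr_eq0 -cmod_eq0 eq_le cmod_ge0 andbT.
(* The residual will be bounded by [2 * rate n]; halving it beforehand puts it in the form that
   [le_of_rate] expects. *)
rewrite -(pmulr_rle0 _ (_ : 0 < 2^-1 :> R)) ?invr_gt0 //.
apply: le_of_rate => n; rewrite add0r ler_pdivrMl //.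
have k10 : 0 < 1 - k by rewrite subr_gt0.
have vb m : exists A, forall x, cmod (viter m rho x) <= A.
  exists (2 / (1 - k) + rate m) => y; rewrite -(subrK (vsol rho y) (viter m rho y)) addrC.
  by apply: (le_trans (ler_cmodD _ _)); rewrite lerD ?cmod_vsol //; exact: vsolP.
have [A uA] := vb n.+1.
have -> : vsol rho x - (vbase rho x + vint (@kern R) vsol rho x) =
    (vsol rho x - viter n.+2 rho x) +
    (vint (@kern R) (viter n.+1) rho x - vint (@kern R) vsol rho x).
  by rewrite /viter [iter n.+2 _ _]iterS /vstep -/(viter n.+1); ring.
have lm := line_meas_vsol brho.
rewrite (vintB (C := (cmod rho)^-1) _ (line_meas_kern _) (line_meas_viter _ _) lm _ uA cmod_vsol);
  last by move=> z; exact: (cmod_kern b0 brho).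
apply: (le_trans (ler_cmodD _ _)); rewrite -cmodN opprB.
apply: (@le_trans _ _ (rate n.+2 + (cmod rho)^-1 * rate n.+1 * Q1)).
  apply: lerD; first exact: vsolP.
  apply: cmod_vint; [exact: line_meas_kern| |by move=> z; exact: (cmod_kern b0 brho)|].
    by apply: cmeasB => //; exact: line_meas_viter.
  by move=> y; exact: vsolP.
have r0 : 0 <= rate n.+1.
  by rewrite /rate !mulr_ge0 ?invr_ge0 ?(ltW k10) ?exprn_ge0.
have rS m : rate m.+1 <= rate m.
  rewrite /rate ler_wpM2l // ler_wpM2r ?invr_ge0 ?(ltW k10) // ler_wpM2l ?mulr_ge0 //.
  by rewrite exprS ler_piMl ?exprn_ge0 // ltW.
rewrite mulr2n mulrDl !mul1r; apply: lerD; first exact: le_trans (rS _) (rS _).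
apply: le_trans (rS n); rewrite mulrAC ler_piMl //; exact: le_trans Qrho (ltW k1).
Qed.

(** The difference is one application of the Volterra operator to a bounded function, and the kernel
    supplies the factor [1 / |rho|]. *)
Lemma cmod_vsolB x :
  cmod (vsol rho x - vbase rho x) <= 2 / (1 - k) * Q1 / cmod rho.
Proof.
rewrite vsolE addrC addKr [leRHS]mulrC mulrA; apply: cmod_vint.
- exact: line_meas_kern.
- exact: line_meas_vsol.
- by move=> z; exact: (cmod_kern b0 brho).
- exact: cmod_vsol.
Qed.

Lemma cmod_dsolB x :
  cmod (dsol rho x - dbase rho x) <= 2 / (1 - k) * Q1 / cmod rho.
Proof.
rewrite /dsol addrC addKr [leRHS]mulrC mulrA; apply: cmod_vint.
- exact: line_meas_dkern.
- exact: line_meas_vsol.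
- by move=> z; exact: (cmod_dkern b0 brho).
- exact: cmod_vsol.
Qed.

End VsolProperties.

Section VsolPoisson.
Variables (s0 h : R).
Hypothesis h0 : 0 < h.

Let bh : b <= b + h. Proof. by rewrite lerDl ltW. Qed.

Lemma poisson_algebra_vint K u (x A : R) :
  (forall z, 0 <= z -> poisson_algebra s0 b h (fun r => K r z)) ->
  (forall r z, b <= complex.Im r -> 0 <= z -> cmod (K r z) <= (cmod r)^-1) ->
  (forall tau, b <= tau -> line_meas K tau) ->
  (forall z, poisson_algebra s0 b h (fun r => u r z)) ->
  (forall r z, b <= complex.Im r -> cmod (u r z) <= A) ->
  (forall tau, b <= tau -> line_meas u tau) ->
  poisson_algebra s0 b h (fun r => vint K u r x).
Proof.
move=> HK KC mK Hu uA mu_.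
pose F t r := if 0 < t < x then K r (x - t) * u r t else 0.
have A0 : 0 <= A by apply: le_trans (cmod_ge0 _) (uA (0 +i* b) 0 _).
have FB t r : b <= complex.Im r -> cmod (F t r) <= b^-1 * A.
  move=> br; rewrite /F; case: ifPn => [/andP[_ tx]|_]; last by rewrite cmod0 mulr_ge0 // invr_ge0 ltW.
  rewrite cmodM ler_pM ?cmod_ge0 ?uA //; apply: (le_trans (KC _ _ br _)).
    by rewrite subr_ge0 ltW.
  have rc := lt_le_trans b0 (ler_Im_rho br).
  by rewrite lef_pV2 ?posrE // ler_Im_rho.
have mF tau : b <= tau -> line_meas (fun r t => F t r) tau.
  move=> bt; apply: cmeas_if; last exact: cmeas_cst.
    by apply: measurable_and; exact: measurable_fun_ltr.
  apply: cmeasM; last exact: mu_.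
  apply: (@cmeas_comp _ _ _ _ _ (fun z : R * R => K (z.2 +i* tau) z.1)
    (fun w : R * R => (x - w.1, w.2)) (mK _ bt)).
  by apply: measurable_fun_pair => //; exact: measurable_funB.
apply: (@poisson_algebra_int _ _ _ _ (ltW b0) h0 q F (b^-1 * A)) => //.
- move=> t; rewrite /F; case: (boolP (0 < t < x)) => [/andP[_ tx]|_].
    by apply: poisson_algebraM => //; apply: HK; rewrite subr_ge0 ltW.
  exact: (poisson_algebra_cst _ (ltW b0) h0).
- by move=> t s; exact: FB.
- by move=> t; exact: FB.
- exact: mF.
- exact: (@line_meas_fixed (fun r t => F t r) (s0 +i* (b + h)) (mF _ bh)).
Qed.

Lemma poisson_algebra_base (c : R[i]) x :
  poisson_algebra s0 b h (fun r => 1 + c * ce r (2 * Num.max 0 x)).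
Proof.
apply: (poisson_algebraD (ltW b0) h0); first exact: (poisson_algebra_cst _ (ltW b0) h0).
apply: poisson_algebraM; first exact: (poisson_algebra_cst _ (ltW b0) h0).
by apply: poisson_algebra_ce; rewrite ?(ltW b0) ?(ltW h0) //; rewrite mulr_ge0 // le_max lexx.
Qed.

Lemma poisson_algebra_vsol x : poisson_algebra s0 b h (fun r => vsol r x).
Proof.
apply: (@poisson_algebra_lim _ _ _ _ (ltW b0) h0 (fun n r => viter n r x) _ rate).
- move=> n; elim: n x => [|n IH] x; first exact: poisson_algebra_base.
  apply: (poisson_algebraD (ltW b0) h0); first exact: poisson_algebra_base.
  apply: (@poisson_algebra_vint _ (viter n) _ (2 / (1 - k))) => //.
  - by move=> z; exact: poisson_algebra_kern.
  - by move=> r z br; exact: (cmod_kern b0 br).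
  - by move=> tau _; exact: line_meas_kern.
  - by move=> r z br; exact: cmod_viter.
  - by move=> tau _; exact: line_meas_viter.
- exact: cvg_rate.
- by move=> n s; apply: vsolP.
- by move=> n; apply: vsolP.
Qed.

Lemma poisson_algebra_dsol x : poisson_algebra s0 b h (fun r => dsol r x).
Proof.
apply: (poisson_algebraD (ltW b0) h0); first exact: poisson_algebra_base.
apply: (@poisson_algebra_vint _ _ _ (2 / (1 - k))) => //.
- by move=> z; exact: poisson_algebra_dkern.
- by move=> r z br; exact: (cmod_dkern b0 br).
- by move=> tau _; exact: line_meas_dkern.
- exact: poisson_algebra_vsol.
- by move=> r z br; exact: cmod_vsol.
- exact: line_meas_vsol.
Qed.

End VsolPoisson.
End Convergence.
End Volterra.

Section DerivativeLocality.
Variable R : realType.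
Local Notation mu := (@lebesgue_measure R).
Implicit Types f g : R -> R[i].

Lemma eq_Cderive_itv (a b x : R) f g l : a < x < b ->
  (forall t, a < t < b -> f t = g t) -> is_Cderive x f l -> is_Cderive x g l.
Proof.
move=> /andP[ax xb] fg [fr fi].
have nr : \near x, complex.Re (f x) = complex.Re (g x).
  by near=> t; rewrite fg //; apply/andP; split; near: t;
    [exact: lt_nbhsr|exact: lt_nbhsl].
have ni : \near x, complex.Im (f x) = complex.Im (g x).
  by near=> t; rewrite fg //; apply/andP; split; near: t;
    [exact: lt_nbhsr|exact: lt_nbhsl].
by split; [exact: near_eq_is_derive nr fr|exact: near_eq_is_derive ni fi].
Unshelve. all: by end_near. Qed.

Lemma eq_AC (a b : R) f g : (forall x, a <= x <= b -> f x = g x) ->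
  abs_continuous a b f -> abs_continuous a b g.
Proof.
move=> fg acf e e0; have [d d0 Hd] := acf e e0; exists d => // m s t st tr sd.
rewrite (eq_bigr (fun i => cmod (f (t i) - f (s i)))); first exact: Hd.
move=> i _; have [h1 h2 h3] := st i.
by rewrite !fg // ?h1 ?h3 ?(le_trans h1 h2) ?(le_trans h2 h3).
Qed.

Lemma AC_continuous (L x e : R) f : abs_continuous 0 L f -> 0 < x < L -> 0 < e ->
  \forall t \near x, cmod (f t - f x) < e.
Proof.
move=> acf /andP[x0 xL] e0; have [d d0 Hd] := AC_interval acf e0.
near=> t.
have t0 : 0 < t by near: t; exact: lt_nbhsr.
have tL : t < L by near: t; exact: lt_nbhsl.
have td : `|t - x| < d.
  by near: t; apply: cvgr_distC_lt => //; exact: cvg_id.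
have [xt|tx] := leP x t.
  by apply: Hd; rewrite ?(ltW x0) ?(ltW tL) //; move: td; rewrite ger0_norm // subr_ge0.
rewrite -cmodN opprB; apply: Hd; rewrite ?(ltW t0) ?(ltW xL) ?(ltW tx) //.
by move: td; rewrite distrC ger0_norm // subr_ge0 ltW.
Unshelve. all: by end_near. Qed.

(** A solution must satisfy [y' = dy] at every interior point, while differentiating integrals gives
    it almost everywhere. Absolute continuity writes [f] as an indefinite integral of [g], which is
    differentiable wherever [g] is continuous; [G] is [g] cut off so as to be integrable. *)
Lemma Cderive_of_ae (L : R) f g : cmeas g ->
  abs_continuous 0 L f -> abs_continuous 0 L g ->
  {ae mu, forall x, 0 < x < L -> is_Cderive x f (g x)} ->
  forall x, 0 < x < L -> is_Cderive x f (g x).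
Proof.
move=> mg acf acg df x xL.
pose G t := if 0 < t < L then g t else 0.
have [B gB] := AC_bounded acg.
have mit : measurable_fun setT (fun t : R => 0 < t < L).
  by apply: measurable_and; exact: measurable_fun_ltr.
have GB t : cmod (G t) <= `|B| * (if 0 < t < L then 1 else 0).
  rewrite /G; case: ifPn => [/andP[t0 tL]|_]; last by rewrite cmod0 mulr0.
  by rewrite mulr1 (le_trans _ (ler_norm _)) // gB // !ltW.
have iG : cintble G.
  apply: (cintble_le _ GB); last exact: (rintbleZ _ (rintble_itv 0 L)).
  by apply: cmeas_if => //; exact: cmeas_cst.
have iG2 : rintble (fun t => cmod (G t) ^+ 2).
  apply: (@rintble_le _ _ (fun t => B ^+ 2 * (if 0 < t < L then 1 else 0))).
  - by apply: measurable_funX; apply: measurable_cmod; exact: cintble_meas.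
  - move=> t; rewrite ger0_norm ?sqr_ge0 //; have := GB t; have := cmod_ge0 (G t).
    rewrite -[B ^+ 2]real_normK ?num_real //; case: ifP => _; have := normr_ge0 B; nra.
  - exact: (rintbleZ _ (rintble_itv 0 L)).
have cG (p : R[i] -> R) : (forall z, `|p z| <= cmod z) -> (forall z w, p (z - w) = p z - p w) ->
    {for x, continuous (fun t => p (G t))}.
  move=> pc pB; apply/cvgrPdist_lt => e e0.
  have := AC_continuous acg xL e0; have /andP[x0 xl] := xL => H; near=> t.
  have t0 : 0 < t by near: t; exact: lt_nbhsr.
  have tL : t < L by near: t; exact: lt_nbhsl.
  rewrite /G t0 tL xL /= -pB; apply: (le_lt_trans (pc _)).
  by rewrite -cmodN opprB; near: t.
have df' : {ae mu, forall x, 0 < x < L -> is_Cderive x f (G x)}.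
  by apply: ae_imp df => t H tL; rewrite /G tL; exact: H.
have E := AC_FTC acf df' iG iG2.
apply: (@eq_Cderive_itv 0 L x (fun t => f 0 + (cumul G t - cumul G 0))) => //.
  by move=> t /andP[t0 tL]; rewrite -E // !ltW.
have dG : is_Cderive x (cumul G) (G x).
  apply: Cderive_cumul => //.
  - by apply: cG => [z|z w]; [exact: ler_Re_cmod|rewrite cReD cReN].
  - by apply: cG => [z|z w]; [exact: ler_Im_cmod|rewrite cImD cImN].
apply: (Cderive_eq (CderiveD (Cderive_cst x (f 0)) (CderiveB dG (Cderive_cst x (cumul G 0))))).
by rewrite /G xL subr0 add0r.
Unshelve. all: by end_near. Qed.

Lemma cmeas_cumul g : cintble g -> cmeas (cumul g).
Proof.
move=> ig; apply: (@cmeas_cint _ _ _ (fun z : R * R => if z.2 < z.1 then g z.2 else 0)).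
apply: cmeas_if; [exact: measurable_fun_ltr| |exact: cmeas_cst].
exact: (cmeas_comp (cintble_meas ig) measurable_snd).
Qed.

Lemma Cderive_ceN x (rho : R[i]) :
  is_Cderive x (fun t => ce rho (- t)) (- (ii R * rho) * ce rho (- x)).
Proof.
have := Cderive_ceM (-1) x rho; under eq_fun do rewrite mulN1r.
by move=> /Cderive_eq; apply; rewrite mulN1r rmorphN1; ring.
Qed.

Lemma AC_ceN (a b : R) (rho : R[i]) : abs_continuous a b (fun t => ce rho (- t)).
Proof.
apply: (@eq_AC _ _ (ce (- rho))); last exact: AC_ce.
by move=> x _; rewrite ce.unlock cReN cImN; congr ((expR (- _))%:C * cis _); ring.
Qed.

Lemma eq_SL_solution (q q' : R -> R[i]) lam y y' dy dy' :
  (forall x, 0 < x < pi -> q x = q' x) ->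
  (forall x, 0 <= x <= pi -> y x = y' x) -> (forall x, 0 <= x <= pi -> dy x = dy' x) ->
  SL_solution q lam y dy -> SL_solution q' lam y' dy'.
Proof.
move=> qq yy dd [acy acd Hy Hd].
have oc (x : R) : 0 < x < pi -> 0 <= x <= pi by move=> /andP[? ?]; rewrite !ltW.
split; [exact: (eq_AC yy)|exact: (eq_AC dd)| |].
  move=> x x0; rewrite -dd ?oc //; apply: (eq_Cderive_itv x0 _ (Hy x x0)) => t t0.
  by rewrite yy ?oc.
apply: ae_imp Hd => x H x0; have [d2 D2 E] := H x0; exists d2.
  by apply: (eq_Cderive_itv x0 _ D2) => t t0; rewrite dd ?oc.
by rewrite -yy ?oc // -qq.
Qed.

Lemma SL_solutionZ (q : R -> R[i]) lam (c : R[i]) y dy : SL_solution q lam y dy ->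
  SL_solution q lam (fun x => c * y x) (fun x => c * dy x).
Proof.
move=> [acy acd Hy Hd]; split; [exact: ACZ|exact: ACZ| |].
  by move=> x x0; apply: CderiveZ; exact: Hy.
apply: ae_imp Hd => x H x0; have [d2 D2 E] := H x0; exists (c * d2); first exact: CderiveZ.
by rewrite [RHS]mulrCA -E; ring.
Qed.

Lemma SL_solutionD (q : R -> R[i]) lam y dy z dz :
  SL_solution q lam y dy -> SL_solution q lam z dz ->
  SL_solution q lam (fun x => y x + z x) (fun x => dy x + dz x).
Proof.
move=> [acy acd Hy Hd] [acz acdz Hz Hdz]; split; [exact: ACD|exact: ACD| |].
  by move=> x x0; apply: CderiveD; [exact: Hy|exact: Hz].
apply: ae_imp (ae_and Hd Hdz) => x [H H'] x0.
have [d2 D2 E] := H x0; have [e2 E2 E'] := H' x0.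
exists (d2 + e2); first exact: CderiveD.
by rewrite [RHS]mulrDr -E -E'; ring.
Qed.

Lemma ae_reflect (c : R) (P : R -> Prop) : {ae mu, forall x, P x} ->
  {ae mu, forall x, P (c - x)}.
Proof.
move=> [A [mA A0 PA]]; exists (affine_map (-1) c @^-1` A); split.
- by rewrite -[X in measurable X]setTI; apply: measurable_affine_map.
- have := @lebesgue_measure_affine R (-1) c A; rewrite normrN1 mul1e A0 => <- //.
- by move=> x /= nP; apply: PA => /=; rewrite /affine_map mulN1r addrC.
Qed.

Lemma SL_solution_reflect (q : R -> R[i]) lam y dy : SL_solution q lam y dy ->
  SL_solution (fun x => q (pi - x)) lam (fun x => y (pi - x)) (fun x => - dy (pi - x)).
Proof.
move=> [acy acd Hy Hd].
have flip (x : R) : 0 < x < pi -> 0 < pi - x < pi by move=> /andP[? ?]; apply/andP; split; lra.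
split; [exact: AC_reflect| | |].
- have := ACZ (-1) (AC_reflect acd).
  by under eq_fun do rewrite mulN1r.
- by move=> x x0; apply: Cderive_reflect; apply: Hy; exact: flip.
- apply: ae_imp (ae_reflect pi Hd) => x H x0; have [d2 D2 E] := H (flip _ x0).
  exists d2; last exact: E.
  have := CderiveZ (-1) (Cderive_reflect D2); under eq_fun do rewrite mulN1r.
  by rewrite mulN1r opprK.
Qed.

(** Lagrange's identity: the derivative of [y1' y2 - y1 y2'] is [(q1 - q2) y1 y2], the terms with
    [lam] cancelling. The integrand is passed as a function [P] on the whole line that vanishes
    outside the interval. *)
Lemma wronskian_diff (q1 q2 P : R -> R[i]) lam y1 dy1 y2 dy2 :
  SL_solution q1 lam y1 dy1 -> SL_solution q2 lam y2 dy2 ->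
  (forall x, 0 < x < pi -> P x = (q1 x - q2 x) * (y1 x * y2 x)) ->
  (forall x, ~~ (0 < x < pi) -> P x = 0) ->
  cintble P -> rintble (fun x => cmod (P x) ^+ 2) ->
  (dy1 pi * y2 pi - y1 pi * dy2 pi) - (dy1 0 * y2 0 - y1 0 * dy2 0) = cint P.
Proof.
move=> [ac1 acd1 H1 Hd1] [ac2 acd2 H2 Hd2] PE P0 iP iP2.
pose W x := dy1 x * y2 x - y1 x * dy2 x.
have acW : abs_continuous 0 pi W by apply: ACB; exact: ACM.
have dW : {ae mu, forall x, 0 < x < pi -> is_Cderive x W (P x)}.
  apply: ae_imp (ae_and Hd1 Hd2) => x [h1 h2] x0.
  have [d1 D1 E1] := h1 x0; have [d2 D2 E2] := h2 x0.
  apply: (Cderive_eq (CderiveB (CderiveM D1 (H2 _ x0)) (CderiveM (H1 _ x0) D2))).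
  have -> : d1 = q1 x * y1 x - lam * y1 x by rewrite -E1; ring.
  have -> : d2 = q2 x * y2 x - lam * y2 x by rewrite -E2; ring.
  by rewrite PE //; ring.
have pp (x : R) : 0 <= x -> 0 <= x <= x by move=> ->; rewrite lexx.
have pi0 := pp _ (pi_ge0 R).
rewrite -/(W pi) -/(W 0) (AC_FTC acW dW iP iP2 pi0) addrC addKr cumul_sub ?pi_ge0 //.
apply: eq_cint => x; case: ifPn => // xp; symmetry; apply: P0.
by apply: contra xp => /andP[x0 xpi]; rewrite (ltW x0).
Qed.

Lemma wronskian_const (q : R -> R[i]) lam y1 dy1 y2 dy2 :
  SL_solution q lam y1 dy1 -> SL_solution q lam y2 dy2 ->
  dy1 pi * y2 pi - y1 pi * dy2 pi = dy1 0 * y2 0 - y1 0 * dy2 0.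
Proof.
move=> S1 S2; apply/eqP; rewrite -subr_eq0; apply/eqP.
rewrite (@wronskian_diff q q (fun=> 0) lam _ _ _ _ S1 S2) ?cint0 //.
- by move=> x _; rewrite subrr mul0r.
- exact: cintble0.
- by under eq_fun do rewrite cmod0 expr0n; exact: rintble0.
Qed.

End DerivativeLocality.

(** * Sturm-Liouville solutions *)

Section SLSolutions.
Variables (R : realType) (q : R -> R[i]) (eps : R[i]) (b k : R) (rho : R[i]).
Local Notation mu := (@lebesgue_measure R).
Hypotheses (iq : cintble q) (iq2 : rintble (fun t => cmod (q t) ^+ 2)) (eps1 : cmod eps <= 1).
Hypotheses (b0 : 0 < b) (k0 : 0 <= k) (k1 : k < 1).
Hypotheses (Qk : rint (fun t => cmod (q t)) <= k * b) (brho : b <= complex.Im rho).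

Local Notation u := (vsol q eps k rho).
Local Notation d := (dsol q eps k rho).

Let g (a : R) (t : R) : R[i] := if 0 < t < pi then q t * (ce rho (- (a * t)) * u t) else 0.

Let mu_u : cmeas u.
Proof. exact: (line_meas_fixed (line_meas_vsol iq eps1 b0 k0 k1 Qk brho)). Qed.

Let cmeas_g a : cmeas (g a).
Proof.
apply: cmeas_if; last exact: cmeas_cst.
  by apply: measurable_and; exact: measurable_fun_ltr.
apply: cmeasM; first exact: cintble_meas.
apply: cmeasM => //; apply: cmeas_ce; first exact: cmeas_cst.
by apply: measurableT_comp => //; exact: measurable_funM.
Qed.

Let bound_g a : 0 <= a -> exists2 B, 0 <= B & forall t, cmod (g a t) <= B * cmod (q t).
Proof.
move=> a0; pose M := expR (complex.Im rho * (a * pi)).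
have k10 : 0 < 1 - k by rewrite subr_gt0.
have B0 : 0 <= M * (2 / (1 - k)) by rewrite mulr_ge0 ?expR_ge0 // divr_ge0 // ltW.
exists (M * (2 / (1 - k))) => // t; rewrite /g; case: ifPn => [/andP[t0 tp]|_]; last first.
  by rewrite cmod0 mulr_ge0 // cmod_ge0.
rewrite cmodM mulrC ler_wpM2r ?cmod_ge0 // cmodM ler_pM ?cmod_ge0 //; last first.
  exact: (cmod_vsol iq eps1 b0 k0 k1 Qk brho).
rewrite cmod_ce ler_expR mulrN opprK ler_wpM2l ?(le_trans (ltW b0)) //.
by rewrite ler_wpM2l // ltW.
Qed.

Let cintble_g a : 0 <= a -> cintble (g a).
Proof.
move=> /bound_g[B B0 gB]; apply: (cintble_le _ gB); first exact: cmeas_g.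
by apply: rintbleZ; exact: rintble_cmod.
Qed.

Let rintble_g a : 0 <= a -> rintble (fun t => cmod (g a t) ^+ 2).
Proof.
move=> /bound_g[B B0 gB]; apply: (@rintble_le _ _ (fun t => B ^+ 2 * cmod (q t) ^+ 2)).
- by apply: measurable_funX; apply: measurable_cmod; exact: cmeas_g.
- move=> t; rewrite ger0_norm ?sqr_ge0 // -exprMn lerXn2r ?nnegrE ?cmod_ge0 //.
  by rewrite mulr_ge0 ?cmod_ge0.
- exact: rintbleZ.
Qed.

(** Splitting [exp (2 i rho (x - t))] into its factors turns the convolutions into products of
    exponentials with the indefinite integrals [C1] and [C2], which can be differentiated. The
    formulas [y0] and [dy0] below are variation of constants in this form. *)
Let C1 := cumul (g 2).
Let C2 := cumul (g 0).

Let y0 x := ce rho (- x) + eps * ce rho x + (2 * ii R * rho)^-1 * (ce rho x * C1 x - ce rho (- x) * C2 x).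
Let dy0 x := - (ii R * rho) * ce rho (- x) + eps * (ii R * rho) * ce rho x
  + 2^-1 * (ce rho x * C1 x + ce rho (- x) * C2 x).

Let rho0 : rho != 0. Proof. exact: rho_neq0 b0 brho. Qed.

(** Hence the terms coming from the derivatives of [C1] and [C2] cancel in the derivative of [y0],
    and add up to the potential term in the derivative of [dy0]. *)
Let cegg x : ce rho x * g 2 x = ce rho (- x) * g 0 x.
Proof.
rewrite /g; case: ifP => _; last by rewrite !mulr0.
rewrite mul0r oppr0 ce0 mul1r (_ : - x = x + - (2 * x)); last by ring.
by rewrite ceD; ring.
Qed.

Let cumul_vint a x : 0 <= x <= pi -> cumul (g a) x =
  cint (fun t => q t * (if 0 < t < x then ce rho (- (a * t)) * u t else 0)).
Proof.
move=> /andP[x0 xp]; apply: eq_cint => t; rewrite /g.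
have [tx|xt] := ltP t x; last by rewrite andbF mulr0.
by rewrite andbT (lt_le_trans tx xp) andbT; case: ifP => _; rewrite ?mulr0.
Qed.

Let vint_split (K : R[i] -> R -> R[i]) (c1 c2 : R[i]) x : 0 <= x <= pi ->
  (forall z, K rho z = c1 * ce rho (2 * z) + c2) ->
  vint q K (vsol q eps k) rho x = c1 * ce rho (2 * x) * C1 x + c2 * C2 x.
Proof.
move=> x0p KE; rewrite /C1 /C2.
have L a : 0 <= a -> cintble (fun t => q t * (if 0 < t < x then ce rho (- (a * t)) * u t else 0)).
  move=> a0; have ig : cintble (fun t => if t < x then g a t else 0).
    by apply: cintble_if; [exact: measurable_fun_ltr|exact: cintble_g].
  suff -> : (fun t => q t * (if 0 < t < x then ce rho (- (a * t)) * u t else 0)) =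
    (fun t => if t < x then g a t else 0) by [].
  apply/funext => t; rewrite /g; have /andP[_ xp] := x0p.
  have [tx|xt] := ltP t x; last by rewrite andbF mulr0.
  by rewrite andbT (lt_le_trans tx xp) andbT; case: ifP => _; rewrite ?mulr0.
rewrite !cumul_vint // -!cintZ; [|exact: L..].
rewrite -cintD; last 2 first.
- by apply: cintbleZ; exact: L.
- by apply: cintbleZ; exact: L.
apply: eq_cint => t; case: ifP => _; last by rewrite !mulr0 addr0.
rewrite KE mul0r oppr0 ce0 mulrBr ceD; ring.
Qed.

Let vsol_y0 x : 0 <= x <= pi -> ce rho (- x) * u x = y0 x.
Proof.
move=> x0p; have /andP[x0 xp] := x0p; rewrite (vsolE iq eps1 b0 k0 k1 Qk brho) /vbase (max_idPr x0).
have i0 := ii_neq0 R.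
rewrite (@vint_split _ (2 * ii R * rho)^-1 (- (2 * ii R * rho)^-1)) //; last first.
  by move=> z; rewrite /kern; ring.
have E : ce rho (- x) * ce rho (2 * x) = ce rho x by rewrite -ceD; congr ce; ring.
by rewrite /y0 -E; ring.
Qed.

Let dsol_dy0 x : 0 <= x <= pi -> - (ii R * rho) * (ce rho (- x) * d x) = dy0 x.
Proof.
move=> x0p; have /andP[x0 xp] := x0p; rewrite /dsol /dbase (max_idPr x0).
have i0 := ii_neq0 R.
rewrite (@vint_split _ (- (2 * ii R * rho)^-1) (- (2 * ii R * rho)^-1)) //; last first.
  by move=> z; rewrite /dkern invrN; ring.
have E : ce rho (- x) * ce rho (2 * x) = ce rho x by rewrite -ceD; congr ce; ring.
by rewrite /dy0 -E; field; rewrite rho0 i0.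
Qed.

Let AC_C a : 0 <= a -> abs_continuous 0 pi (cumul (g a)).
Proof. by move=> a0; apply: AC_cumul; [exact: cintble_g|exact: rintble_g]. Qed.

Let der_y0 x (D1 : is_Cderive x C1 (g 2 x)) (D2 : is_Cderive x C2 (g 0 x)) :
  is_Cderive x y0 (dy0 x).
Proof.
have d1 := Cderive_ce x rho; have d2 := Cderive_ceN x rho; have i0 := ii_neq0 R.
apply: (Cderive_eq (CderiveD (CderiveD d2 (CderiveZ eps d1))
  (CderiveZ (2 * ii R * rho)^-1 (CderiveB (CderiveM d1 D1) (CderiveM d2 D2))))).
rewrite -/(ii R) cegg /dy0; field; by rewrite rho0 i0.
Qed.

Let der_dy0 x (D1 : is_Cderive x C1 (g 2 x)) (D2 : is_Cderive x C2 (g 0 x)) :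
  is_Cderive x dy0 (- rho ^+ 2 * y0 x + ce rho (- x) * g 0 x).
Proof.
have d1 := Cderive_ce x rho; have d2 := Cderive_ceN x rho; have i0 := ii_neq0 R.
apply: (Cderive_eq (CderiveD (CderiveD (CderiveZ (- (ii R * rho)) d2) (CderiveZ (eps * (ii R * rho)) d1))
  (CderiveZ 2^-1 (CderiveD (CderiveM d1 D1) (CderiveM d2 D2))))).
rewrite -/(ii R) cegg /y0 [- rho ^+ 2](_ : _ = (ii R * ii R) * rho ^+ 2); last by rewrite sqr_ii mulN1r.
by field; rewrite rho0 i0.
Qed.

Lemma SL_solution_vsol : SL_solution q (rho ^+ 2)
  (fun x => ce rho (- x) * u x) (fun x => - (ii R * rho) * (ce rho (- x) * d x)).
Proof.
have two0 : 0 <= 2 :> R by [].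
apply: (@eq_SL_solution _ q q _ y0 _ dy0) => //; [by move=> x /vsol_y0|by move=> x /dsol_dy0|].
have acy : abs_continuous 0 pi y0.
  apply: ACD; first by apply: ACD; [exact: AC_ceN|apply: ACZ; exact: AC_ce].
  by apply: ACZ; apply: ACB; apply: ACM; [exact: AC_ce|exact: AC_C|exact: AC_ceN|exact: AC_C].
have acd : abs_continuous 0 pi dy0.
  apply: ACD; first by apply: ACD; apply: ACZ; [exact: AC_ceN|exact: AC_ce].
  by apply: ACZ; apply: ACD; apply: ACM; [exact: AC_ce|exact: AC_C|exact: AC_ceN|exact: AC_C].
have dC := ae_and (ae_Cderive_cumul (cintble_g two0)) (ae_Cderive_cumul (cintble_g (lexx 0))).
split => //.
- apply: Cderive_of_ae => //.
    have mce : cmeas (fun x : R => ce rho x) by apply: cmeas_ce => //; exact: cmeas_cst.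
    have mceN : cmeas (fun x : R => ce rho (- x)).
      by apply: cmeas_ce; [exact: cmeas_cst|apply: (@measurable_funN _ _ R setT id); exact: measurable_id].
    have mC a : 0 <= a -> cmeas (cumul (g a)) by move=> /cintble_g; exact: cmeas_cumul.
    apply: cmeasD.
      by apply: cmeasD; apply: cmeasM => //; exact: cmeas_cst.
    apply: cmeasM; first exact: cmeas_cst.
    by apply: cmeasD; apply: cmeasM => //; exact: mC.
  by apply: ae_imp dC => x [D1 D2] _; exact: der_y0.
- apply: ae_imp dC => x [D1 D2] x0; have xc : 0 <= x <= pi by case/andP: x0 => ? ?; rewrite !ltW.
  exists (- rho ^+ 2 * y0 x + ce rho (- x) * g 0 x); first exact: der_dy0.
  by rewrite -vsol_y0 // /g x0 mul0r oppr0 ce0; ring.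
Qed.

Lemma vint0 (K : R[i] -> R -> R[i]) v : vint q K v rho 0 = 0.
Proof.
rewrite -(cint0 R); apply: eq_cint => t.
by case: ifPn => [/andP[t0 /lt_trans/(_ t0)]|_]; rewrite ?ltxx ?mulr0.
Qed.

(** Together with the next lemma: [eps = -1] gives the solution with [y 0 = 0] and [eps = 1] the one
    with zero derivative at 0. *)
Lemma vsol0 : vsol q eps k rho 0 = 1 + eps.
Proof.
by rewrite (vsolE iq eps1 b0 k0 k1 Qk brho) vint0 addr0 /vbase maxxx mulr0 ce0 mulr1.
Qed.

Lemma dsol0 : dsol q eps k rho 0 = 1 - eps.
Proof. by rewrite /dsol vint0 addr0 /dbase maxxx mulr0 ce0 mulr1. Qed.

End SLSolutions.

(** * The star graph and its Weyl functions *)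

Section StarGraphSolutions.
Variables (R : realType) (n : nat) (b kap : R).
Hypotheses (b0 : 0 < b) (kap0 : 0 <= kap) (kap1 : kap < 1).
Implicit Types (q : R -> R[i]) (Q : 'I_n.+1 -> R -> R[i]) (e j : 'I_n.+1) (rho : R[i]) (x : R).

Definition refl q x : R[i] := q (pi - x).

(** The last bound makes the Volterra iteration contract with factor [kap] for every [rho] with
    [Im rho >= b]. *)
Definition admissible q := [/\ cintble q, rintble (fun t => cmod (q t) ^+ 2) &
  rint (fun t => cmod (q t)) <= kap * b].

Lemma admissible_refl q : admissible q -> admissible (refl q).
Proof.
move=> [iq iq2 Q1]; have n1 : (-1 : R) != 0 by rewrite oppr_eq0 oner_eq0.
have E : refl q = (fun x => q (-1 * x + pi)) by apply/funext => x; rewrite /refl mulN1r addrC.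
split; rewrite E.
- exact: (cintble_affine pi n1 iq).
- exact: (rintble_affine pi n1 iq2).
- have := rint_affine pi n1 (rintble_cmod iq).
  by rewrite normrN1 mul1r => <-.
Qed.

(* All edges are parametrised towards the interior vertex, so that edge [ord0]
   is reversed and the star becomes symmetric in its edges. *)
Definition symmetric_star Q (lam : R[i]) (Y dY : 'I_n.+1 -> R -> R[i]) :=
  [/\ forall j, SL_solution (Q j) lam (Y j) (dY j),
      forall i j, Y i pi = Y j pi & \sum_j dY j pi = 0].

(** The given potentials are arbitrary outside the open interval; cutting them off there allows
    integration over the whole line. *)
Definition edge_potential Q j x : R[i] :=
  if 0 < x < pi then (if j == ord0 then refl (Q j) x else Q j x) else 0.

(** This and the next map reverse edge [ord0], the derivative changing sign. Both are involutions,
    so they serve for passing to the symmetric star and back. *)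
Definition edge_fun Q j x : R[i] := if j == ord0 then Q j (pi - x) else Q j x.
Definition edge_derive Q j x : R[i] := if j == ord0 then - Q j (pi - x) else Q j x.

Lemma symmetric_star_of_star Q lam Y dY : star_solution Q lam Y dY ->
  symmetric_star (edge_potential Q) lam (edge_fun Y) (edge_derive dY).
Proof.
move=> [SL V S]; split.
- move=> j; rewrite /edge_potential /edge_fun /edge_derive; case: (boolP (j == ord0)) => j0.
    apply: (eq_SL_solution _ _ _ (SL_solution_reflect (SL j))) => //.
    by move=> x x0; rewrite x0.
  by apply: (eq_SL_solution _ _ _ (SL j)) => // x ->.
- have H j : edge_fun Y j pi = Y ord0 0.
    by rewrite /edge_fun; case: eqP => [->|/eqP/V ->] //; rewrite subrr.
  by move=> i j; rewrite !H.
- rewrite (bigD1 ord0) //= {1}/edge_derive eqxx subrr S addrC; apply/eqP; rewrite subr_eq0; apply/eqP.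
  by apply: eq_bigr => j /negbTE j0; rewrite /edge_derive j0.
Qed.

Lemma star_of_symmetric_star Q lam Y dY : symmetric_star (edge_potential Q) lam Y dY ->
  star_solution Q lam (edge_fun Y) (edge_derive dY).
Proof.
move=> [SL V S]; split.
- move=> j; have := SL j; rewrite /edge_potential /edge_fun /edge_derive.
  case: (boolP (j == ord0)) => j0 H.
    apply: (eq_SL_solution _ _ _ (SL_solution_reflect H)) => // x /andP[x0 xp].
    have -> : 0 < pi - x < pi by apply/andP; split; lra.
    by rewrite /refl subKr.
  by apply: (eq_SL_solution _ _ _ H) => // x ->.
- move=> j /negbTE j0; rewrite /edge_fun eqxx j0 subr0; exact: V.
- rewrite /edge_derive eqxx subr0; move/eqP: S; rewrite (bigD1 ord0) //= addr_eq0 => /eqP ->.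
  by rewrite opprK; apply: eq_bigr => j /negbTE ->.
Qed.

(** Up to explicit factors, this and [d_end] are the value and the derivative, at the interior
    vertex, of the solution on edge [j] that vanishes at its boundary vertex. *)
Definition s_end Q j rho := vsol (Q j) (-1) kap rho pi.
Definition d_end Q j rho := dsol (Q j) (-1) kap rho pi.
Definition star_P Q e j rho := \prod_(i | (i != e) && (i != j)) s_end Q i rho.
Definition star_X Q e rho := \sum_(j | j != e) star_P Q e j rho * d_end Q j rho.
Definition star_Y Q e rho := \prod_(i | i != e) s_end Q i rho.

(** The solution on the edges other than [e] is normalised so that all of them reach the common
    vertex value carried by [2 * star_Y]. On [e] it is started at the interior vertex, with the
    coefficient [star_Y] fixing the value and [star_X] balancing the sum of the derivatives. *)
Definition phi_amp Q e j rho x : R[i] :=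
  if j == e then star_X Q e rho * vsol (refl (Q e)) (-1) kap rho (pi - x)
                 + star_Y Q e rho * vsol (refl (Q e)) 1 kap rho (pi - x)
  else 2 * (star_P Q e j rho * vsol (Q j) (-1) kap rho x).

Definition dphi_amp Q e j rho x : R[i] :=
  if j == e then star_X Q e rho * dsol (refl (Q e)) (-1) kap rho (pi - x)
                 + star_Y Q e rho * dsol (refl (Q e)) 1 kap rho (pi - x)
  else - (2 * (star_P Q e j rho * dsol (Q j) (-1) kap rho x)).

(** The distance in the graph from the point [x] of edge [j] to the boundary vertex of edge [e]. *)
Definition phi_arg e j x : R := if j == e then x else 2 * pi - x.

(* A solution of the symmetric star vanishing at the boundary vertices other
   than that of edge [e], scaled by exponentials so as to be bounded in
   [Im rho >= b]; [phi Q e e rho 0] is the characteristic function. *)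
Definition phi Q e j rho x : R[i] := ce rho (phi_arg e j x) * phi_amp Q e j rho x.
Definition dphi Q e j rho x : R[i] :=
  ii R * rho * (ce rho (phi_arg e j x) * dphi_amp Q e j rho x).

Section FixedFamily.
Variables (Q : 'I_n.+1 -> R -> R[i]) (e : 'I_n.+1) (rho : R[i]).
Hypotheses (adm : forall j, admissible (Q j)) (brho : b <= complex.Im rho).

Let cN1 : cmod (-1 : R[i]) <= 1. Proof. by rewrite cmodN cmod1. Qed.
Let c1 : cmod (1 : R[i]) <= 1. Proof. by rewrite cmod1. Qed.

Let SLv q (eps : R[i]) : cmod eps <= 1 -> admissible q -> SL_solution q (rho ^+ 2)
  (fun x => ce rho (- x) * vsol q eps kap rho x)
  (fun x => - (ii R * rho) * (ce rho (- x) * dsol q eps kap rho x)).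
Proof. by move=> eps1 [iq iq2 Q1]; exact: (SL_solution_vsol iq iq2 eps1 b0 kap0 kap1 Q1 brho). Qed.

Let v0 q (eps : R[i]) : cmod eps <= 1 -> admissible q -> vsol q eps kap rho 0 = 1 + eps.
Proof. by move=> eps1 [iq iq2 Q1]; exact: (vsol0 iq eps1 b0 kap0 kap1 Q1 brho). Qed.

Lemma SL_solution_phi j : SL_solution (Q j) (rho ^+ 2) (phi Q e j rho) (dphi Q e j rho).
Proof.
have [->|je] := eqVneq j e; last first.
  apply: (eq_SL_solution _ _ _ (SL_solutionZ (2 * ce rho (2 * pi) * star_P Q e j rho)
    (SLv cN1 (adm j)))) => // x _; rewrite /phi /dphi /phi_amp /dphi_amp /phi_arg (negbTE je) ceD; ring.
have ar := admissible_refl (adm e).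
have E x : ce rho x = ce rho pi * ce rho (- (pi - x)) by rewrite -ceD; congr ce; ring.
have H := SL_solutionD (SL_solutionZ (star_X Q e rho) (SLv cN1 ar))
                       (SL_solutionZ (star_Y Q e rho) (SLv c1 ar)).
apply: (eq_SL_solution _ _ _ (SL_solution_reflect (SL_solutionZ (ce rho pi) H))) => x _.
- by rewrite /refl subKr.
- rewrite /phi /phi_amp /phi_arg eqxx.
  by rewrite (E x); ring.
- rewrite /dphi /dphi_amp /phi_arg eqxx.
  by rewrite (E x); ring.
Qed.

Lemma phi_pi j : phi Q e j rho pi = 2 * ce rho pi * star_Y Q e rho.
Proof.
rewrite /phi /phi_amp /phi_arg; have [_|je] := eqVneq j e.
  rewrite subrr !v0 //; [|exact: admissible_refl..].
  by rewrite subrr mulr0 add0r; ring.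
rewrite (_ : 2 * pi - pi = pi); last by ring.
by rewrite /star_Y (bigD1 j) //= -/(s_end Q j rho) -/(star_P Q e j rho); ring.
Qed.

Let d0 q (eps : R[i]) : dsol q eps kap rho 0 = 1 - eps.
Proof. exact: dsol0. Qed.

Lemma symmetric_star_phi :
  symmetric_star Q (rho ^+ 2) (fun j => phi Q e j rho) (fun j => dphi Q e j rho).
Proof.
split; [exact: SL_solution_phi|by move=> i j; rewrite !phi_pi|].
rewrite (bigD1 e) //= {1}/dphi {1}/dphi_amp /phi_arg eqxx subrr !d0 opprK subrr mulr0 addr0.
rewrite (eq_bigr (fun j => - (2 * ii R * rho * ce rho pi) * (star_P Q e j rho * d_end Q j rho))).
  by rewrite -mulr_sumr -/(star_X Q e rho); ring.
move=> j /negbTE je; rewrite /dphi /dphi_amp /phi_arg je (_ : 2 * pi - pi = pi); last by ring.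
by rewrite -/(d_end Q j rho); ring.
Qed.

Lemma phi_0 j : j != e -> phi Q e j rho 0 = 0.
Proof.
move=> /negbTE je; rewrite /phi /phi_amp je v0 //.
by rewrite subrr !mulr0.
Qed.

End FixedFamily.

(* Summing the Wronskians over the edges, the contributions of the interior
   vertex cancel by the matching conditions. *)
Lemma symmetric_star_wronskian lam Q1 Q2 Y1 dY1 Y2 dY2 (P : 'I_n.+1 -> R[i]) :
  symmetric_star Q1 lam Y1 dY1 -> symmetric_star Q2 lam Y2 dY2 ->
  (forall j, (dY1 j pi * Y2 j pi - Y1 j pi * dY2 j pi)
             - (dY1 j 0 * Y2 j 0 - Y1 j 0 * dY2 j 0) = P j) ->
  \sum_j (dY1 j 0 * Y2 j 0 - Y1 j 0 * dY2 j 0) = - \sum_j P j.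
Proof.
move=> [_ V1 S1] [_ V2 S2] HP; under [in RHS]eq_bigr do rewrite -HP.
rewrite !sumrB opprB; apply/eqP; rewrite -subr_eq0 opprB addrCA subrr addr0.
rewrite (eq_bigr (fun j => dY1 j pi * Y2 ord0 pi)); last by move=> j _; rewrite (V2 j ord0).
rewrite [X in _ - X](eq_bigr (fun j => Y1 ord0 pi * dY2 j pi)); last by move=> j _; rewrite (V1 j ord0).
by rewrite -mulr_suml -mulr_sumr S1 S2 mulr0 mul0r subrr.
Qed.

Lemma sum_at_vertex e (F : 'I_n.+1 -> R[i]) : (forall j, j != e -> F j = 0) -> \sum_j F j = F e.
Proof. by move=> F0; rewrite (bigD1 e) //= big1 ?addr0. Qed.

(** Uniqueness: the Wronskian of [phi] with any Weyl solution reduces to its value at the boundary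
    vertex of [e], which forces the derivative there to be [N / D]. Existence: [phi] divided by [D]
    is a Weyl solution. *)
Lemma weyl_functionE Q e rho : (forall j, admissible (edge_potential Q j)) -> e != ord0 ->
  b <= complex.Im rho -> phi (edge_potential Q) e e rho 0 != 0 ->
  weyl_function Q e (rho ^+ 2) =
    dphi (edge_potential Q) e e rho 0 / phi (edge_potential Q) e e rho 0.
Proof.
move=> adm e0 brho D0; set D := phi _ _ _ _ _ in D0 *; set N := dphi _ _ _ _ _.
have Sphi := symmetric_star_phi e adm brho.
rewrite /weyl_function.
set W := [set m | _].
have WE m : W m -> m = N / D.
  move=> [Phi [dPhi [[St P0 Pj] ->]]]; have Ss := symmetric_star_of_star St.
  have H := symmetric_star_wronskian (P := fun=> 0) Sphi Ss.
  have {}H := H _; rewrite sumr_const mul0rn oppr0 in H.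
  have {}H : \sum_j (dphi (edge_potential Q) e j rho 0 * edge_fun Phi j 0 -
      phi (edge_potential Q) e j rho 0 * edge_derive dPhi j 0) = 0.
    apply: H => j; apply/eqP; rewrite subr_eq0; apply/eqP; apply: wronskian_const.
      by case: Sphi.
    by case: Ss.
  (* At the other boundary vertices both [phi] and the Weyl solution vanish, so only the term of [e]
     remains. *)
  move: H; rewrite (@sum_at_vertex e); last first.
    move=> j je; rewrite phi_0 // mul0r subr0 /edge_fun.
    have [->|j0] := eqVneq j ord0; first by rewrite subr0 P0 mulr0.
    by rewrite Pj // (negbTE je) mulr0.
  rewrite /edge_fun /edge_derive (negbTE e0) Pj // eqxx mulr1 -/D -/N => /eqP.
  by rewrite subr_eq0 => /eqP ->; rewrite mulrC mulKf.
apply: WE; apply: (@xgetPex _ 0 W).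
exists (D^-1 * N), (edge_fun (fun j x => D^-1 * phi (edge_potential Q) e j rho x)),
  (edge_derive (fun j x => D^-1 * dphi (edge_potential Q) e j rho x)).
split; last by rewrite /edge_derive (negbTE e0).
split.
- apply: star_of_symmetric_star; case: Sphi => SL V S; split.
  + by move=> j; apply: SL_solutionZ.
  + by move=> i j; rewrite (V i j).
  + by rewrite -mulr_sumr S mulr0.
- by rewrite /edge_fun eqxx subrr phi_0 ?mulr0 // eq_sym.
- move=> j j0; rewrite /edge_fun (negbTE j0); have [->|je] := eqVneq j e.
    by rewrite mulVf.
  by rewrite phi_0 ?mulr0.
Qed.

End StarGraphSolutions.

(** * Approximation of the amplitudes and non-vanishing of the characteristic function *)

Section UniformlyClose.
Variables (R : realType) (T : Type) (ok : T -> Prop) (w : T -> R).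
Hypothesis w0 : forall t, 0 <= w t.
Implicit Types F G : T -> R[i].

(** Boundedness of both functions is included so that the relation is closed under products. One
    constant serves all parameters [t]. *)
Definition close F F0 := exists C, forall t, ok t ->
  [/\ cmod (F t) <= C, cmod (F0 t) <= C & cmod (F t - F0 t) <= C * w t].

Lemma eq_close F F0 G G0 : (forall t, ok t -> F t = G t) -> (forall t, ok t -> F0 t = G0 t) ->
  close F F0 -> close G G0.
Proof. by move=> FG FG0 [C HC]; exists C => t ot; rewrite -FG // -FG0 //; exact: HC. Qed.

Lemma close_bounded F C : (forall t, ok t -> cmod (F t) <= C) -> close F F.
Proof.
move=> FC; exists C => t ot; rewrite subrr cmod0; split; rewrite ?FC //.
by rewrite mulr_ge0 // (le_trans (cmod_ge0 _) (FC _ ot)).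
Qed.

Lemma close_cst (c : R[i]) : close (fun=> c) (fun=> c).
Proof. by apply: (@close_bounded _ (cmod c)). Qed.

Lemma closeD F F0 G G0 : close F F0 -> close G G0 ->
  close (fun t => F t + G t) (fun t => F0 t + G0 t).
Proof.
move=> [C HC] [B HB]; exists (C + B) => t ot.
have [f1 f2 f3] := HC t ot; have [g1 g2 g3] := HB t ot; split.
- exact: le_trans (ler_cmodD _ _) (lerD f1 g1).
- exact: le_trans (ler_cmodD _ _) (lerD f2 g2).
- rewrite (_ : _ - _ = (F t - F0 t) + (G t - G0 t)); last by ring.
  by rewrite mulrDl; exact: le_trans (ler_cmodD _ _) (lerD f3 g3).
Qed.

Lemma closeM F F0 G G0 : close F F0 -> close G G0 ->
  close (fun t => F t * G t) (fun t => F0 t * G0 t).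
Proof.
move=> [C HC] [B HB]; exists (2 * (C * B)) => t ot.
have [f1 f2 f3] := HC t ot; have [g1 g2 g3] := HB t ot.
have C0 := le_trans (cmod_ge0 _) f1; have B0 := le_trans (cmod_ge0 _) g1.
have h (x y : R) : 0 <= x -> x <= C -> 0 <= y -> y <= B -> x * y <= 2 * (C * B).
  move=> x0 xC y0 yB; apply: (@le_trans _ _ (C * B)); first exact: ler_pM.
  by rewrite ler_peMl ?mulr_ge0 // ler1n.
split; rewrite ?cmodM ?h ?cmod_ge0 //.
rewrite (_ : _ - _ = (F t - F0 t) * G t + F0 t * (G t - G0 t)); last by ring.
apply: (le_trans (ler_cmodD _ _)); rewrite !cmodM.
apply: (@le_trans _ _ (C * w t * B + C * (B * w t))); last by rewrite le_eqVlt; apply/orP; left; apply/eqP; ring.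
by rewrite lerD // ler_pM ?cmod_ge0.
Qed.

Lemma close_sum I (s : seq I) (P : pred I) (F F0 : I -> T -> R[i]) :
  (forall i, P i -> close (F i) (F0 i)) ->
  close (fun t => \sum_(i <- s | P i) F i t) (fun t => \sum_(i <- s | P i) F0 i t).
Proof.
move=> H; elim: s => [|i s IH].
  by under eq_fun do rewrite big_nil; under [X in close _ X]eq_fun do rewrite big_nil; exact: close_cst.
under eq_fun do rewrite big_cons; under [X in close _ X]eq_fun do rewrite big_cons.
by case Pi: (P i) => //; apply: closeD => //; exact: H.
Qed.

Lemma close_prod I (s : seq I) (P : pred I) (F F0 : I -> T -> R[i]) :
  (forall i, P i -> close (F i) (F0 i)) ->
  close (fun t => \prod_(i <- s | P i) F i t) (fun t => \prod_(i <- s | P i) F0 i t).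
Proof.
move=> H; elim: s => [|i s IH].
  by under eq_fun do rewrite big_nil; under [X in close _ X]eq_fun do rewrite big_nil; exact: close_cst.
under eq_fun do rewrite big_cons; under [X in close _ X]eq_fun do rewrite big_cons.
by case Pi: (P i) => //; apply: closeM => //; exact: H.
Qed.

End UniformlyClose.

Section ProductPerturbation.
Variables (R : realType) (A d : R).

(** For the non-vanishing of the characteristic function the constants matter:
    [(A + d) ^+ m - A ^+ m] is the exact accumulated error of [m] factors of size [A], each
    perturbed by [d], and it composes under products without loss. *)
Definition prod_close (m : nat) (z w : R[i]) :=
  cmod w <= A ^+ m /\ cmod (z - w) <= (A + d) ^+ m - A ^+ m.

Lemma prod_close0 : prod_close 0 1 1.
Proof. by split; rewrite ?cmod1 ?subrr ?cmod0. Qed.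

Lemma prod_close1 z w : cmod w <= A -> cmod (z - w) <= d -> prod_close 1 z w.
Proof. by move=> wA zw; split; rewrite !expr1 // [A + d]addrC addrK. Qed.

Lemma prod_closeM m l z w z' w' : prod_close m z w -> prod_close l z' w' ->
  prod_close (m + l) (z * z') (w * w').
Proof.
move=> [w1 z1] [w2 z2]; split; first by rewrite cmodM exprD ler_pM ?cmod_ge0.
have z'l : cmod z' <= (A + d) ^+ l.
  rewrite -(subrK w' z'); apply: (le_trans (ler_cmodD _ _)).
  by rewrite -(subrK (A ^+ l) ((A + d) ^+ l)) lerD.
rewrite (_ : _ - _ = (z - w) * z' + w * (z' - w')); last by ring.
apply: (le_trans (ler_cmodD _ _)); rewrite !cmodM.
apply: (@le_trans _ _ (((A + d) ^+ m - A ^+ m) * (A + d) ^+ l + A ^+ m * ((A + d) ^+ l - A ^+ l))).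
  by rewrite lerD // ler_pM ?cmod_ge0.
by rewrite !exprD le_eqVlt; apply/orP; left; apply/eqP; ring.
Qed.

Lemma prod_close_prod (I : finType) (P : pred I) (F : I -> R[i]) (w : R[i]) :
  (forall i, P i -> prod_close 1 (F i) w) ->
  prod_close #|P| (\prod_(i | P i) F i) (w ^+ #|P|).
Proof.
move=> H; have -> : w ^+ #|P| = \prod_(i | P i) w by rewrite prodr_const.
rewrite -sum1_card.
elim/big_rec3: _ => [|i m z v Pi IH]; first exact: prod_close0.
have := prod_closeM (H i Pi) IH.
by rewrite add1n.
Qed.

End ProductPerturbation.

Section Amplitudes.
Variables (R : realType) (n : nat) (b kap : R).
Hypotheses (n0 : (0 < n)%N) (b0 : 0 < b) (kap0 : 0 <= kap) (kap1 : kap < 1).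
Implicit Types (q : R -> R[i]) (Q : 'I_n.+1 -> R -> R[i]) (e j : 'I_n.+1) (rho : R[i]) (x : R).

Let eps_ := 2 * kap / (1 - kap).

Let cN1 : cmod (-1 : R[i]) <= 1. Proof. by rewrite cmodN cmod1. Qed.
Let c1 : cmod (1 : R[i]) <= 1. Proof. by rewrite cmod1. Qed.
Let k10 : 0 < 1 - kap. Proof. by rewrite subr_gt0. Qed.

Definition amp0 e j rho x : R[i] :=
  let E := ce rho (2 * pi) in
  (1 - E) ^+ n.-1 * (if j == e
     then n%:R * (1 + E) * (1 - ce rho (2 * (pi - x))) + (1 - E) * (1 + ce rho (2 * (pi - x)))
     else 2 * (1 - ce rho (2 * x))).

Lemma card_neq2 e j : j != e -> #|[pred i | (i != e) && (i != j)]| = n.-1.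
Proof.
move=> je; have := cardC (pred2 e j); rewrite card2 eq_sym je card_ord => H.
have -> : #|[pred i | (i != e) && (i != j)]| = #|[predC (pred2 e j)]|.
  by apply: eq_card => i; rewrite !inE negb_or.
by move/eqP: H; rewrite addSn eqSS add1n => /eqP/(congr1 predn) <-.
Qed.

Lemma card_neq1 e : #|[pred i | i != e]| = n.
Proof. by have := cardC1 e; rewrite card_ord. Qed.

Section Factors.
Variables (q : R -> R[i]) (eps rho : R[i]) (x : R).
Hypotheses (aq : admissible b kap q) (eps1 : cmod eps <= 1) (brho : b <= complex.Im rho).

Let rc : 0 < cmod rho. Proof. exact: lt_le_trans b0 (ler_Im_rho brho). Qed.

Let bnd : 2 / (1 - kap) * rint (fun t => cmod (q t)) / cmod rho <= eps_ * b / cmod rho.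
Proof.
have [_ _ Q1] := aq; rewrite ler_wpM2r ?invr_ge0 ?cmod_ge0 //.
rewrite /eps_ [2 * kap / _]mulrAC -[leRHS]mulrA ler_wpM2l // divr_ge0 // ltW //.
Qed.

Lemma vsol_base : cmod (vsol q eps kap rho x - vbase eps rho x) <= eps_ * b / cmod rho.
Proof.
have [iq iq2 Q1] := aq; apply: le_trans bnd.
exact: (cmod_vsolB iq eps1 b0 kap0 kap1 Q1 brho).
Qed.

Lemma dsol_base : cmod (dsol q eps kap rho x - dbase eps rho x) <= eps_ * b / cmod rho.
Proof.
have [iq iq2 Q1] := aq; apply: le_trans bnd.
exact: (cmod_dsolB iq eps1 b0 kap0 kap1 Q1 brho).
Qed.

Lemma eps_rho : eps_ * b / cmod rho <= eps_.
Proof.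
have e0 : 0 <= eps_ by rewrite divr_ge0 ?mulr_ge0 // ltW.
by rewrite -mulrA ler_piMr // ler_pdivrMr // mul1r ler_Im_rho.
Qed.

End Factors.

Section CloseAmplitudes.
Local Notation fam := ('I_n.+1 -> R -> R[i]).
(** The family of potentials belongs to the parameter, so the constants produced by [close] do not
    depend on it. *)
Let T := (fam * R[i] * R)%type.
Let ok (t : T) := [/\ forall j, admissible b kap (t.1.1 j), b <= complex.Im t.1.2 & 0 <= t.2 <= pi].
Let w (t : T) := (cmod t.1.2)^-1.
Let w0 t : 0 <= w t. Proof. by rewrite invr_ge0 cmod_ge0. Qed.

Let close_vsol (q_ : T -> R -> R[i]) (p : T -> R) (eps : R[i]) : cmod eps <= 1 ->
  (forall t, ok t -> admissible b kap (q_ t)) -> (forall t, ok t -> 0 <= p t) ->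
  close ok w (fun t => vsol (q_ t) eps kap t.1.2 (p t)) (fun t => 1 + eps * ce t.1.2 (2 * p t)).
Proof.
move=> eps1 aq p0; apply: (@eq_close _ _ _ _
  (fun t => vsol (q_ t) eps kap t.1.2 (p t)) (fun t => vbase eps t.1.2 (p t))) => //.
  by move=> t ot; rewrite /vbase (max_idPr (p0 _ ot)).
exists (2 + eps_ + eps_ * b) => t ot; have [_ br _] := ot; have aqt := aq _ ot.
have e0 : 0 <= eps_ by rewrite divr_ge0 ?mulr_ge0 // ltW.
have vb := cmod_vbase eps1 b0 br (p t).
have eb : 0 <= eps_ * b by rewrite mulr_ge0 // ltW.
have db := vsol_base (p t) aqt eps1 br.
split; [| |rewrite /w]; last 1 first.
- by apply: (le_trans db); rewrite ler_wpM2r ?invr_ge0 ?cmod_ge0 //; lra.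
- rewrite -(subrK (vbase eps t.1.2 (p t)) (vsol _ _ _ _ _)); apply: (le_trans (ler_cmodD _ _)).
  by have := le_trans db (eps_rho br); lra.
- by lra.
Qed.

Let close_dsol (q_ : T -> R -> R[i]) (p : T -> R) (eps : R[i]) : cmod eps <= 1 ->
  (forall t, ok t -> admissible b kap (q_ t)) -> (forall t, ok t -> 0 <= p t) ->
  close ok w (fun t => dsol (q_ t) eps kap t.1.2 (p t)) (fun t => 1 - eps * ce t.1.2 (2 * p t)).
Proof.
move=> eps1 aq p0; apply: (@eq_close _ _ _ _
  (fun t => dsol (q_ t) eps kap t.1.2 (p t)) (fun t => dbase eps t.1.2 (p t))) => //.
  by move=> t ot; rewrite /dbase (max_idPr (p0 _ ot)) mulNr.
exists (2 + eps_ + eps_ * b) => t ot; have [_ br _] := ot; have aqt := aq _ ot.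
have e0 : 0 <= eps_ by rewrite divr_ge0 ?mulr_ge0 // ltW.
have eN : cmod (- eps) <= 1 by rewrite cmodN.
have vb : cmod (dbase eps t.1.2 (p t)) <= 2 := cmod_vbase eN b0 br (p t).
have eb : 0 <= eps_ * b by rewrite mulr_ge0 // ltW.
have db := dsol_base (p t) aqt eps1 br.
split; [| |rewrite /w]; last 1 first.
- by apply: (le_trans db); rewrite ler_wpM2r ?invr_ge0 ?cmod_ge0 //; lra.
- rewrite -(subrK (dbase eps t.1.2 (p t)) (dsol _ _ _ _ _)); apply: (le_trans (ler_cmodD _ _)).
  by have := le_trans db (eps_rho br); lra.
- by lra.
Qed.

Lemma close_amp e j :
  close ok w (fun t => phi_amp kap t.1.1 e j t.1.2 t.2) (fun t => amp0 e j t.1.2 t.2).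
Proof.
have pi0 := pi_ge0 R.
have cs i : close ok w (fun t => s_end kap t.1.1 i t.1.2) (fun t => 1 - ce t.1.2 (2 * pi)).
  have H := @close_vsol (fun t => t.1.1 i) (fun=> pi) (-1) cN1.
  apply: (eq_close _ _ (H _ _)) => //; [by move=> t _; rewrite mulN1r|by move=> t []].
have cd i : close ok w (fun t => d_end kap t.1.1 i t.1.2) (fun t => 1 + ce t.1.2 (2 * pi)).
  have H := @close_dsol (fun t => t.1.1 i) (fun=> pi) (-1) cN1.
  by apply: (eq_close _ _ (H _ _)) => //; [move=> t _; rewrite mulN1r opprK|move=> t []].
have cP i : i != e -> close ok w (fun t => star_P kap t.1.1 e i t.1.2)
    (fun t => (1 - ce t.1.2 (2 * pi)) ^+ n.-1).
  move=> ie; apply: (eq_close _ _ (close_prod w0 (index_enum _) (fun l _ => cs l))) => // t _.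
  by rewrite prodr_const card_neq2.
have cX : close ok w (fun t => star_X kap t.1.1 e t.1.2)
    (fun t => n%:R * ((1 - ce t.1.2 (2 * pi)) ^+ n.-1 * (1 + ce t.1.2 (2 * pi)))).
  apply: (eq_close _ _ (close_sum w0 (index_enum _) (fun l le => closeM (cP l le) (cd l)))) => // t _.
  by rewrite sumr_const card_neq1 [RHS]mulr_natl.
have cY : close ok w (fun t => star_Y kap t.1.1 e t.1.2) (fun t => (1 - ce t.1.2 (2 * pi)) ^+ n).
  apply: (eq_close _ _ (close_prod w0 (index_enum _) (fun l _ => cs l))) => // t _.
  by rewrite prodr_const card_neq1.
rewrite /phi_amp /amp0; case: (eqVneq j e) => je.
  have ar t : ok t -> admissible b kap (refl (t.1.1 e)).
    by case=> at_ _ _; exact: admissible_refl.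
  have p0 (t : T) : ok t -> 0 <= pi - t.2 by case=> _ _ /andP[_]; rewrite subr_ge0.
  have H1 := @close_vsol (fun t => refl (t.1.1 e)) (fun t => pi - t.2) (-1) cN1 ar p0.
  have H2 := @close_vsol (fun t => refl (t.1.1 e)) (fun t => pi - t.2) 1 c1 ar p0.
  apply: (eq_close _ _ (closeD (closeM cX H1) (closeM cY H2))) => // t _.
  rewrite mulN1r mul1r (_ : (1 - ce t.1.2 (2 * pi)) ^+ n =
    (1 - ce t.1.2 (2 * pi)) ^+ n.-1 * (1 - ce t.1.2 (2 * pi))); first by ring.
  by rewrite -exprSr prednK.
have aj t : ok t -> admissible b kap (t.1.1 j) by case.
have p0 (t : T) : ok t -> 0 <= t.2 by case=> _ _ /andP[].
have H := @close_vsol (fun t => t.1.1 j) (fun t => t.2) (-1) cN1 aj p0.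
apply: (eq_close _ _ (closeM (close_cst ok w0 2) (closeM (cP j je) H))) => // t _.
by rewrite mulN1r; ring.
Qed.

End CloseAmplitudes.

Lemma amp_estimates : exists2 C, 0 < C & forall e j Q rho x,
  (forall j, admissible b kap (Q j)) -> b <= complex.Im rho -> 0 <= x <= pi ->
  [/\ cmod (phi_amp kap Q e j rho x) <= C, cmod (amp0 e j rho x) <= C &
      cmod (phi_amp kap Q e j rho x - amp0 e j rho x) <= C / cmod rho].
Proof.
have /choice[C HC] : forall z : 'I_n.+1 * 'I_n.+1, exists C, forall Q rho x,
    (forall j, admissible b kap (Q j)) -> b <= complex.Im rho -> 0 <= x <= pi ->
    [/\ cmod (phi_amp kap Q z.1 z.2 rho x) <= C, cmod (amp0 z.1 z.2 rho x) <= C &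
        cmod (phi_amp kap Q z.1 z.2 rho x - amp0 z.1 z.2 rho x) <= C / cmod rho].
  move=> [e j]; have [C HC] := close_amp e j; exists C => Q rho x aQ br x0.
  exact: (HC (Q, rho, x)).
(* A single constant above the finitely many [C z]; the 1 makes it positive. *)
exists (\sum_z `|C z| + 1) => [|e j Q rho x aQ br x0].
  by rewrite ltr_wpDl // sumr_ge0.
have [h1 h2 h3] := HC (e, j) Q rho x aQ br x0.
have CC : C (e, j) <= \sum_z `|C z| + 1.
  rewrite (bigD1 (e, j)) //=; have := ler_norm (C (e, j)).
  have : 0 <= \sum_(i | i != (e, j)) `|C i| by exact: sumr_ge0.
  by lra.
split; [exact: le_trans CC|exact: le_trans CC|apply: (le_trans h3)].
by rewrite ler_wpM2r // invr_ge0 cmod_ge0.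
Qed.

Hypotheses (hE : expR (- (b * (2 * pi))) <= 4^-1 :> R)
  (heps : (5 / 4 + eps_) ^+ n.+1 - (5 / 4) ^+ n.+1 < (3 / 4) ^+ n.+1).

Lemma cmod_E rho : b <= complex.Im rho -> cmod (ce rho (2 * pi)) <= 4^-1.
Proof.
move=> br; rewrite cmod_ce; apply: le_trans hE; rewrite ler_expR lerN2 ler_wpM2r //.
by rewrite mulr_ge0 // pi_ge0.
Qed.

(** The value is a sum of [n.+1] products of [n.+1] factors, each product having the leading value
    [D0 = (1 + E) * (1 - E) ^+ n]. As [|E| <= 1/4], the modulus of [D0] is at least
    [(3 / 4) ^+ n.+1], while each product deviates by at most [B], which [heps] makes smaller. *)
Lemma phi_0_neq0 Q e rho : (forall j, admissible b kap (Q j)) -> b <= complex.Im rho ->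
  phi kap Q e e rho 0 != 0.
Proof.
move=> aQ br; set E := ce rho (2 * pi); have Eb : cmod E <= 4^-1 := cmod_E br.
have A0 : 0 <= 5 / 4 :> R by rewrite divr_ge0.
have pi0 := pi_ge0 R.
have e0 : 0 <= eps_ by rewrite divr_ge0 ?mulr_ge0 // ltW.
have p1 q z : admissible b kap q -> cmod z <= 5 / 4 -> vbase (-1) rho pi = z ->
    prod_close (5 / 4) eps_ 1 (vsol q (-1) kap rho pi) z.
  move=> aq z1 zE; apply: prod_close1 => //; rewrite -zE.
  exact: le_trans (vsol_base _ aq cN1 br) (eps_rho br).
have EB : cmod (1 - E) <= 5 / 4.
  by apply: (le_trans (ler_cmodB _ _)); rewrite cmod1; lra.
have ED : cmod (1 + E) <= 5 / 4.
  by apply: (le_trans (ler_cmodD _ _)); rewrite cmod1; lra.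
have vE : vbase (-1) rho pi = 1 - E by rewrite /vbase (max_idPr pi0) mulN1r.
have ps q : admissible b kap q -> prod_close (5 / 4) eps_ 1 (vsol q (-1) kap rho pi) (1 - E).
  by move=> aq; exact: p1.
have pc q : admissible b kap q -> prod_close (5 / 4) eps_ 1 (vsol q 1 kap rho pi) (1 + E).
  move=> aq; apply: prod_close1 => //; rewrite (_ : 1 + E = vbase 1 rho pi); last first.
    by rewrite /vbase (max_idPr pi0) mul1r.
  exact: le_trans (vsol_base _ aq c1 br) (eps_rho br).
have pd q : admissible b kap q -> prod_close (5 / 4) eps_ 1 (dsol q (-1) kap rho pi) (1 + E).
  move=> aq; apply: prod_close1 => //; rewrite (_ : 1 + E = dbase (-1) rho pi); last first.
    by rewrite /dbase (max_idPr pi0) opprK mul1r.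
  exact: le_trans (dsol_base _ aq cN1 br) (eps_rho br).
pose B := (5 / 4 + eps_) ^+ n.+1 - (5 / 4) ^+ n.+1.
pose D0 := (1 + E) * (1 - E) ^+ n.
have ar := admissible_refl (aQ e).
have tX j : j != e -> cmod (star_P kap Q e j rho * d_end kap Q j rho * vsol (refl (Q e)) (-1) kap rho pi - D0) <= B.
  move=> je.
  have H := prod_closeM (prod_closeM
    (prod_close_prod (P := [pred i | (i != e) && (i != j)]) (fun i _ => ps _ (aQ i))) (pd _ (aQ j))) (ps _ ar).
  move: H => [_]; rewrite card_neq2 // !addn1 prednK // -/(B).
  rewrite (_ : (1 - E) ^+ n.-1 * (1 + E) * (1 - E) = D0) //.
  rewrite /D0 (_ : (1 - E) ^+ n = (1 - E) ^+ n.-1 * (1 - E)); first by ring.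
  by rewrite -exprSr prednK.
have tY : cmod (star_Y kap Q e rho * vsol (refl (Q e)) 1 kap rho pi - D0) <= B.
  have H := prod_closeM
    (prod_close_prod (P := [pred i | i != e]) (fun i _ => ps _ (aQ i))) (pc _ ar).
  by move: H => [_]; rewrite card_neq1 addn1 /D0 [(1 + E) * _]mulrC.
have -> : phi kap Q e e rho 0 = star_X kap Q e rho * vsol (refl (Q e)) (-1) kap rho pi
    + star_Y kap Q e rho * vsol (refl (Q e)) 1 kap rho pi.
  by rewrite /phi /phi_amp /phi_arg eqxx ce0 mul1r subr0.
set D := _ + _.
have HD : cmod (D - n.+1%:R * D0) <= n.+1%:R * B.
  have -> : D - n.+1%:R * D0 = \sum_(j | j != e) (star_P kap Q e j rho * d_end kap Q j rho *
      vsol (refl (Q e)) (-1) kap rho pi - D0) + (star_Y kap Q e rho * vsol (refl (Q e)) 1 kap rho pi - D0).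
    rewrite sumrB -mulr_suml sumr_const card_neq1 -mulr_natl -/(star_X kap Q e rho) /D -addn1 natrD.
    by ring.
  apply: (le_trans (ler_cmodD _ _)); rewrite -[n.+1%:R]natr1 mulrDl mul1r lerD //.
  apply: (le_trans (ler_cmod_sum _ _ _)); apply: (@le_trans _ _ (\sum_(j | j != e) B)).
    by apply: ler_sum => j je; exact: tX.
  by rewrite sumr_const card_neq1 mulr_natl.
rewrite -cmod_gt0.
have lo : (3 / 4) ^+ n.+1 <= cmod D0.
  rewrite /D0 cmodM cmodX exprS.
  have l1 : 3 / 4 <= cmod (1 + E).
    have := ler_cmodB (1 + E) E; rewrite addrK cmod1; lra.
  have l2 : 3 / 4 <= cmod (1 - E).
    have := ler_cmodD (1 - E) E; rewrite subrK cmod1; lra.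
  apply: ler_pM => //; rewrite ?exprn_ge0 ?divr_ge0 //.
  by rewrite lerXn2r ?nnegrE ?cmod_ge0 ?divr_ge0.
have tri : cmod (n.+1%:R * D0) <= cmod D + cmod (D - n.+1%:R * D0).
  rewrite -[X in cmod X <= _](subKr D); exact: ler_cmodB.
move: tri; rewrite cmodM cmod_nat => tri.
have N0 : 0 < n.+1%:R :> R by rewrite ltr0n.
have : n.+1%:R * B < n.+1%:R * cmod D0 by rewrite ltr_pM2l //; exact: lt_le_trans heps lo.
by move: tri HD; lra.
Qed.

End Amplitudes.

Lemma sqr_cmodB (R : realType) (z w : R[i]) :
  cmod (z - w) ^+ 2 <= 2 * cmod z ^+ 2 + 2 * cmod w ^+ 2.
Proof.
apply: (@le_trans _ _ ((cmod z + cmod w) ^+ 2)).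
  by rewrite lerXn2r ?nnegrE ?addr_ge0 ?cmod_ge0 // ler_cmodB.
by have := sqr_ge0 (cmod z - cmod w); nra.
Qed.

(** * Differences of Weyl functions in terms of differences of potentials *)

Section WeylDifference.
Variables (R : realType) (n : nat) (b kap : R).
Hypotheses (n0 : (0 < n)%N) (b0 : 0 < b) (kap0 : 0 <= kap) (kap1 : kap < 1).
Implicit Types (q : R -> R[i]) (Q : 'I_n.+1 -> R -> R[i]) (e j : 'I_n.+1) (rho : R[i]) (x : R).

Let cN1 : cmod (-1 : R[i]) <= 1. Proof. by rewrite cmodN cmod1. Qed.
Let c1 : cmod (1 : R[i]) <= 1. Proof. by rewrite cmod1. Qed.

Lemma measurable_phi_arg e j : measurable_fun setT (@phi_arg R n e j).
Proof. by rewrite /phi_arg; case: (j == e); [exact: measurable_id|exact: measurable_funB]. Qed.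

Lemma phi_arg_ge0 e j x : 0 <= x <= pi -> 0 <= phi_arg e j x.
Proof. by move=> /andP[x0 xp]; rewrite /phi_arg; case: ifP => _ //; have := pi_ge0 R; lra. Qed.

Section OneFamily.
Variables (Q : 'I_n.+1 -> R -> R[i]) (e : 'I_n.+1).
Hypothesis adm : forall j, admissible b kap (Q j).

Let lm_vsol q (eps : R[i]) tau (p : R * R -> R) : b <= tau -> admissible b kap q ->
  cmod eps <= 1 -> measurable_fun setT p ->
  cmeas (fun z : R * R => vsol q eps kap (z.2 +i* tau) (p z)).
Proof.
move=> bt [iq _ Q1] eps1 mp.
apply: (@cmeas_comp _ _ _ _ _ (fun z : R * R => vsol q eps kap (z.2 +i* tau) z.1)
  (fun z => (p z, z.2)) (line_meas_vsol iq eps1 b0 kap0 kap1 Q1 bt)).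
by apply: measurable_fun_pair => //; exact: measurable_snd.
Qed.

Let lm_dsol q (eps : R[i]) tau (p : R * R -> R) : b <= tau -> admissible b kap q ->
  cmod eps <= 1 -> measurable_fun setT p ->
  cmeas (fun z : R * R => dsol q eps kap (z.2 +i* tau) (p z)).
Proof.
move=> bt [iq _ Q1] eps1 mp.
apply: (@cmeas_comp _ _ _ _ _ (fun z : R * R => dsol q eps kap (z.2 +i* tau) z.1)
  (fun z => (p z, z.2))); last first.
  by apply: measurable_fun_pair => //; exact: measurable_snd.
have eN : cmod (- eps) <= 1 by rewrite cmodN.
apply: cmeasD; first exact: (line_meas_vbase (- eps) tau).
apply: (line_meas_vint iq (line_meas_dkern tau)).
exact: (line_meas_vsol iq eps1 b0 kap0 kap1 Q1 bt).
Qed.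

Lemma line_meas_phi j tau : b <= tau -> line_meas (phi kap Q e j) tau.
Proof.
move=> bt.
have ms i : cmeas (fun z : R * R => s_end kap Q i (z.2 +i* tau)).
  by apply: lm_vsol => //; exact: measurable_cst.
have md i : cmeas (fun z : R * R => d_end kap Q i (z.2 +i* tau)).
  by apply: lm_dsol => //; exact: measurable_cst.
have mP i : cmeas (fun z : R * R => star_P kap Q e i (z.2 +i* tau)) by exact: cmeas_prod.
apply: cmeasM.
  apply: cmeas_ce; first exact: cmeas_rho.
  exact: (measurableT_comp (measurable_phi_arg e j) measurable_fst).
rewrite /phi_amp; case: (j == e).
  have mp : measurable_fun setT (fun z : R * R => pi - z.1) by exact: measurable_funB.
  have ar := admissible_refl (adm e).
  apply: cmeasD; apply: cmeasM; [|exact: lm_vsol| |exact: lm_vsol].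
    by apply: cmeas_sum => i _; exact: cmeasM.
  exact: cmeas_prod.
apply: cmeasM; first exact: cmeas_cst.
by apply: cmeasM => //; apply: lm_vsol => //; exact: measurable_fst.
Qed.

Section Poisson.
Variables (s0 h : R).
Hypothesis h0 : 0 < h.

Let pv q (eps : R[i]) x : admissible b kap q -> cmod eps <= 1 ->
  poisson_algebra s0 b h (fun r => vsol q eps kap r x).
Proof. by move=> [iq _ Q1] eps1; exact: (poisson_algebra_vsol iq eps1 b0 kap0 kap1 Q1 s0 h0 x). Qed.

Let pd q (eps : R[i]) x : admissible b kap q -> cmod eps <= 1 ->
  poisson_algebra s0 b h (fun r => dsol q eps kap r x).
Proof. by move=> [iq _ Q1] eps1; exact: (poisson_algebra_dsol iq eps1 b0 kap0 kap1 Q1 s0 h0 x). Qed.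

Lemma poisson_algebra_phi j x : 0 <= x <= pi ->
  poisson_algebra s0 b h (fun r => phi kap Q e j r x).
Proof.
move=> x0; have pP i : poisson_algebra s0 b h (star_P kap Q e i).
  by apply: (poisson_algebra_prod (ltW b0) h0) => l _; exact: pv.
apply: poisson_algebraM.
  by apply: poisson_algebra_ce; rewrite ?(ltW b0) ?h0 //; exact: phi_arg_ge0.
rewrite /phi_amp; case: (j == e).
  have ar := admissible_refl (adm e).
  apply: (poisson_algebraD (ltW b0) h0); apply: poisson_algebraM; [|exact: pv| |exact: pv].
    apply: (poisson_algebra_sum (ltW b0) h0) => i _; apply: poisson_algebraM => //; exact: pd.
  by apply: (poisson_algebra_prod (ltW b0) h0) => i _; exact: pv.
apply: poisson_algebraM; first exact: (poisson_algebra_cst _ (ltW b0) h0).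
by apply: poisson_algebraM => //; exact: pv.
Qed.

End Poisson.
End OneFamily.

Definition inside (F : R -> R[i]) x : R[i] := if 0 < x < pi then F x else 0.

Definition star_G Q Q' e rho : R[i] := \sum_j cint (fun t =>
  (Q j t - Q' j t) * inside (fun x => phi kap Q e j rho x * phi kap Q' e j rho x) t).

Section TwoFamilies.
Variables (Q Q' : 'I_n.+1 -> R -> R[i]) (e : 'I_n.+1).
Hypotheses (adm : forall j, admissible b kap (Q j)) (adm' : forall j, admissible b kap (Q' j)).

Lemma cintble_diff j : cintble (fun t => Q j t - Q' j t).
Proof. by have [h _ _] := adm j; have [h' _ _] := adm' j; exact: cintbleB. Qed.

Lemma rintble_diff j : rintble (fun t => cmod (Q j t - Q' j t) ^+ 2).
Proof.
have [_ h _] := adm j; have [_ h' _] := adm' j.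
apply: (@rintble_le _ _ (fun t => 2 * cmod (Q j t) ^+ 2 + 2 * cmod (Q' j t) ^+ 2)).
- by apply: measurable_funX; apply: measurable_cmod; apply: cintble_meas; exact: cintble_diff.
- by move=> t; rewrite ger0_norm ?sqr_ge0 // sqr_cmodB.
- by apply: rintbleD; exact: rintbleZ.
Qed.

Lemma phi_bounded : exists2 C, 0 <= C & forall j rho x, b <= complex.Im rho -> 0 <= x <= pi ->
  cmod (phi kap Q e j rho x * phi kap Q' e j rho x) <= C.
Proof.
have [C C0 HC] := amp_estimates n0 b0 kap0 kap1.
exists (C * C) => [|j rho x br x0]; first by rewrite mulr_ge0 // ltW.
have I0 : 0 <= complex.Im rho by exact: le_trans (ltW b0) br.
have ce1 := cmod_ce_le1 I0 (phi_arg_ge0 e j x0).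
have H Q0 : (forall j, admissible b kap (Q0 j)) -> cmod (phi kap Q0 e j rho x) <= C.
  move=> a0; rewrite cmodM; have [h _ _] := HC e j Q0 rho x a0 br x0.
  by rewrite -[leRHS]mul1r ler_pM ?cmod_ge0.
by rewrite cmodM ler_pM ?cmod_ge0 ?H.
Qed.

Let line_meas_inside j tau : b <= tau ->
  line_meas (fun r => inside (fun x => phi kap Q e j r x * phi kap Q' e j r x)) tau.
Proof.
move=> bt; apply: cmeas_if; last exact: cmeas_cst.
  by apply: measurable_and; exact: measurable_fun_ltr.
by apply: cmeasM; exact: line_meas_phi.
Qed.

Lemma poisson_algebra_star_G s0 h : 0 < h -> poisson_algebra s0 b h (star_G Q Q' e).
Proof.
move=> h0; have [C C0 HC] := phi_bounded.
have bh : b <= b + h by rewrite lerDl ltW.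
have HB j t rho : b <= complex.Im rho ->
    cmod (inside (fun x => phi kap Q e j rho x * phi kap Q' e j rho x) t) <= C.
  move=> br; rewrite /inside; case: ifPn => [/andP[t0 tp]|_]; last by rewrite cmod0.
  by apply: HC => //; rewrite !ltW.
apply: (poisson_algebra_sum (ltW b0) h0) => j _.
apply: (@poisson_algebra_int _ _ _ _ (ltW b0) h0 _
  (fun t rho => inside (fun x => phi kap Q e j rho x * phi kap Q' e j rho x) t) C).
- exact: cintble_diff.
- move=> t; rewrite /inside; case: (boolP (0 < t < pi)) => [/andP[t0 tp]|_].
    by apply: poisson_algebraM; apply: poisson_algebra_phi => //; rewrite !ltW.
  exact: (poisson_algebra_cst _ (ltW b0) h0).
- by move=> t s; exact: HB.
- by move=> t; exact: HB.
- exact: line_meas_inside.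
- exact: (line_meas_fixed (rho := s0 +i* (b + h)) (line_meas_inside j bh)).
Qed.

Hypotheses (Q0 : forall j x, ~~ (0 < x < pi) -> Q j x = 0)
  (Q0' : forall j x, ~~ (0 < x < pi) -> Q' j x = 0).

(** Boundary vertices other than that of [e] do not contribute, because both solutions vanish
    there. *)
Lemma star_G_wronskian rho : b <= complex.Im rho ->
  dphi kap Q e e rho 0 * phi kap Q' e e rho 0 - phi kap Q e e rho 0 * dphi kap Q' e e rho 0
  = - star_G Q Q' e rho.
Proof.
move=> br; have [C C0 HC] := phi_bounded.
have S := symmetric_star_phi b0 kap0 kap1 e adm br.
have S' := symmetric_star_phi b0 kap0 kap1 e adm' br.
have W := symmetric_star_wronskian (P := fun j => cint (fun t =>
  (Q j t - Q' j t) * inside (fun x => phi kap Q e j rho x * phi kap Q' e j rho x) t)) S S'.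
rewrite /star_G -W.
  rewrite (@sum_at_vertex _ _ e) // => j je.
  by rewrite !(phi_0 b0 kap0 kap1) // mulr0 mul0r subrr.
move=> j; case: S => SL _ _; case: S' => SL' _ _.
have Pb t : cmod ((Q j t - Q' j t) * inside (fun x => phi kap Q e j rho x * phi kap Q' e j rho x) t)
    <= C * cmod (Q j t - Q' j t).
  rewrite cmodM mulrC ler_wpM2r ?cmod_ge0 // /inside.
  by case: ifPn => [/andP[t0 tp]|_]; rewrite ?cmod0 // HC // !ltW.
have mP : cmeas (fun t => (Q j t - Q' j t) * inside (fun x => phi kap Q e j rho x * phi kap Q' e j rho x) t).
  apply: cmeasM; first exact: (cintble_meas (cintble_diff j)).
  exact: (line_meas_fixed (line_meas_inside j br)).
apply: (wronskian_diff (SL j) (SL' j)).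
- by move=> x x0; rewrite /inside x0.
- by move=> x x0; rewrite Q0 // Q0' // subrr mul0r.
- apply: (cintble_le mP Pb); apply: rintbleZ; exact: rintble_cmod (cintble_diff j).
- apply: (@rintble_le _ _ (fun t => C ^+ 2 * cmod (Q j t - Q' j t) ^+ 2)).
  + by apply: measurable_funX; exact: measurable_cmod.
  + move=> t; rewrite ger0_norm ?sqr_ge0 // -exprMn lerXn2r ?nnegrE ?cmod_ge0 //.
    by rewrite mulr_ge0 ?cmod_ge0.
  + by apply: rintbleZ; exact: rintble_diff.
Qed.

End TwoFamilies.

Hypotheses (hE : expR (- (b * (2 * pi))) <= 4^-1 :> R)
  (heps : (5 / 4 + 2 * kap / (1 - kap)) ^+ n.+1 - (5 / 4) ^+ n.+1 < (3 / 4) ^+ n.+1).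

Lemma weyl_diffE Q Q' e rho : (forall j, admissible b kap (edge_potential Q j)) ->
  (forall j, admissible b kap (edge_potential Q' j)) -> e != ord0 -> b <= complex.Im rho ->
  weyl_function Q e (rho ^+ 2) - weyl_function Q' e (rho ^+ 2) =
  - star_G (edge_potential Q) (edge_potential Q') e rho /
    (phi kap (edge_potential Q) e e rho 0 * phi kap (edge_potential Q') e e rho 0).
Proof.
move=> aQ aQ' e0 br.
have D0 := phi_0_neq0 n0 b0 kap0 kap1 hE heps e aQ br.
have D0' := phi_0_neq0 n0 b0 kap0 kap1 hE heps e aQ' br.
rewrite !(weyl_functionE b0 kap0 kap1) //.
have Z0 Q1 j x : ~~ (0 < x < pi) -> @edge_potential R n Q1 j x = 0.
  by rewrite /edge_potential => /negbTE ->.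
rewrite -(star_G_wronskian e aQ aQ' (Z0 Q) (Z0 Q') br).
move: (dphi _ _ _ _ _ _) (dphi kap (edge_potential Q') _ _ _ _) D0 D0' => N N'.
move: (phi _ _ _ _ _ _) (phi kap (edge_potential Q') _ _ _ _) => D D' D0 D0'.
by field; rewrite D0 D0'.
Qed.

(** In the formula for the difference the denominators are bounded from above by [amp_estimates],
    uniformly in the potentials; their non-vanishing is what allows them to be multiplied out. *)
Lemma cmod_star_G_le : exists2 C, 0 < C & forall Q Q' e rho,
  (forall j, admissible b kap (edge_potential Q j)) ->
  (forall j, admissible b kap (edge_potential Q' j)) -> e != ord0 -> b <= complex.Im rho ->
  cmod (star_G (edge_potential Q) (edge_potential Q') e rho) <=
    C * cmod (weyl_function Q e (rho ^+ 2) - weyl_function Q' e (rho ^+ 2)).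
Proof.
have [C C0 HC] := amp_estimates n0 b0 kap0 kap1.
exists (C * C) => [|Q Q' e rho aQ aQ' e0 br]; first exact: mulr_gt0.
have D0 := phi_0_neq0 n0 b0 kap0 kap1 hE heps e aQ br.
have D0' := phi_0_neq0 n0 b0 kap0 kap1 hE heps e aQ' br.
rewrite weyl_diffE // cmodM cmodN cmodV cmodM.
have x0 (x : R) : 0 <= x -> ((0 : R) <= 0) && (0 <= x) by move=> ->; rewrite lexx.
have pb Q1 : (forall j, admissible b kap (Q1 j)) -> cmod (phi kap Q1 e e rho 0) <= C.
  move=> a1; rewrite cmodM /phi_arg eqxx ce0 cmod1 mul1r.
  by have [] := HC e e Q1 rho 0 a1 br (x0 _ (pi_ge0 R)).
rewrite mulrCA ler_peMr ?cmod_ge0 // ler_pdivlMr ?mul1r; last by rewrite mulr_gt0 ?cmod_gt0.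
by rewrite ler_pM ?cmod_ge0 ?pb.
Qed.

Lemma measurable_weyl_diff Q Q' e : (forall j, admissible b kap (edge_potential Q j)) ->
  (forall j, admissible b kap (edge_potential Q' j)) -> e != ord0 ->
  measurable_fun setT (fun s : R =>
    cmod (weyl_function Q e ((s +i* b) ^+ 2) - weyl_function Q' e ((s +i* b) ^+ 2)) ^+ 2).
Proof.
move=> aQ aQ' e0; apply: measurable_funX; apply: measurable_cmod.
under eq_fun do rewrite weyl_diffE //.
have [[mG _] _] := poisson_algebra_star_G e aQ aQ' 0 ltr01.
have mphi Q1 : (forall j, admissible b kap (Q1 j)) -> cmeas (fun s : R => phi kap Q1 e e (s +i* b) 0).
  move=> a1; apply: (@cmeas_comp _ _ _ _ _ (fun z : R * R => phi kap Q1 e e (z.2 +i* b) z.1)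
    (fun s : R => (0 : R, s)) (line_meas_phi e a1 e (lexx b))).
  by apply: measurable_fun_pair.
apply: cmeasM; first exact: cmeasN.
by apply: cmeas_inv; apply: cmeasM; exact: mphi.
Qed.

End WeylDifference.

(** * The leading term *)

Section ComplexIntegralValue.
Variable R : realType.
Implicit Types f g : R -> R[i].

(** Carrying integrability along with the value lets long linear combinations be integrated without
    separate side conditions. *)
Definition has_cint f (v : R[i]) := cintble f /\ cint f = v.

Lemma has_cint_cint f v : has_cint f v -> cint f = v.
Proof. by case. Qed.

Lemma eq_has_cint f g v w : f =1 g -> v = w -> has_cint f v -> has_cint g w.
Proof. by move=> /funext -> ->. Qed.

Lemma has_cintD f g v w : has_cint f v -> has_cint g w -> has_cint (fun t => f t + g t) (v + w).
Proof. by move=> [fi <-] [gi <-]; split; [exact: cintbleD|exact: cintD]. Qed.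

Lemma has_cintZ f v (c : R[i]) : has_cint f v -> has_cint (fun t => c * f t) (c * v).
Proof. by move=> [fi <-]; split; [exact: cintbleZ|exact: cintZ]. Qed.

Lemma has_cint_sum (I : Type) (s : seq I) (P : pred I) (F : I -> R -> R[i]) (v : I -> R[i]) :
  (forall i, P i -> has_cint (F i) (v i)) ->
  has_cint (fun t => \sum_(i <- s | P i) F i t) (\sum_(i <- s | P i) v i).
Proof.
move=> H; split; first by apply: cintble_sum => i /H[].
by rewrite cint_sum => [|i /H[] //]; apply: eq_bigr => i /H[].
Qed.

End ComplexIntegralValue.

Section FourierSupported.
Variables (R : realType) (p : R -> R[i]) (rho : R[i]).
Hypotheses (ip : cintble p) (p0 : forall x, ~~ (0 < x < pi) -> p x = 0).
Hypothesis I0 : 0 <= complex.Im rho.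

Lemma cintble_supported (u : R -> R[i]) (B : R) : cmeas u ->
  (forall x, 0 < x < pi -> cmod (u x) <= B) -> cintble (fun x => p x * u x).
Proof.
move=> mu_ uB; apply: (@cintble_le _ _ (fun x => B * cmod (p x))).
- by apply: cmeasM => //; exact: cintble_meas.
- move=> x; rewrite cmodM mulrC; have [/uB h|/p0 ->] := boolP (0 < x < pi).
    by rewrite ler_wpM2r ?cmod_ge0.
  by rewrite cmod0 !mulr0.
- by apply: rintbleZ; exact: rintble_cmod.
Qed.

Definition four_pos := cint (fun x => p x * ce rho (2 * x)).
Definition four_neg := cint (fun x => p x * ce rho (- (2 * x))).

Lemma has_four_pos : has_cint (fun x => p x * ce rho (2 * x)) four_pos.
Proof.
split => //; apply: (@cintble_supported _ 1).
  by apply: cmeas_ce; [exact: cmeas_cst|exact: measurable_funM].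
by move=> x /andP[x0 _]; rewrite cmod_ce_le1 // mulr_ge0 // ltW.
Qed.

Lemma has_four_neg : has_cint (fun x => p x * ce rho (- (2 * x))) four_neg.
Proof.
split => //; apply: (@cintble_supported _ (expR (complex.Im rho * (2 * pi)))).
  apply: cmeas_ce; [exact: cmeas_cst|].
  by apply: measurableT_comp => //; exact: measurable_funM.
move=> x /andP[x0 xp]; rewrite cmod_ce mulrN opprK ler_expR ler_wpM2l //.
by rewrite ler_wpM2l // ltW.
Qed.

Lemma has_four_shift (c : R) :
  has_cint (fun t => p (t - c) * ce rho (2 * t)) (ce rho (2 * c) * four_pos).
Proof.
have [h1 h2] := has_cintZ (ce rho (2 * c)) has_four_pos.
have E : (fun t => p (t - c) * ce rho (2 * t)) =
    (fun t => (fun x => ce rho (2 * c) * (p x * ce rho (2 * x))) (1 * t + - c)).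
  apply/funext => t; rewrite mul1r mulrCA -ceD; apply: (congr1 ( *%R _)).
  by congr ce; ring.
split; rewrite E; first exact: (cintble_affine (- c) (oner_neq0 R) h1).
by rewrite -h2 (cint_affine (- c) (oner_neq0 R) h1) normr1 mul1r.
Qed.

Lemma has_four_reflect (c : R) :
  has_cint (fun t => p (c - t) * ce rho (2 * t)) (ce rho (2 * c) * four_neg).
Proof.
have [h1 h2] := has_cintZ (ce rho (2 * c)) has_four_neg.
have n1 : (-1 : R) != 0 by rewrite oppr_eq0 oner_eq0.
have E : (fun t => p (c - t) * ce rho (2 * t)) =
    (fun t => (fun x => ce rho (2 * c) * (p x * ce rho (- (2 * x)))) (-1 * t + c)).
  apply/funext => t; rewrite mulN1r [- t + c]addrC mulrCA -ceD; apply: (congr1 ( *%R _)).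
  by congr ce; ring.
split; rewrite E; first exact: (cintble_affine c n1 h1).
by rewrite -h2 (cint_affine c n1 h1) normrN1 mul1r.
Qed.

End FourierSupported.

Section LeadingTerm.
Variables (R : realType) (n : nat) (P : 'I_n.+1 -> R -> R[i]) (e : 'I_n.+1).
Hypotheses (iP : forall j, cintble (P j)) (P0 : forall j x, ~~ (0 < x < pi) -> P j x = 0).
Hypothesis Pint : forall j, cint (P j) = 0.

(** With [E = ce rho (2 * pi)] and [z = ce rho (- (2 * x))], the function [star_psi] on edge [e]
    equals [(a + c * E) - E * z * (c + a * E)]. *)
Let a : R[i] := n%:R + 1.
Let c : R[i] := n%:R - 1.

(* The density whose Fourier transform is the leading term of [star_G]; the terms
   of the squares [star_psi ^+ 2] that do not depend on [x] drop out because the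
   potentials have equal means. *)
Definition star_g (t : R) : R[i] :=
  a ^+ 2 * P e (t - 0) + 2 * a * c * P e (t - pi) + c ^+ 2 * P e (t - 2 * pi)
  + c ^+ 2 * P e (2 * pi - t) + 2 * a * c * P e (3 * pi - t) + a ^+ 2 * P e (4 * pi - t)
  + \sum_(j | j != e) 4 * (P j (2 * pi - t) + P j (t - 2 * pi)).

(** This is [amp0] without its common factor [(1 - E) ^+ n.-1]. *)
Definition star_psi j (rho : R[i]) (x : R) : R[i] :=
  let E := ce rho (2 * pi) in
  if j == e then n%:R * (1 + E) * (1 - ce rho (2 * (pi - x))) + (1 - E) * (1 + ce rho (2 * (pi - x)))
  else 2 * (1 - ce rho (2 * x)).

Variable rho : R[i].
Hypothesis I0 : 0 <= complex.Im rho.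

Let E := ce rho (2 * pi).
Let U j := four_pos (P j) rho.
Let V j := four_neg (P j) rho.

Let zero_int (p : R -> R[i]) : cintble p -> cint p = 0 -> has_cint p 0.
Proof. by []. Qed.

(** Squaring [star_psi] leaves in each term a power of [E] times [exp (2 i rho x)], its inverse or
    1. A factor [E ^+ k] shifts the Fourier integral by [k * pi], an inverse exponential reflects
    it, and the terms with 1 are multiples of [cint (P j) = 0]. *)
Lemma star_leading : has_cint (fun t => star_g t * ce rho (2 * t))
  (\sum_j cint (fun t => P j t * inside (fun x => ce rho (2 * phi_arg e j x) * star_psi j rho x ^+ 2) t)).
Proof.
have ins j f t : P j t * inside f t = P j t * f t.
  by rewrite /inside; case: ifPn => // /P0 ->; rewrite !mul0r.
have cK x : ce rho (2 * x) * ce rho (- (2 * x)) = 1 by rewrite -ceD subrr ce0.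
have He : cint (fun t => P e t * inside (fun x => ce rho (2 * phi_arg e e x) * star_psi e rho x ^+ 2) t)
    = (a + c * E) ^+ 2 * U e + E ^+ 2 * (c + a * E) ^+ 2 * V e.
  have := has_cintD (has_cintZ ((a + c * E) ^+ 2) (has_four_pos (iP e) (@P0 e) I0))
    (has_cintD (has_cintZ (E ^+ 2 * (c + a * E) ^+ 2) (has_four_neg (iP e) (@P0 e) I0))
      (has_cintZ (- 2 * E * (a + c * E) * (c + a * E)) (zero_int (iP e) (Pint e)))).
  move=> /eq_has_cint H; apply: has_cint_cint; apply: H; last first.
    by rewrite mulr0 addr0.
  move=> t; rewrite ins /phi_arg /star_psi eqxx -/E.
  have -> : ce rho (2 * (pi - t)) = E * ce rho (- (2 * t)) by rewrite -ceD mulrBr.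
  have := cK t; move: (ce rho (2 * t)) (ce rho (- (2 * t))) => y z yz.
  have -> : P e t * (y * (n%:R * (1 + E) * (1 - E * z) + (1 - E) * (1 + E * z)) ^+ 2) =
    P e t * (y * (a + c * E) ^+ 2 - 2 * E * (a + c * E) * (c + a * E) * (y * z) +
      E ^+ 2 * (c + a * E) ^+ 2 * (y * z) * z) by rewrite /a /c; ring.
  by rewrite yz; ring.
have Hj j : j != e -> cint (fun t => P j t * inside (fun x => ce rho (2 * phi_arg e j x) * star_psi j rho x ^+ 2) t)
    = 4 * (E ^+ 2 * V j + E ^+ 2 * U j).
  move=> je; have := has_cintD (has_cintZ (4 * E ^+ 2) (has_four_neg (iP j) (@P0 j) I0))
    (has_cintD (has_cintZ (4 * E ^+ 2) (has_four_pos (iP j) (@P0 j) I0))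
      (has_cintZ (- 8 * E ^+ 2) (zero_int (iP j) (Pint j)))).
  move=> /eq_has_cint H; apply: has_cint_cint; apply: H; last first.
    by rewrite /U /V; ring.
  move=> t; rewrite ins /phi_arg /star_psi (negbTE je).
  have -> : ce rho (2 * (2 * pi - t)) = E ^+ 2 * ce rho (- (2 * t)).
    by rewrite expr2 -!ceD; congr ce; ring.
  have := cK t; move: (ce rho (2 * t)) (ce rho (- (2 * t))) => y z yz.
  have -> : P j t * (E ^+ 2 * z * (2 * (1 - y)) ^+ 2) =
    P j t * (4 * E ^+ 2 * (z - 2 * (y * z) + (y * z) * y)) by ring.
  by rewrite yz; ring.
have sh j d := has_four_shift (iP j) (@P0 j) I0 d.
have rf j d := has_four_reflect (iP j) (@P0 j) I0 d.
have E0 : ce rho (2 * 0) = 1 by rewrite mulr0 ce0.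
have E2 : ce rho (2 * (2 * pi)) = E ^+ 2 by rewrite expr2 -ceD; congr ce; ring.
have E3 : ce rho (2 * (3 * pi)) = E ^+ 3 by rewrite !exprS expr0 mulr1 -!ceD; congr ce; ring.
have E4 : ce rho (2 * (4 * pi)) = E ^+ 4 by rewrite !exprS expr0 mulr1 -!ceD; congr ce; ring.
have S := has_cint_sum (index_enum _) (fun j (_ : j != e) =>
  has_cintZ 4 (has_cintD (rf j (2 * pi)) (sh j (2 * pi)))).
have H := has_cintD (has_cintD (has_cintD (has_cintD (has_cintD (has_cintD
  (has_cintZ (a ^+ 2) (sh e 0)) (has_cintZ (2 * a * c) (sh e pi)))
  (has_cintZ (c ^+ 2) (sh e (2 * pi)))) (has_cintZ (c ^+ 2) (rf e (2 * pi))))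
  (has_cintZ (2 * a * c) (rf e (3 * pi)))) (has_cintZ (a ^+ 2) (rf e (4 * pi)))) S.
apply: (eq_has_cint _ _ H).
- move=> t; rewrite /star_g !mulrDl mulr_suml; congr (_ + _); first by ring.
  by apply: eq_bigr => j _; ring.
- rewrite [in RHS](bigD1 e) //= He [X in _ = _ + X](eq_bigr (fun j => 4 * (E ^+ 2 * V j + E ^+ 2 * U j))) //.
  by rewrite E0 E2 E3 E4 -/E /U /V; congr (_ + _); ring.
Qed.

End LeadingTerm.

(** * Energy estimates *)

Section SupportedReal.
Variable R : realType.
Implicit Types (f u : R -> R) (p : R -> R[i]).

(** Cauchy-Schwarz on an interval of length [pi], from the integral of the square of [f] minus its
    mean [m]. *)
Lemma sqr_rint_le f : (forall x, ~~ (0 < x < pi) -> f x = 0) ->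
  rintble f -> rintble (fun x => f x ^+ 2) ->
  rint f ^+ 2 <= pi * rint (fun x => f x ^+ 2).
Proof.
move=> f0 fi f2i; have pi0 := pi_gt0 R; pose m := rint f / pi.
have ii1 := rintble_itv (0 : R) pi.
pose k x := f x ^+ 2 + (- (2 * m)) * f x + m ^+ 2 * (if 0 < x < pi then 1 else 0).
have : 0 <= rint k.
  apply: rint_ge0 => x; rewrite /k; case: ifPn => [_|/f0 ->].
    by rewrite (_ : _ + _ = (f x - m) ^+ 2) ?sqr_ge0 //; ring.
  by rewrite expr0n /= !mulr0 !addr0.
rewrite /k !rintD ?rintZ //; [|exact: rintbleZ|apply: rintbleD; [exact: f2i|exact: rintbleZ]|exact: rintbleZ].
rewrite rint_itv subr0 (max_idPr (ltW pi0)) => H.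
have E : rint f = m * pi by rewrite /m divfK // gt_eqF.
rewrite E; rewrite E in H; move: (rint _) H => Z H.
have : 0 <= pi * (Z + - (2 * m) * (m * pi) + m ^+ 2 * pi) by rewrite mulr_ge0 // ltW.
by nra.
Qed.

Lemma rintble_supported f u : rintble f -> (forall x, ~~ (0 < x < pi) -> f x = 0) ->
  measurable_fun setT u -> (forall x, 0 < x < pi -> 0 <= u x <= 1) ->
  rintble (fun x => f x * u x).
Proof.
move=> fi f0 mu_ u01; apply: (@rintble_le _ _ (fun x => `|f x|)); last exact: integrable_norm.
  by apply: measurable_funM => //; exact: rintble_meas.
move=> x; rewrite normrM; have [/u01/andP[u0 u1]|/f0 ->] := boolP (0 < x < pi).
  by rewrite (ger0_norm u0) ler_piMr.
by rewrite normr0 mul0r.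
Qed.

End SupportedReal.

Section Energy.
Variables (R : realType) (n : nat) (b kap : R).
Hypotheses (n0 : (0 < n)%N) (b0 : 0 < b) (kap0 : 0 <= kap) (kap1 : kap < 1).
Hypothesis hE : expR (- (b * (2 * pi))) <= 4^-1 :> R.
Local Notation mu := (@lebesgue_measure R).
Local Notation fam := ('I_n.+1 -> R -> R[i]).
Implicit Types (Q : fam) (e j : 'I_n.+1) (rho : R[i]) (x t tau : R).

(** The square of [|exp (2 i rho d)|] for [Im rho = tau] and [d = phi_arg e j t], this exponential
    being the one carried by the product of the two solutions on edge [j]. *)
Definition weight e j tau t : R := expR (- (tau * (4 * phi_arg e j t))).

Definition edge_energy (P : fam) e j tau : R :=
  rint (fun t => cmod (P j t) ^+ 2 * weight e j tau t).

(** The damping moves the height of the line into the density, so that the leading term on the line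
    becomes a Fourier integral over real frequencies. *)
Definition line_g (P : fam) e tau t : R[i] := star_g P e t * ce (0 +i* tau) (2 * t).

Section Pair.
Variables (Q Q' : fam).
Hypotheses (adm : forall j, admissible b kap (Q j)) (adm' : forall j, admissible b kap (Q' j)).
Hypotheses (Q0 : forall j x, ~~ (0 < x < pi) -> Q j x = 0)
  (Q0' : forall j x, ~~ (0 < x < pi) -> Q' j x = 0).

Let P j x := Q j x - Q' j x.
Hypothesis Pint : forall j, cint (P j) = 0.

Let iP j : cintble (P j). Proof. exact: (cintble_diff adm adm'). Qed.
Let iP2 j : rintble (fun t => cmod (P j t) ^+ 2). Proof. exact: (rintble_diff adm adm'). Qed.
Let P0 j x : ~~ (0 < x < pi) -> P j x = 0.
Proof. by move=> x0; rewrite /P Q0 // Q0' // subrr. Qed.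

Let measurable_expw (c : R) e j : measurable_fun setT (fun t => expR (- (c * phi_arg e j t))).
Proof.
apply: (measurableT_comp (@measurable_expR R)); apply: measurableT_comp => //.
by apply: measurable_funM => //; exact: measurable_phi_arg.
Qed.

Let expw01 (c : R) e j t : 0 <= c -> 0 < t < pi -> 0 <= expR (- (c * phi_arg e j t)) <= 1.
Proof.
move=> c0 /andP[t0 tp]; rewrite expR_ge0 -expR0 ler_expR oppr_le0 mulr_ge0 //.
by apply: phi_arg_ge0; rewrite !ltW.
Qed.

Lemma rintble_energy e j tau : 0 <= tau -> rintble (fun t => cmod (P j t) ^+ 2 * weight e j tau t).
Proof.
move=> t0; have E t : weight e j tau t = expR (- (tau * 4 * phi_arg e j t)) by rewrite /weight mulrA.
under eq_fun do rewrite E.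
apply: rintble_supported => //.
- by move=> x x0; rewrite P0 // cmod0 expr0n.
- by move=> x; apply: expw01; rewrite mulr_ge0.
Qed.

Lemma cmod_psi e j rho x : 0 <= complex.Im rho -> 0 <= x <= pi ->
  cmod (star_psi e j rho x) <= 4 * (n%:R + 1).
Proof.
move=> I0 /andP[x0 xp]; rewrite /star_psi.
have ce1 y : 0 <= y -> cmod (ce rho (2 * y)) <= 1.
  by move=> y0; rewrite cmod_ce_le1 // mulr_ge0.
have b1 y : 0 <= y -> cmod (1 - ce rho (2 * y)) <= 2.
  by move=> /ce1 h; apply: (le_trans (ler_cmodB _ _)); rewrite cmod1; lra.
have b2 y : 0 <= y -> cmod (1 + ce rho (2 * y)) <= 2.
  by move=> /ce1 h; apply: (le_trans (ler_cmodD _ _)); rewrite cmod1; lra.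
have pi0 := pi_ge0 R; have px : 0 <= pi - x by rewrite subr_ge0.
have N0 : 0 <= n%:R :> R by rewrite ler0n.
case: ifP => _; last first.
  by rewrite cmodM cmod2; have := b1 _ x0; move: (cmod _) => y; nra.
apply: (le_trans (ler_cmodD _ _)); rewrite !cmodM cmod_nat.
apply: (@le_trans _ _ (n%:R * 2 * 2 + 2 * 2)); last by lra.
by apply: lerD; apply: ler_pM; rewrite ?mulr_ge0 ?cmod_ge0 ?b1 ?b2 // ler_wpM2l // b2.
Qed.

Let cmeas_psi e j rho : cmeas (star_psi e j rho).
Proof.
have m1 : cmeas (fun x : R => ce rho (2 * (pi - x))).
  apply: cmeas_ce; [exact: cmeas_cst|apply: measurable_funM => //; exact: measurable_funB].
have m2 : cmeas (fun x : R => ce rho (2 * x)).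
  by apply: cmeas_ce; [exact: cmeas_cst|exact: measurable_funM].
rewrite /star_psi; case: (j == e).
  apply: cmeasD; apply: cmeasM; try exact: cmeas_cst.
    by apply: cmeasB => //; exact: cmeas_cst.
  by apply: cmeasD => //; exact: cmeas_cst.
by apply: cmeasM; [exact: cmeas_cst|apply: cmeasB => //; exact: cmeas_cst].
Qed.

Let cintble_inside j (F : R -> R[i]) (B : R) : cmeas (inside F) ->
  (forall x, 0 <= x <= pi -> cmod (F x) <= B) -> cintble (fun t => P j t * inside F t).
Proof.
move=> mF FB; apply: (cintble_supported (iP j) (@P0 j) (B := B)) => // x x0.
by rewrite /inside x0 FB //; case/andP: x0 => ? ?; rewrite !ltW.
Qed.

Let cmeas_inside (F : R -> R[i]) : cmeas F -> cmeas (inside F).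
Proof.
move=> mF; apply: (@cmeas_if _ _ _ (fun x : R => 0 < x < pi) F (fun=> 0)) => //.
  by apply: measurable_and; exact: measurable_fun_ltr.
Qed.

Let lead e j rho x := ce rho (2 * phi_arg e j x) * star_psi e j rho x ^+ 2.

(** The amplitudes are replaced by their leading parts pointwise, without touching the exponentials:
    the error thus keeps the damping of the main term, which is indispensable for absorbing it
    later. *)
Lemma star_G_error (C : R) e rho : b <= complex.Im rho ->
  (forall j Q1 x, (forall j, admissible b kap (Q1 j)) -> 0 <= x <= pi ->
    [/\ cmod (phi_amp kap Q1 e j rho x) <= C, cmod (amp0 e j rho x) <= C &
      cmod (phi_amp kap Q1 e j rho x - amp0 e j rho x) <= C / cmod rho]) ->
  cmod (star_G kap Q Q' e rho - ((1 - ce rho (2 * pi)) ^+ n.-1) ^+ 2 *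
     \sum_j cint (fun t => P j t * inside (lead e j rho) t)) <=
  2 * C ^+ 2 / cmod rho *
    \sum_j rint (fun t => cmod (P j t) * expR (- (complex.Im rho * 2 * phi_arg e j t))).
Proof.
move=> br HC; have I0 : 0 <= complex.Im rho by exact: le_trans (ltW b0) br.
have C0 : 0 <= C.
  have x0 (x : R) : 0 <= x -> ((0 : R) <= 0) && (0 <= x) by move=> ->; rewrite lexx.
  have [h _ _] := HC e Q 0 adm (x0 _ (pi_ge0 R)).
  exact: le_trans (cmod_ge0 _) h.
set Z := (1 - ce rho (2 * pi)) ^+ n.-1.
have ml j : cmeas (lead e j rho).
  apply: cmeasM; last exact: cmeasX.
  by apply: cmeas_ce; [exact: cmeas_cst|apply: measurable_funM => //; exact: measurable_phi_arg].
have mphi Q1 j : (forall j, admissible b kap (Q1 j)) -> cmeas (phi kap Q1 e j rho).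
  by move=> a0; exact: (line_meas_fixed (line_meas_phi b0 kap0 kap1 e a0 j br)).
have ce1 j x : 0 <= x <= pi -> cmod (ce rho (2 * phi_arg e j x)) <= 1.
  by move=> x0; rewrite cmod_ce_le1 // mulr_ge0 // phi_arg_ge0.
have il j : cintble (fun t => P j t * inside (lead e j rho) t).
  apply: (@cintble_inside _ _ ((4 * (n%:R + 1)) ^+ 2)); first exact: cmeas_inside.
  move=> x x0; rewrite cmodM cmodX -[leRHS]mul1r ler_pM ?exprn_ge0 ?cmod_ge0 ?ce1 //.
  by rewrite lerXn2r ?nnegrE ?cmod_ge0 ?cmod_psi // mulr_ge0 // addr_ge0.
have [B B0 HB] := phi_bounded n0 b0 kap0 kap1 e adm adm'.
have ig j : cintble (fun t => P j t * inside (fun x => phi kap Q e j rho x * phi kap Q' e j rho x) t).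
  apply: (@cintble_inside _ _ B); last by move=> x x0; exact: HB.
  by apply: cmeas_inside; apply: cmeasM; exact: mphi.
rewrite /star_G mulr_sumr -sumrB mulr_sumr.
apply: (le_trans (ler_cmod_sum _ _ _)); apply: ler_sum => j _.
have iZ := cintbleZ (Z ^+ 2) (il j).
rewrite -cintZ // -(cintB (ig j) iZ).
have iw : rintble (fun t => cmod (P j t) * expR (- (complex.Im rho * 2 * phi_arg e j t))).
  apply: rintble_supported.
  - exact: rintble_cmod.
  - by move=> x /P0 ->; rewrite cmod0.
  - exact: measurable_expw.
  - by move=> x; apply: expw01; rewrite mulr_ge0.
rewrite -rintZ //; apply: ler_cmod_cint; [|exact: rintbleZ|].
  exact: (cintbleB (ig j) iZ).
move=> t; rewrite /inside; case: ifPn => [t0|/P0 Pt]; last first.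
  by rewrite -/(P j t) Pt !mulr0 subrr cmod0 mul0r mulr0.
have tc : 0 <= t <= pi by case/andP: t0 => ? ?; rewrite !ltW.
(* Both terms carry the same exponential, which factors out and leaves a difference of products of
   amplitudes. *)
have -> : (Q j t - Q' j t) * (phi kap Q e j rho t * phi kap Q' e j rho t) -
    Z ^+ 2 * (P j t * lead e j rho t) =
    P j t * (ce rho (2 * phi_arg e j t) *
      (phi_amp kap Q e j rho t * phi_amp kap Q' e j rho t - amp0 e j rho t * amp0 e j rho t)).
  rewrite /phi /lead /amp0 -/(star_psi e j rho t) -/Z.
  have -> : ce rho (2 * phi_arg e j t) = ce rho (phi_arg e j t) * ce rho (phi_arg e j t).
    by rewrite -ceD; congr ce; ring.
  by rewrite /P; ring.
have [h1 h2 h3] := HC j Q t adm tc; have [h1' h2' h3'] := HC j Q' t adm' tc.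
have d : cmod (phi_amp kap Q e j rho t * phi_amp kap Q' e j rho t - amp0 e j rho t * amp0 e j rho t)
    <= 2 * C ^+ 2 / cmod rho.
  rewrite (_ : _ - _ = (phi_amp kap Q e j rho t - amp0 e j rho t) * phi_amp kap Q' e j rho t +
    amp0 e j rho t * (phi_amp kap Q' e j rho t - amp0 e j rho t)); last by ring.
  apply: (le_trans (ler_cmodD _ _)).
  apply: (@le_trans _ _ (C / cmod rho * C + C * (C / cmod rho))).
    by apply: lerD; rewrite cmodM; apply: ler_pM; rewrite ?cmod_ge0.
  by rewrite le_eqVlt; apply/orP; left; apply/eqP; ring.
rewrite cmodM [leRHS]mulrCA ler_wpM2l ?cmod_ge0 //.
rewrite cmodM cmod_ce mulrA mulrC ler_wpM2r ?expR_ge0 //.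
Qed.

(** As the Poisson kernel has mass 1, the integral of [1 / |rho|^2] over the line is [pi / tau].
    This is the source of the gain at large heights. *)
Lemma rhoV_poisson (s tau : R) : 0 < tau ->
  (cmod (s +i* tau) ^+ 2)^-1 = pi / tau * poisson tau s.
Proof.
move=> t0; have p0 : pi != 0 :> R by rewrite gt_eqF // pi_gt0.
rewrite cmod_sqr /= poisson.unlock [s ^+ 2 + _]addrC.
have : tau ^+ 2 + s ^+ 2 != 0 by rewrite gt_eqF // ltr_pwDl ?sqr_ge0 // exprn_gt0.
have : tau != 0 by rewrite gt_eqF.
by move: (tau ^+ 2 + s ^+ 2) pi p0 => u p p0 tn un; field; rewrite p0 tn un.
Qed.

Let measurable_star_G e tau : b <= tau ->
  measurable_fun setT (fun s : R => cmod (star_G kap Q Q' e (s +i* tau)) ^+ 2).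
Proof.
(* Admissibility relative to [b] implies admissibility relative to [tau], so the line at height
   [tau] can itself serve as base line. *)
move=> bt; have adt Q1 : (forall j, admissible b kap (Q1 j)) -> forall j, admissible tau kap (Q1 j).
  by move=> a1 j; have [h1 h2 h3] := a1 j; split => //; apply: (le_trans h3); rewrite ler_wpM2l.
have t0 := lt_le_trans b0 bt.
have [[m _] _] := poisson_algebra_star_G n0 t0 kap0 kap1 e (adt _ adm) (adt _ adm') 0 ltr01.
by apply: measurable_funX; exact: measurable_cmod.
Qed.

Lemma ce_vertical (s tau t : R) :
  ce (s +i* tau) (2 * t) = ce (0 +i* tau) (2 * t) * cis (2 * s * t).
Proof.
rewrite ce.unlock /= mul0r cis0 mulr1; apply: (congr1 ( *%R _)).
by congr cis; ring.
Qed.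

Let gsupport e t : ~~ (0 <= t <= 4 * pi) -> star_g P e t = 0.
Proof.
move=> tn; have pi0 := pi_gt0 R.
have Z j x : x <= 0 \/ pi <= x -> P j x = 0.
  by move=> h; apply: P0; apply/negP => /andP[? ?]; case: h; lra.
have {}tn : t < 0 \/ 4 * pi < t.
  by move: tn; rewrite negb_and -!ltNge => /orP[]; [left|right].
have [] : (t - 2 * pi <= 0 \/ pi <= t - 2 * pi) /\ (2 * pi - t <= 0 \/ pi <= 2 * pi - t).
  by case: tn => ?; split; ((left; lra) || (right; lra)).
move=> z1 z2; rewrite /star_g big1 => [|j _]; last by rewrite !Z // addr0 mulr0.
by rewrite !Z ?mulr0 ?addr0 //; case: tn => ?; ((left; lra) || (right; lra)).
Qed.

(** The main term is [star_G] minus the error, divided by the square of [Z = (1 - E) ^+ n.-1]; as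
    [|1 - E| >= 3/4], this division costs at most [(4 / 3) ^+ (4 * n.-1)] in the squared modulus.
    Plancherel then passes to the density. *)
Lemma line_g_energy (C : R) e tau (m : R) : b <= tau ->
  (forall j Q1 rho x, (forall j, admissible b kap (Q1 j)) -> b <= complex.Im rho -> 0 <= x <= pi ->
    [/\ cmod (phi_amp kap Q1 e j rho x) <= C, cmod (amp0 e j rho x) <= C &
      cmod (phi_amp kap Q1 e j rho x - amp0 e j rho x) <= C / cmod rho]) ->
  (\int[mu]_s (cmod (star_G kap Q Q' e (s +i* tau)) ^+ 2)%:E <= m%:E)%E ->
  rintble (fun t => cmod (line_g P e tau t) ^+ 2) /\
  pi * rint (fun t => cmod (line_g P e tau t) ^+ 2) <=
    2 * (4 / 3) ^+ (4 * n.-1) *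
      (m + 4 * C ^+ 4 * n.+1%:R * pi ^+ 2 / tau * \sum_j edge_energy P e j tau).
Proof.
move=> bt HC Gm; have t0 := lt_le_trans b0 bt.
set W := \sum_j _; set kk := (4 / 3) ^+ _.
pose F (s : R) := cint (fun t => line_g P e tau t * cis (2 * s * t)).
pose K := 4 * C ^+ 4 * n.+1%:R * pi * W.
have V0 j : 0 <= edge_energy P e j tau.
  by apply: rint_ge0 => t; rewrite mulr_ge0 ?sqr_ge0 // expR_ge0.
have C40 : 0 <= C ^+ 4 by rewrite (_ : C ^+ 4 = (C ^+ 2) ^+ 2) ?sqr_ge0 // -exprM.
have W0 : 0 <= W by apply: sumr_ge0.
have K0 : 0 <= K by rewrite /K; do !apply: mulr_ge0 => //; exact: pi_ge0.
have kk0 : 0 <= kk by rewrite exprn_ge0 // divr_ge0.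
have FE s : F s = \sum_j cint (fun t => P j t * inside (lead e j (s +i* tau)) t).
  have I0 : 0 <= complex.Im (s +i* tau) by rewrite /= ltW.
  rewrite -(has_cint_cint (star_leading e iP P0 Pint I0)); apply: eq_cint => t.
  by rewrite /line_g ce_vertical mulrA.
have Fb s : cmod (F s) ^+ 2 <= 2 * kk * cmod (star_G kap Q Q' e (s +i* tau)) ^+ 2 +
    2 * kk * K * (cmod (s +i* tau) ^+ 2)^-1.
  have br : b <= complex.Im (s +i* tau) by [].
  have := star_G_error br (fun j Q1 x aQ => HC j Q1 _ x aQ br).
  rewrite -FE; set G := star_G _ _ _ _ _; set Z := _ ^+ n.-1; set X := \sum_j _ => err.
  (* Cauchy-Schwarz twice: over the edges, with the factor [n.+1], and over the interval, with the
     factor [pi]. Squaring the exponentials produces exactly [weight]. *)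
  have X2 : X ^+ 2 <= n.+1%:R * (pi * W).
    apply: (le_trans (sqr_sum_le _ _)); rewrite card_ord ler_wpM2l // mulr_sumr.
    apply: ler_sum => j _; apply: (le_trans (sqr_rint_le _ _ _)).
    - by move=> x /P0 ->; rewrite cmod0 mul0r.
    - apply: rintble_supported; [exact: rintble_cmod|by move=> x /P0 ->; rewrite cmod0|
        exact: measurable_expw|].
      by move=> x; apply: expw01; rewrite mulr_ge0 //= ltW.
    - have := rintble_energy e j (ltW t0); congr (rintble _); apply/funext => x.
      by rewrite exprMn /weight -expRM_natl; congr (_ * expR _); rewrite /=; ring.
    - rewrite le_eqVlt; apply/orP; left; apply/eqP; congr (_ * _); apply: eq_rint => x.
      by rewrite exprMn /weight -expRM_natl; congr (_ * expR _); rewrite /=; ring.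
  have Z2 : 1 <= kk * cmod (Z ^+ 2) ^+ 2.
    have l2 : 3 / 4 <= cmod (1 - ce (s +i* tau) (2 * pi)).
      have := ler_cmodD (1 - ce (s +i* tau) (2 * pi)) (ce (s +i* tau) (2 * pi)).
      by rewrite subrK cmod1; have := cmod_E hE br; lra.
    have pw (y : R) : ((y ^+ n.-1) ^+ 2) ^+ 2 = (y ^+ 4) ^+ n.-1.
      by rewrite -[LHS]exprM exprAC.
    rewrite /kk /Z !cmodX pw exprM -exprMn exprn_ege1 // -exprMn exprn_ege1 //.
    by move: l2; lra.
  have err2 : cmod (G - Z ^+ 2 * F s) ^+ 2 <= K * (cmod (s +i* tau) ^+ 2)^-1.
    apply: (@le_trans _ _ ((2 * C ^+ 2 / cmod (s +i* tau) * X) ^+ 2)).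
      rewrite lerXn2r ?nnegrE ?cmod_ge0 //; exact: le_trans (cmod_ge0 _) err.
    rewrite (_ : _ ^+ 2 = 4 * C ^+ 4 * X ^+ 2 * (cmod (s +i* tau) ^+ 2)^-1); last first.
      by rewrite !exprMn exprVn; ring.
    rewrite (_ : K = 4 * C ^+ 4 * (n.+1%:R * (pi * W))); last by rewrite /K; ring.
    by rewrite ler_wpM2r ?invr_ge0 ?sqr_ge0 // ler_wpM2l // mulr_ge0.
  have tri := sqr_cmodB G (G - Z ^+ 2 * F s); rewrite subKr cmodM exprMn in tri.
  apply: (@le_trans _ _ (kk * (cmod (Z ^+ 2) ^+ 2 * cmod (F s) ^+ 2))).
    by rewrite mulrA ler_peMl ?sqr_ge0.
  apply: (le_trans (ler_wpM2l kk0 tri)).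
  rewrite (_ : _ + _ = kk * (2 * cmod G ^+ 2 + 2 * (K * (cmod (s +i* tau) ^+ 2)^-1))); last by ring.
  by rewrite ler_wpM2l // lerD2l ler_wpM2l.
have ig : cintble (line_g P e tau).
  have I0 : 0 <= complex.Im (0 +i* tau) by rewrite /= ltW.
  by case: (star_leading e iP P0 Pint I0).
have gsup x : ~~ (0 <= x <= 4 * pi) -> line_g P e tau x = 0.
  by move=> /gsupport h; rewrite /line_g h mul0r.
have mF : cmeas F.
  apply: (@cmeas_cint _ _ _ (fun z : R * R => line_g P e tau z.2 * cis (2 * z.1 * z.2))).
  apply: cmeasM; first exact: (cmeas_comp (cintble_meas ig) measurable_snd).
  by apply: cmeas_cis; apply: measurable_funM => //; exact: measurable_funM.
have pl := plancherel_lower ig gsup.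
have Fm : (\int[mu]_s (cmod (F s) ^+ 2)%:E <= (2 * kk * (m + K * (pi / tau)))%:E)%E.
  have mG := measurable_star_G e bt.
  have ir : rintble (fun s => 2 * kk * K * (cmod (s +i* tau) ^+ 2)^-1).
    apply: rintbleZ; under eq_fun do rewrite (rhoV_poisson _ t0).
    by apply: rintbleZ; exact: rintble_poisson.
  apply: (@le_trans _ _ (\int[mu]_s ((2 * kk)%:E * (cmod (star_G kap Q Q' e (s +i* tau)) ^+ 2)%:E +
      (2 * kk * K * (cmod (s +i* tau) ^+ 2)^-1)%:E))%E).
    apply: ge0_le_integral => //.
    - by move=> s _; rewrite lee_fin sqr_ge0.
    - by apply/measurable_EFinP; apply: measurable_funX; exact: measurable_cmod.
    - apply: emeasurable_funD; last by apply/measurable_EFinP; exact: rintble_meas.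
      by apply: emeasurable_funM => //; apply/measurable_EFinP.
    - by move=> s _; rewrite -EFinM -EFinD lee_fin Fb.
  rewrite ge0_integralD //; last first.
  - by apply/measurable_EFinP; exact: rintble_meas.
  - move=> s _; rewrite lee_fin; apply: mulr_ge0; last by rewrite invr_ge0 sqr_ge0.
    by apply: mulr_ge0 => //; exact: mulr_ge0.
  - by apply: emeasurable_funM => //; apply/measurable_EFinP.
  - by move=> s _; rewrite mule_ge0 // lee_fin ?sqr_ge0 ?mulr_ge0.
  rewrite ge0_integralZl //; last first.
  - by rewrite lee_fin mulr_ge0.
  - by move=> s _; rewrite lee_fin sqr_ge0.
  - exact/measurable_EFinP.
  rewrite (rintE ir) mulrDr EFinD; apply: leeD.
    rewrite [leRHS]EFinM; apply: lee_wpmul2l => //.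
    by rewrite lee_fin mulr_ge0.
  rewrite lee_fin rintZ; last first.
    under eq_fun do rewrite (rhoV_poisson _ t0).
    by apply: rintbleZ; exact: rintble_poisson.
  under eq_rint => s do rewrite (rhoV_poisson _ t0).
  by rewrite rintZ ?rint_poisson ?mulr1 ?mulrA //; exact: rintble_poisson.
have {}pl := le_trans pl Fm.
have mg : measurable_fun setT (fun t => cmod (line_g P e tau t) ^+ 2).
  by apply: measurable_funX; apply: measurable_cmod; exact: cintble_meas.
(* The Plancherel bound lives in the extended reals, so its finite right side also proves square
   integrability. *)
have rg : rintble (fun t => cmod (line_g P e tau t) ^+ 2).
  apply/integrableP; split; first exact/measurable_EFinP.
  under eq_integral do rewrite /= ger0_norm ?sqr_ge0 //.
  rewrite ltey; apply/eqP => E; move: pl; rewrite E gt0_muley ?lte_fin ?pi_gt0 //.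
split => //; move: pl; rewrite rintE // -EFinM lee_fin => /le_trans; apply.
by rewrite le_eqVlt; apply/orP; left; apply/eqP; rewrite /K; ring.
Qed.

End Pair.
End Energy.

(** * Separating the edges by windows of the density *)

Section Windows.
Variables (R : realType) (n : nat) (P : 'I_n.+1 -> R -> R[i]) (tau : R).
Hypothesis iP2 : forall j, rintble (fun t => cmod (P j t) ^+ 2).
Hypotheses (P0 : forall j x, ~~ (0 < x < pi) -> P j x = 0) (tau0 : 0 <= tau).
Implicit Types (e j : 'I_n.+1) (x t : R).

Local Notation N := (n.+1%:R : R).
Let w4 t : R := expR (- (tau * (4 * t))).

Let PZ j x : x <= 0 \/ pi <= x -> P j x = 0.
Proof. by move=> h; apply: P0; apply/negP => /andP[? ?]; case: h; lra. Qed.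

Let w4_ge0 t : 0 <= w4 t. Proof. exact: expR_ge0. Qed.

Let w4_le t t' : t' <= t -> w4 t <= w4 t'.
Proof. by move=> tt; rewrite ler_expR lerN2 ler_wpM2l // ler_wpM2l. Qed.

Let rintble_w4 j (k : R -> R) : measurable_fun setT k -> (forall x, 0 < x < pi -> 0 <= k x) ->
  rintble (fun x => cmod (P j x) ^+ 2 * w4 (k x)).
Proof.
move=> mk k0; apply: rintble_supported => //.
- by move=> x /P0 ->; rewrite cmod0 expr0n.
- apply: (measurableT_comp (@measurable_expR R)); apply: measurableT_comp => //.
  by apply: measurable_funM => //; exact: measurable_funM.
- by move=> x /k0 h; rewrite w4_ge0 -[leRHS]expR0 ler_expR oppr_le0 !mulr_ge0.
Qed.

Lemma rintble_edge_energy e j : rintble (fun t => cmod (P j t) ^+ 2 * weight e j tau t).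
Proof.
apply: rintble_w4; first exact: measurable_phi_arg.
by move=> x /andP[? ?]; apply: phi_arg_ge0; rewrite !ltW.
Qed.

Lemma edge_energy_ge0 e j : 0 <= edge_energy P e j tau.
Proof. by apply: rint_ge0 => t; rewrite mulr_ge0 ?sqr_ge0 // w4_ge0. Qed.

Lemma edge_energy_le e j : edge_energy P e j tau <= edge_energy P j j tau.
Proof.
apply: ler_rint; [exact: rintble_edge_energy..|move=> x].
have [/andP[x0 xp]|/P0 ->] := boolP (0 < x < pi); last by rewrite cmod0 expr0n !mul0r.
rewrite ler_wpM2l ?sqr_ge0 //; apply: w4_le; rewrite /phi_arg eqxx; case: ifP => _ //.
by lra.
Qed.

(** Every point is at distance at most [2 * pi] from the boundary vertex of [e], so the weight is at
    least [exp (- 8 pi tau)]. *)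
Lemma energy_lower e j : rint (fun t => cmod (P j t) ^+ 2) <= expR (tau * (8 * pi)) * edge_energy P e j tau.
Proof.
rewrite -rintZ; last exact: rintble_edge_energy.
apply: ler_rint => //; first by apply: rintbleZ; exact: rintble_edge_energy.
move=> x; have [/andP[x0 xp]|/P0 ->] := boolP (0 < x < pi); last by rewrite cmod0 expr0n mul0r mulr0.
rewrite mulrCA ler_peMr ?sqr_ge0 // -expRD -[leLHS]expR0 ler_expR.
rewrite -mulrBr mulr_ge0 //; have := pi_ge0 R; rewrite /phi_arg; case: ifP => _; lra.
Qed.

Let ce_w4 t : cmod (ce (0 +i* tau) (2 * t)) ^+ 2 = w4 t.
Proof. by rewrite cmod_ce -expRM_natl /w4 /=; congr expR; ring. Qed.

(** On [(0, pi)] every term of [star_g] vanishes except that of [P e] itself, whose coefficient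
    [(n + 1) ^+ 2] has modulus at least 1. *)
Lemma first_window e : rintble (fun t => cmod (line_g P e tau t) ^+ 2) ->
  edge_energy P e e tau <= rint (fun t => cmod (line_g P e tau t) ^+ 2).
Proof.
move=> ig; apply: ler_rint => //; first exact: rintble_edge_energy.
move=> t; have [/andP[t0 tp]|/P0 ->] := boolP (0 < t < pi); last first.
  by rewrite cmod0 expr0n mul0r sqr_ge0.
rewrite /line_g cmodM exprMn ce_w4 /weight /phi_arg eqxx ler_wpM2r ?w4_ge0 //.
have pi0 := pi_gt0 R.
rewrite /star_g big1 => [|j _]; last first.
  rewrite (@PZ _ (2 * pi - t)); last by right; lra.
  rewrite (@PZ _ (t - 2 * pi)); last by left; lra.
  by rewrite addr0 mulr0.
rewrite (@PZ _ (t - pi)); last by left; lra.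
rewrite (@PZ _ (t - 2 * pi)); last by left; lra.
rewrite (@PZ _ (2 * pi - t)); last by right; lra.
rewrite (@PZ _ (3 * pi - t)); last by right; lra.
rewrite (@PZ _ (4 * pi - t)); last by right; lra.
rewrite !mulr0 !addr0 subr0 cmodM exprMn ler_peMl ?sqr_ge0 //.
rewrite exprn_ege1 // cmodX exprn_ege1 // natr1 cmod_nat ler1n //.
Qed.

Let n1 : (-1 : R) != 0. Proof. by rewrite oppr_eq0 oner_eq0. Qed.

Let refl_energy j : rintble (fun t => cmod (P j (2 * pi - t)) ^+ 2 * w4 t) /\
  rint (fun t => cmod (P j (2 * pi - t)) ^+ 2 * w4 t) =
  rint (fun x => cmod (P j x) ^+ 2 * w4 (2 * pi - x)).
Proof.
have ir : rintble (fun x => cmod (P j x) ^+ 2 * w4 (2 * pi - x)).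
  by apply: rintble_w4 => [|x /andP[? ?]]; [exact: measurable_funB|lra].
have E : (fun t => cmod (P j (2 * pi - t)) ^+ 2 * w4 t) =
    (fun t => (fun x => cmod (P j x) ^+ 2 * w4 (2 * pi - x)) (-1 * t + 2 * pi)).
  by apply/funext => t; rewrite mulN1r [- t + _]addrC subKr.
split; first by rewrite E; exact: (rintble_affine (2 * pi) n1 ir).
by rewrite E [RHS](rint_affine (2 * pi) n1 ir) normrN1 mul1r.
Qed.

Let shift_energy j : rintble (fun t => cmod (P j (t - pi)) ^+ 2 * w4 t) /\
  rint (fun t => cmod (P j (t - pi)) ^+ 2 * w4 t) =
  rint (fun x => cmod (P j x) ^+ 2 * w4 (x + pi)).
Proof.
have pi0 := pi_ge0 R.
have ir : rintble (fun x => cmod (P j x) ^+ 2 * w4 (x + pi)).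
  by apply: rintble_w4 => [|x /andP[? ?]]; [exact: measurable_funD|lra].
have E : (fun t => cmod (P j (t - pi)) ^+ 2 * w4 t) =
    (fun t => (fun x => cmod (P j x) ^+ 2 * w4 (x + pi)) (1 * t + - pi)).
  by apply/funext => t; rewrite mul1r subrK.
split; first by rewrite E; exact: (rintble_affine (- pi) (oner_neq0 R) ir).
by rewrite E [RHS](rint_affine (- pi) (oner_neq0 R) ir) normr1 mul1r.
Qed.

(* On (pi, 2pi) the edges other than [e] enter [star_g] with the same sign, so
   that the edge without Weyl function can be isolated. *)
Lemma second_window_pointwise e i t : i != e -> pi < t < 2 * pi ->
  cmod (P i (2 * pi - t)) ^+ 2 <= cmod (star_g P e t) ^+ 2 +
    4 * N ^+ 4 * (cmod (P e (t - pi)) ^+ 2 + N * \sum_(j | j != i) cmod (P j (2 * pi - t)) ^+ 2).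
Proof.
move=> ie /andP[pt t2]; pose a : R[i] := n%:R + 1; pose c : R[i] := n%:R - 1.
set x := cmod (P e (t - pi)); pose Y := \sum_(j | j != i) cmod (P j (2 * pi - t)).
pose rest := 2 * a * c * P e (t - pi) + (c ^+ 2 * P e (2 * pi - t) +
  \sum_(j | (j != e) && (j != i)) 4 * P j (2 * pi - t)).
have gE : star_g P e t = 4 * P i (2 * pi - t) + rest.
  rewrite /star_g (@PZ _ (t - 0)); last by right; lra.
  rewrite (@PZ _ (t - 2 * pi)); last by left; lra.
  rewrite (@PZ _ (3 * pi - t)); last by right; lra.
  rewrite (@PZ _ (4 * pi - t)); last by right; lra.
  rewrite (eq_bigr (fun j => 4 * P j (2 * pi - t))); last first.
    by move=> j _; rewrite (@PZ _ (t - 2 * pi)) ?addr0 //; left; lra.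
  by rewrite (bigD1 i) //= /rest -/a -/c; ring.
have N1 : 1 <= N by rewrite ler1n.
have Nn : N = n%:R + 1 by rewrite natr1.
have n00 : 0 <= n%:R :> R by rewrite ler0n.
have ca : cmod a <= N by rewrite /a natr1 cmod_nat.
have cc : cmod c <= N by apply: (le_trans (ler_cmodB _ _)); rewrite cmod_nat cmod1 Nn.
have ca0 := cmod_ge0 a; have cc0 := cmod_ge0 c.
have Ye : cmod (P e (2 * pi - t)) + \sum_(j | (j != e) && (j != i)) cmod (P j (2 * pi - t)) = Y.
  rewrite /Y [RHS](bigD1 e) /=; last by rewrite eq_sym.
  by congr (_ + _); apply: eq_bigl => j; rewrite andbC.
have rb : cmod rest <= 4 * N ^+ 2 * (x + Y).
  rewrite mulrDr; apply: (le_trans (ler_cmodD _ _)); apply: lerD.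
    rewrite cmodM ler_wpM2r ?cmod_ge0 // !cmodM cmod2; nra.
  rewrite -Ye [leRHS]mulrDr; apply: (le_trans (ler_cmodD _ _)); apply: lerD.
    by rewrite cmodM ler_wpM2r ?cmod_ge0 // cmodX; nra.
  apply: (le_trans (ler_cmod_sum _ _ _)); rewrite mulr_sumr; apply: ler_sum => j _.
  by rewrite cmodM cmod_nat ler_wpM2r ?cmod_ge0 //; nra.
have Y2 : Y ^+ 2 <= N * \sum_(j | j != i) cmod (P j (2 * pi - t)) ^+ 2.
  by apply: (le_trans (sqr_sum_le _ _)); rewrite card_ord.
have x0 : 0 <= x by exact: cmod_ge0.
have Y0 : 0 <= Y by apply: sumr_ge0 => j _; exact: cmod_ge0.
(* This gives [16 |P i|^2 <= 2 |star_g|^2 + 2 |rest|^2]. With [|rest|^2] at most [32 N^4] times the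
   sum of the two squares, division by 16 leaves the constant [4 N^4]. *)
have tri := sqr_cmodB (star_g P e t) rest.
rewrite {1}gE addrK cmodM cmod_nat exprMn in tri.
have r2 : cmod rest ^+ 2 <= 16 * N ^+ 4 * (2 * x ^+ 2 + 2 * Y ^+ 2).
  apply: (@le_trans _ _ ((4 * N ^+ 2 * (x + Y)) ^+ 2)).
    by rewrite lerXn2r ?nnegrE ?cmod_ge0 // !mulr_ge0 ?exprn_ge0 ?addr_ge0.
  rewrite (_ : _ ^+ 2 = 16 * N ^+ 4 * (x + Y) ^+ 2); last by rewrite !exprMn; ring.
  rewrite ler_wpM2l ?mulr_ge0 ?exprn_ge0 //.
  by have := sqr_ge0 (x - Y); nra.
have N40 : 0 <= N ^+ 4 by rewrite exprn_ge0.
move: (N ^+ 4) (\sum_(j | j != i) _) N40 Y2 r2 tri => M Z M0 Y2 r2 tri.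
have : M * Y ^+ 2 <= M * (N * Z) by rewrite ler_wpM2l.
have := sqr_ge0 (cmod (star_g P e t)).
by move: tri r2; rewrite (_ : 4 ^+ 2 = 16); [lra|rewrite -natrX].
Qed.

(** All terms of the window other than that of edge [i] belong to edges different from [i]. Their
    weights in this window are at most those seen from their own boundary vertices, so the energies
    [edge_energy P j j] suffice. *)
Lemma second_window e i : i != e -> rintble (fun t => cmod (line_g P e tau t) ^+ 2) ->
  edge_energy P e i tau <= rint (fun t => cmod (line_g P e tau t) ^+ 2) +
    8 * N ^+ 5 * \sum_(j | j != i) edge_energy P j j tau.
Proof.
move=> ie ig; have [ri re] := refl_energy i; have [si se] := shift_energy e.
have -> : edge_energy P e i tau = rint (fun t => cmod (P i (2 * pi - t)) ^+ 2 * w4 t).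
  by rewrite re; apply: eq_rint => x; rewrite /weight /phi_arg (negbTE ie).
pose S := \sum_(j | j != i) edge_energy P j j tau.
have iS : rintble (fun t => \sum_(j | j != i) cmod (P j (2 * pi - t)) ^+ 2 * w4 t).
  by apply: rintble_sum => j _; case: (refl_energy j).
have N1 : 1 <= N by rewrite ler1n.
apply: (@le_trans _ _ (rint (fun t => cmod (line_g P e tau t) ^+ 2 +
    4 * N ^+ 4 * (cmod (P e (t - pi)) ^+ 2 * w4 t +
      N * \sum_(j | j != i) cmod (P j (2 * pi - t)) ^+ 2 * w4 t)))).
  apply: ler_rint => //.
    by apply: rintbleD => //; apply: rintbleZ; apply: rintbleD => //; exact: rintbleZ.
  move=> t; have [/andP[h1 h2]|h] := boolP (pi < t < 2 * pi); last first.
    rewrite PZ ?cmod0 ?expr0n ?mul0r //.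
      rewrite addr_ge0 ?sqr_ge0 // !mulr_ge0 ?exprn_ge0 // addr_ge0 ?mulr_ge0 ?sqr_ge0 ?cmod_ge0 //.
      by apply: sumr_ge0 => j _; rewrite mulr_ge0 ?sqr_ge0.
    by move: h; rewrite negb_and -!leNgt => /orP[h|h]; [right|left]; lra.
  have pt : pi < t < 2 * pi by rewrite h1.
  rewrite /line_g cmodM exprMn ce_w4.
  have := ler_wpM2r (w4_ge0 t) (second_window_pointwise ie pt).
  move=> /le_trans; apply; rewrite -mulr_suml le_eqVlt; apply/orP; left; apply/eqP; ring.
rewrite rintD //; last by apply: rintbleZ; apply: rintbleD => //; exact: rintbleZ.
rewrite lerD2l rintZ; last by apply: rintbleD => //; exact: rintbleZ.
rewrite rintD //; last exact: rintbleZ.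
rewrite rintZ // rint_sum; last by move=> j _; case: (refl_energy j).
have S1 : \sum_(j | j != i) rint (fun t => cmod (P j (2 * pi - t)) ^+ 2 * w4 t) <= S.
  apply: ler_sum => j _; have [_ ->] := refl_energy j.
  apply: ler_rint.
  - by apply: rintble_w4 => [|x /andP[? ?]]; [exact: measurable_funB|lra].
  - exact: rintble_edge_energy.
  move=> x; have [/andP[x0 xp]|/P0 ->] := boolP (0 < x < pi); last by rewrite cmod0 expr0n !mul0r.
  rewrite ler_wpM2l ?sqr_ge0 //; apply: w4_le; rewrite /phi_arg eqxx; lra.
have S2 : rint (fun t => cmod (P e (t - pi)) ^+ 2 * w4 t) <= S.
  apply: (@le_trans _ _ (edge_energy P e e tau)); last first.
    rewrite /S (bigD1 e) /=; last by rewrite eq_sym.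
    rewrite lerDl; apply: sumr_ge0 => j _; exact: edge_energy_ge0.
  rewrite se; apply: ler_rint.
  - by have pi0 := pi_ge0 R; apply: rintble_w4 => [|x /andP[? ?]]; [exact: measurable_funD|lra].
  - exact: rintble_edge_energy.
  move=> x; rewrite ler_wpM2l ?sqr_ge0 //; apply: w4_le; rewrite /phi_arg eqxx.
  by have := pi_ge0 R; lra.
have S0 : 0 <= S by apply: sumr_ge0 => j _; exact: edge_energy_ge0.
rewrite -/S (_ : 8 * N ^+ 5 * S = 4 * N ^+ 4 * (2 * N * S)); last by ring.
rewrite ler_wpM2l ?mulr_ge0 ?exprn_ge0 //.
move: S1; move: (\sum_(j | j != i) _) => Z ZS.
have : N * Z <= N * S by rewrite ler_wpM2l.
by move: S2; nra.
Qed.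

End Windows.

(** * Absorption of the error *)

Section Stability.
Variables (R : realType) (n : nat) (b kap : R).
Hypotheses (n0 : (0 < n)%N) (b0 : 0 < b) (kap0 : 0 <= kap) (kap1 : kap < 1).
Hypothesis hE : expR (- (b * (2 * pi))) <= 4^-1 :> R.
Local Notation mu := (@lebesgue_measure R).
Local Notation fam := ('I_n.+1 -> R -> R[i]).

(* The window estimates bound the weighted energy [T] of the difference of the
   potentials by the data plus a multiple of [T / tau], which is absorbed by
   taking [tau] large. *)
Lemma star_stability : exists2 C, 0 < C & forall Q Q' : fam,
  (forall j, admissible b kap (Q j)) -> (forall j, admissible b kap (Q' j)) ->
  (forall j x, ~~ (0 < x < pi) -> Q j x = 0) -> (forall j x, ~~ (0 < x < pi) -> Q' j x = 0) ->
  (forall j, cint (fun x => Q j x - Q' j x) = 0) ->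
  forall m : R, (forall e, e != ord0 ->
    \int[mu]_s (cmod (star_G kap Q Q' e (s +i* b)) ^+ 2)%:E <= m%:E)%E ->
  forall j, rint (fun t => cmod (Q j t - Q' j t) ^+ 2) <= C * m.
Proof.
have [C C0 HC] := amp_estimates n0 b0 kap0 kap1.
have pi0 := pi_gt0 R.
pose c1 : R := 2 * (4 / 3) ^+ (4 * n.-1) / pi.
pose K1 : R := 4 * C ^+ 4 * n.+1%:R * pi ^+ 2.
(* From [S <= n * X] and [B0 <= X + 8 N^5 * S] the sum [S + B0] is at most [KK * X]. *)
pose KK : R := n%:R + 1 + 8 * n.+1%:R ^+ 5 * n%:R.
have c10 : 0 < c1 by rewrite divr_gt0 // mulr_gt0 // exprn_gt0.
have K10 : 0 < K1 by rewrite /K1; do !apply: mulr_gt0 => //; rewrite ?exprn_gt0.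
have KK0 : 0 < KK.
  by rewrite /KK ltr_wpDr ?mulr_ge0 ?exprn_ge0 // ltr_wpDl.
(* Makes [KK * c1 * K1 / tau] at most 1/2. The part added to [b] is the positive distance by which
   the line is raised. *)
pose tau := b + (1 + 2 * (KK * c1 * K1)).
have KcK : 0 < KK * c1 * K1 by exact: mulr_gt0 (mulr_gt0 KK0 c10) K10.
have h0 : 0 < 1 + 2 * (KK * c1 * K1) by lra.
have bt : b <= tau by rewrite lerDl ltW.
have tau0 : 0 < tau by exact: lt_le_trans b0 bt.
exists (expR (tau * (8 * pi)) * (2 * (KK * c1))) => [|Q Q' aQ aQ' Q0 Q0' Pint m Gm j].
  by rewrite (mulr_gt0 (expR_gt0 _)) // (mulr_gt0 _ (mulr_gt0 KK0 c10)).
pose P j x := Q j x - Q' j x.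
have iP2 i : rintble (fun t => cmod (P i t) ^+ 2) by exact: (rintble_diff aQ aQ').
have P0 i x : ~~ (0 < x < pi) -> P i x = 0 by move=> x0; rewrite /P Q0 // Q0' // subrr.
have e1P : exists e : 'I_n.+1, e != ord0.
  by exists ord_max; rewrite -val_eqE /= -lt0n.
have [e1 e10] := e1P.
pose S := \sum_(i | i != ord0) edge_energy P i i tau.
(* The weight on edge [ord0] is the same seen from every other edge, so the choice of [e1] is
   immaterial. *)
pose B0 := edge_energy P e1 ord0 tau.
have en0 e i : 0 <= edge_energy P e i tau by exact: edge_energy_ge0.
have S0 : 0 <= S by exact: sumr_ge0.
have W e : e != ord0 -> \sum_i edge_energy P e i tau <= S + B0.
  move=> e0; rewrite (bigD1 ord0) //= addrC; apply: lerD.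
    by apply: ler_sum => i _; exact: (edge_energy_le iP2 P0 (ltW tau0)).
  rewrite le_eqVlt; apply/orP; left; apply/eqP; apply: eq_rint => t.
  by rewrite /weight /phi_arg ![ord0 == _]eq_sym (negbTE e0) (negbTE e10).
pose X := c1 * (m + K1 / tau * (S + B0)).
have L e : e != ord0 -> rintble (fun t => cmod (line_g P e tau t) ^+ 2) /\
    rint (fun t => cmod (line_g P e tau t) ^+ 2) <= X.
  move=> e0.
  have Gt : (\int[mu]_s (cmod (star_G kap Q Q' e (s +i* tau)) ^+ 2)%:E <= m%:E)%E.
    apply: le_trans (Gm e e0); apply: height_shift => //; first exact: ltW.
    by move=> s0; exact: poisson_algebra_star_G.
  have [rg gb] := line_g_energy n0 b0 kap0 kap1 hE aQ aQ' Q0 Q0' Pint bt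
    (fun i Q1 rho x => HC e i Q1 rho x) Gt.
  split => //; rewrite -(ler_pM2l pi0); apply: (le_trans gb).
  rewrite (_ : pi * X = 2 * (4 / 3) ^+ (4 * n.-1) * (m + K1 / tau * (S + B0))); last first.
    by rewrite /X /c1; move: pi pi0 => p p0; field; rewrite gt_eqF //= gt_eqF.
  rewrite ler_wpM2l ?mulr_ge0 ?exprn_ge0 ?divr_ge0 // lerD2l ler_wpM2l ?W //.
  by rewrite divr_ge0 // ltW.
have SX : S <= n%:R * X.
  apply: (@le_trans _ _ (\sum_(i < n.+1 | i != ord0) X)).
    apply: ler_sum => i i0; have [rg gb] := L i i0.
    exact: le_trans (first_window iP2 P0 (ltW tau0) rg) gb.
  by rewrite sumr_const card_neq1 mulr_natl.
have BX : B0 <= X + 8 * n.+1%:R ^+ 5 * S.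
  have [rg gb] := L e1 e10; have ie : ord0 != e1 by rewrite eq_sym.
  by apply: (le_trans (second_window iP2 P0 (ltW tau0) ie rg)); rewrite lerD2r.
have TX : S + B0 <= KK * X.
  have : 8 * n.+1%:R ^+ 5 * S <= 8 * n.+1%:R ^+ 5 * (n%:R * X).
    by rewrite ler_wpM2l // mulr_ge0 // exprn_ge0.
  by rewrite /KK; move: (n.+1%:R ^+ 5) SX BX => M; lra.
have half : KK * c1 * K1 / tau <= 2^-1.
  have t1 : 2 * (KK * c1 * K1) <= tau by rewrite /tau; have := b0; lra.
  by rewrite ler_pdivrMr //; lra.
have T0 : 0 <= S + B0 by rewrite addr_ge0 // en0.
(* [X] itself contains [S + B0] with factor [c1 * K1 / tau]; by the choice of [tau] that share is at
   most half and moves to the left. *)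
have TM : S + B0 <= 2 * (KK * c1) * m.
  have : KK * X = KK * c1 * m + KK * c1 * K1 / tau * (S + B0) by rewrite /X; ring.
  have := ler_wpM2r T0 half; move: TX; set U := _ / tau * _; lra.
apply: (le_trans (energy_lower iP2 P0 (ltW tau0) e1 j)).
rewrite -mulrA ler_wpM2l ?expR_ge0 //; apply: le_trans TM.
have [->|j0] := eqVneq j ord0; first by rewrite lerDr.
apply: (le_trans (edge_energy_le iP2 P0 (ltW tau0) e1 j)).
rewrite /S (bigD1 j) //= -addrA lerDl addr_ge0 ?sumr_ge0 //.
exact: en0.
Qed.

End Stability.

(** * Potentials and the height of the line *)

Section L2Cutoff.
Variable R : realType.
Local Notation mu := (@lebesgue_measure R).
Implicit Types (f : R -> R[i]) (r : R).

Definition cut f x : R[i] := if 0 < x < pi then f x else 0.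

Lemma sqrt_ereal_le (I : \bar R) (c : R) : 0 <= c -> (0 <= I)%E ->
  (I `^ 2^-1 <= c%:E)%E -> (I <= (c ^+ 2)%:E)%E.
Proof.
case: I => [x| |] c0 //; rewrite ?lee_fin => x0.
  rewrite powR12_sqrt // => h; rewrite -(sqr_sqrtr x0).
  by rewrite lerXn2r ?nnegrE ?sqrtr_ge0.
by rewrite poweRyr ?invr_eq0 ?pnatr_eq0.
Qed.

Let itvE (x : R) : (x \in `]0, pi[%classic) = (0 < x < pi).
Proof. by rewrite mem_setE in_itv. Qed.

Let patch_cut (p : R[i] -> R) f : p 0 = 0 ->
  ((fun x => p (f x)) \_ `]0, pi[)%classic = (fun x => p (cut f x)).
Proof. by move=> p0; apply/funext => x; rewrite patchE itvE /cut; case: ifP => _; rewrite ?p0. Qed.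

Lemma cmeas_cut f : Cmeasurable_fun `]0, pi[ f -> cmeas (cut f).
Proof.
have mI : measurable (`]0, pi[%classic : set R) by exact: measurable_itv.
move=> [fr fi]; split.
- by have /(measurable_restrictT _ mI) := fr; rewrite (patch_cut (p := fun z => complex.Re z)).
- by have /(measurable_restrictT _ mI) := fi; rewrite (patch_cut (p := fun z => complex.Im z)).
Qed.

Lemma integral_cut f : (\int[mu]_(x in `]0%R, pi[) ((cmod (f x)) ^+ 2)%:E =
  \int[mu]_x ((cmod (cut f x)) ^+ 2)%:E)%E.
Proof.
rewrite integral_mkcond; apply: eq_integral => x _; rewrite patchE itvE /cut.
by case: ifP => _ //; rewrite cmod0 expr0n.
Qed.

Lemma cint_cut f : cint (cut f) = Cintegral `]0, pi[ f.
Proof.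
rewrite cint.unlock /Cintegral; apply: complex_eqP; rewrite /=.
- by rewrite [RHS]Rintegral_mkcond (patch_cut (p := fun z => complex.Re z)).
- by rewrite [RHS]Rintegral_mkcond (patch_cut (p := fun z => complex.Im z)).
Qed.

(** Cauchy-Schwarz on [(0, pi)] turns the bound on the L2 norm into the bound [sqrt pi * r] on the
    L1 norm, the quantity that governs the Volterra iteration. *)
Lemma L2_cut f r : 0 <= r -> Cmeasurable_fun `]0, pi[ f -> (L2norm `]0%R, pi[ f <= r%:E)%E ->
  [/\ cintble (cut f), rintble (fun x => cmod (cut f x) ^+ 2) &
      rint (fun x => cmod (cut f x)) <= Num.sqrt pi * r].
Proof.
move=> r0 mf; rewrite /L2norm integral_cut => /(sqrt_ereal_le r0) H.
have {}H : (\int[mu]_x ((cmod (cut f x)) ^+ 2)%:E <= (r ^+ 2)%:E)%E.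
  by apply: H; apply: integral_ge0 => x _; rewrite lee_fin sqr_ge0.
have mc := cmeas_cut mf.
have m2 : measurable_fun setT (fun x => cmod (cut f x) ^+ 2).
  by apply: measurable_funX; exact: measurable_cmod.
have r2 : rintble (fun x => cmod (cut f x) ^+ 2).
  apply/integrableP; split; first exact/measurable_EFinP.
  under eq_integral do rewrite /= ger0_norm ?sqr_ge0 //.
  by apply: (le_lt_trans H); rewrite ltry.
have ic : cintble (cut f).
  (* Inside the interval [|z| <= 1 + |z|^2], and the interval has finite length. *)
  apply: (@cintble_le _ _ (fun x => (if 0 < x < pi then 1 else 0) + cmod (cut f x) ^+ 2)) => //.
    move=> x; rewrite /cut; case: ifP => _; last by rewrite cmod0 expr0n addr0.
    by have := sqr_ge0 (cmod (f x) - 1); have := cmod_ge0 (f x); nra.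
  by apply: rintbleD => //; exact: rintble_itv.
split => //; move: H; rewrite rintE // lee_fin => H.
have pi0 := pi_ge0 R.
rewrite -(@ler_pXn2r _ 2) ?nnegrE //; last 2 first.
- by apply: rint_ge0 => x; exact: cmod_ge0.
- by rewrite mulr_ge0 // sqrtr_ge0.
rewrite exprMn sqr_sqrtr //; apply: le_trans (ler_wpM2l pi0 H).
apply: sqr_rint_le => //; last exact: rintble_cmod.
by move=> x /negbTE x0; rewrite /cut x0 cmod0.
Qed.

End L2Cutoff.

Section PotentialBounds.
Variables (R : realType) (n : nat).
Implicit Types (q : 'I_n.+1 -> R -> R[i]).

Lemma edge_potentialE q j :
  edge_potential q j = if j == ord0 then refl (cut (q j)) else cut (q j).
Proof.
apply/funext => x; rewrite /edge_potential /refl /cut; case: (j == ord0) => //.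
rewrite (_ : (0 < pi - x < pi) = (0 < x < pi)) // subr_gt0 andbC; congr (_ && _).
by rewrite gtrBl.
Qed.

Lemma potential_norm_edge q j (r : R) : (potential_norm q < r%:E)%E ->
  (L2norm `]0%R, pi[ (q j) <= r%:E)%E.
Proof.
move=> /ltW; apply: le_trans; rewrite /potential_norm.
exact: (le_bigmax _ (fun j => L2norm `]0%R, pi[ (q j))).
Qed.

Lemma admissible_edge_potential q (r b kap : R) : 0 <= r -> potential q ->
  (potential_norm q < r%:E)%E -> Num.sqrt pi * r <= kap * b ->
  forall j, admissible b kap (edge_potential q j).
Proof.
move=> r0 pq qr rk j; have [mq _] := pq j.
have [h1 h2 h3] := L2_cut r0 mq (potential_norm_edge j qr).
have ac : admissible b kap (cut (q j)) by split => //; exact: le_trans rk.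
by rewrite edge_potentialE; case: ifP => _ //; exact: admissible_refl.
Qed.

(** Reversing the edge does not change the integral, so equality of the [omega] says that the
    differences of the edge potentials have mean 0. *)
Lemma cint_edge_potential q j : cintble (cut (q j)) ->
  cint (edge_potential q j) = 2 * omega q j.
Proof.
move=> ic; have -> : 2 * omega q j = cint (cut (q j)).
  rewrite /omega cint_cut mulrA (_ : 2 * (2^-1)%:C = 1) ?mul1r //.
  by apply: complex_eqP; rewrite /= ?mul0r ?mulr0 ?addr0 ?subr0; field.
rewrite edge_potentialE; case: ifP => _ //; exact: cint_reflect.
Qed.

End PotentialBounds.

Section LineHeight.
Variable R : realType.

(** Used to pass from the base 5/4, natural for the factors [1 +- E], to the base [2 = 8 / 4] that
    the formula for the height is built on. *)
Lemma subrX_mono (x y d : R) m : 0 <= x -> x <= y -> 0 <= d ->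
  (x + d) ^+ m - x ^+ m <= (y + d) ^+ m - y ^+ m.
Proof.
move=> x0 xy d0; elim: m => [|m IH]; first by rewrite !subrr.
have E (z : R) : (z + d) ^+ m.+1 - z ^+ m.+1 = (z + d) * ((z + d) ^+ m - z ^+ m) + d * z ^+ m.
  by rewrite !exprS; ring.
have y0 := le_trans x0 xy.
rewrite !E lerD //.
  apply: ler_pM => //; [exact: addr_ge0| |by rewrite lerD2r].
  by rewrite subr_ge0 lerXn2r ?nnegrE ?addr_ge0 // lerDl.
by rewrite ler_wpM2l // lerXn2r ?nnegrE.
Qed.

Lemma line_height_spec n (r : R) : 0 < r -> exists kap : R,
  let b := line_height n.+1 r in
  [/\ 0 < b, 0 <= kap < 1, expR (- (b * (2 * pi))) <= 4^-1, Num.sqrt pi * r <= kap * b &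
      (5 / 4 + 2 * kap / (1 - kap)) ^+ n.+1 - (5 / 4) ^+ n.+1 < (3 / 4) ^+ n.+1].
Proof.
(* [d] is the denominator in the formula for the height: with [N = n.+1] it is defined by
   [(8 + d)^N = 8^N + 3^(N-1)]. *)
move=> r0; pose x : R := 8 ^+ n.+1 + 3 ^+ n; pose d := x `^ n.+1%:R^-1 - 8.
have pi0 := pi_gt0 R.
have x0 : 0 < x by rewrite addr_gt0 // exprn_gt0.
have dE : (8 + d) ^+ n.+1 = x.
  rewrite /d addrC subrK -powR_mulrn ?powR_ge0 // -powRrM mulVf ?powRr1 ?ltW //.
have d80 : 0 <= 8 + d by rewrite /d addrC subrK powR_ge0.
have d0 : 0 < d.
  have : (8 : R) ^+ n.+1 < (8 + d) ^+ n.+1 by rewrite dE ltrDl exprn_gt0.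
  by rewrite ltr_pXn2r ?nnegrE // ltrDl.
have d1 : d <= 1.
  have : (8 + d) ^+ n.+1 <= 9 ^+ n.+1.
    have h8 : (8 : R) ^+ n <= 9 ^+ n by rewrite lerXn2r ?nnegrE //; lra.
    have h3 : (3 : R) ^+ n <= 9 ^+ n by rewrite lerXn2r ?nnegrE //; lra.
    by rewrite dE /x !exprS; move: (8 ^+ n) (9 ^+ n) (3 ^+ n) h8 h3 => u v w; lra.
  by rewrite ler_pXn2r ?nnegrE //; lra.
pose b := line_height n.+1 r.
have b1 : ln 4 / (2 * pi) <= b by rewrite /b /line_height le_max lexx.
have ln40 : 0 < ln 4 :> R by rewrite ln_gt0 // ltr1n.
have b0 : 0 < b by apply: lt_le_trans b1; rewrite divr_gt0 // mulr_gt0.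
have s0 : 0 < Num.sqrt pi :> R by rewrite sqrtr_gt0.
have b2 : 4 * r * (Num.sqrt pi + Num.sqrt (2 * pi)) <= d * b.
  rewrite mulrC -[leRHS]mulrC -ler_pdivrMr //.
  apply: le_trans (_ : _ <= 4 * r * (Num.sqrt pi + Num.sqrt (2 * pi)
      + 24 * pi ^+ 2 * r * expR (2 * pi `^ (3 / 2) * r)) / d) _; last first.
    by rewrite /b /line_height le_max lexx orbT.
  rewrite ler_wpM2r ?invr_ge0 ?(ltW d0) // mulrC ler_wpM2l ?mulr_ge0 ?(ltW r0) // lerDl.
  by rewrite !mulr_ge0 ?expR_ge0 ?exprn_ge0 ?(ltW r0) ?(ltW pi0).
(* As [7/5 < sqrt 2], the bound [b2] gives [4 * (1 + 7/5) * r * sqrt pi <= d * b], that is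
   [r * sqrt pi <= 5 * d / 48 * b]. This is the origin of the contraction factor below. *)
have s2 : 7 / 5 * Num.sqrt pi <= Num.sqrt (2 * pi) :> R.
  rewrite -(@ler_pXn2r _ 2) ?nnegrE ?mulr_ge0 ?divr_ge0 ?sqrtr_ge0 //.
  by rewrite exprMn !sqr_sqrtr ?mulr_ge0 ?(ltW pi0) //; move: pi pi0 => p p0; lra.
(* With this contraction factor every factor of the characteristic function is
   within [d / 4] of its leading value [1 +- exp (2 i rho pi)]. *)
exists (5 * d / 48) => /=; split => //.
- by apply/andP; split; lra.
- have : expR (- (b * (2 * pi))) <= expR (- ln 4).
    by rewrite ler_expR lerN2 -ler_pdivrMr // mulr_gt0.
  by rewrite [X in _ <= X]expRN lnK // posrE.
- move: b2; rewrite -/b; nra.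
- set kap := 5 * d / 48; have k1 : 0 < 1 - kap by rewrite /kap; lra.
  have e4 : 2 * kap / (1 - kap) <= d / 4.
    by rewrite ler_pdivrMr // /kap; nra.
  have e0 : 0 <= 2 * kap / (1 - kap) by rewrite divr_ge0 ?(ltW k1) // /kap; lra.
  have h5 : 0 <= 5 / 4 :> R by lra.
  have M : (5 / 4 + 2 * kap / (1 - kap)) ^+ n.+1 <= (5 / 4 + d / 4) ^+ n.+1.
    by rewrite lerXn2r ?nnegrE ?addr_ge0 ?lerD2l //; lra.
  (* With base 2 the error of the product is exactly [((8 + d)^N - 8^N) / 4^N = 3^(N-1) / 4^N],
     which is less than [(3/4)^N]. *)
  have := @subrX_mono (5 / 4) 2 (d / 4) n.+1 h5 _ _.
  have -> : 2 + d / 4 = (8 + d) / 4 by field.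
  have -> : ((8 + d) / 4) ^+ n.+1 = x * 4^-1 ^+ n.+1 by rewrite exprMn dE.
  move=> H.
  have {}H : (5 / 4 + d / 4) ^+ n.+1 - (5 / 4) ^+ n.+1 <= x * 4^-1 ^+ n.+1 - 2 ^+ n.+1 by apply: H; lra.
  have E : x * 4^-1 ^+ n.+1 - 2 ^+ n.+1 = 3 ^+ n * 4^-1 ^+ n.+1.
    rewrite /x mulrDl -exprMn (_ : 8 / 4 = 2 :> R); last by field.
    by ring.
  have L : 3 ^+ n * 4^-1 ^+ n.+1 < (3 / 4) ^+ n.+1 :> R.
    by rewrite exprMn ltr_pM2r ?exprn_gt0 ?invr_gt0 // exprS ltr_pMl ?exprn_gt0 // ltr1n.
  by move: H M; rewrite E; move: L; lra.
Qed.

End LineHeight.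

Theorem theorem1 (R : realType) (n : nat) (hN : (2 <= n.+1)%N)
    (r : R) (hr : 0 < r) :
  exists2 A : R, 0 < A &
    forall q q' : 'I_n.+1 -> R -> R[i],
      potential q -> potential q' ->
      (forall j, omega q j = omega q' j) ->
      (potential_norm q < r%:E)%E ->
      (potential_norm q' < r%:E)%E ->
      (potential_norm (fun j x => (q j x - q' j x)%R)
         <= A%:E * weyl_dist q q' (line_height n.+1 r))%E.
Proof.
have n0 : (0 < n)%N by [].
have [kap /=] := line_height_spec n hr; set b := line_height _ _.
move=> [b0 /andP[kap0 kap1] hE rk heps].
have [C C0 HC] := star_stability n0 b0 kap0 kap1 hE.
have [D D0 HD] := cmod_star_G_le n0 b0 kap0 kap1 hE heps.
(* [D] compares [star_G] with the difference of Weyl functions, and [C] bounds squared norms of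
   potentials by squared norms of [star_G], hence the square root. *)
exists (Num.sqrt C * D) => [|q q' pq pq' om nq nq']; first by rewrite mulr_gt0 ?sqrtr_gt0.
have aq := admissible_edge_potential (ltW hr) pq nq rk.
have aq' := admissible_edge_potential (ltW hr) pq' nq' rk.
have A0 : 0 < Num.sqrt C * D by rewrite mulr_gt0 ?sqrtr_gt0.
have w0 : (0 <= weyl_dist q q' b)%E by rewrite /weyl_dist; exact: bigmax_ge_id.
(* If the Weyl functions are at infinite distance, the right side is infinite because the constant
   is positive. *)
case E : (weyl_dist q q' b) w0 => [w| |] // w0; last first.
  by rewrite gt0_muley ?lte_fin // leey.
rewrite lee_fin in w0.
have Z0 (Q1 : 'I_n.+1 -> R -> R[i]) j x : ~~ (0 < x < pi) -> edge_potential Q1 j x = 0.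
  by rewrite /edge_potential => /negbTE ->.
have icut (q1 : 'I_n.+1 -> R -> R[i]) j : potential q1 -> (potential_norm q1 < r%:E)%E ->
    cintble (cut (q1 j)).
  move=> p1 h1; have [m1 _] := p1 j.
  by have [] := L2_cut (ltW hr) m1 (potential_norm_edge j h1).
have Pint j : cint (fun x => edge_potential q j x - edge_potential q' j x) = 0.
  have [h _ _] := aq j; have [h' _ _] := aq' j.
  by rewrite cintB // !cint_edge_potential ?om ?subrr //; exact: icut.
have Gm e : e != ord0 -> (\int[@lebesgue_measure R]_s
    (cmod (star_G kap (edge_potential q) (edge_potential q') e (s +i* b)) ^+ 2)%:E
    <= ((D * w) ^+ 2)%:E)%E.
  move=> e0; have mW := measurable_weyl_diff n0 b0 kap0 kap1 hE heps aq aq' e0.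
  have [[mG _] _] := poisson_algebra_star_G n0 b0 kap0 kap1 e aq aq' 0 ltr01.
  have Ww : (\int[@lebesgue_measure R]_s (cmod (weyl_function q e ((s +i* b) ^+ 2)
      - weyl_function q' e ((s +i* b) ^+ 2)) ^+ 2)%:E <= (w ^+ 2)%:E)%E.
    apply: sqrt_ereal_le => //.
      by apply: integral_ge0 => s _; rewrite lee_fin sqr_ge0.
    rewrite -E /weyl_dist.
    exact: (le_bigmax_cond _ (fun k => L2norm setT (fun s : R =>
      weyl_function q k ((s +i* b) ^+ 2) - weyl_function q' k ((s +i* b) ^+ 2))) e0).
  apply: (@le_trans _ _ (\int[@lebesgue_measure R]_s ((D ^+ 2)%:E * (cmod (weyl_function q e ((s +i* b) ^+ 2)
      - weyl_function q' e ((s +i* b) ^+ 2)) ^+ 2)%:E))%E).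
    apply: ge0_le_integral => //.
    - by move=> s _; rewrite lee_fin sqr_ge0.
    - by apply/measurable_EFinP; apply: measurable_funX; exact: measurable_cmod.
    - by apply: emeasurable_funM => //; apply/measurable_EFinP.
    - move=> s _; rewrite -EFinM lee_fin -exprMn lerXn2r ?nnegrE ?cmod_ge0 //.
        by rewrite mulr_ge0 ?cmod_ge0 // ltW.
      exact: HD.
  rewrite ge0_integralZl_EFin ?sqr_ge0 //; last first.
  - exact/measurable_EFinP.
  - by move=> s _; rewrite lee_fin sqr_ge0.
  rewrite (_ : (D * w) ^+ 2 = D ^+ 2 * w ^+ 2); last by rewrite exprMn.
  by rewrite [leRHS]EFinM; apply: lee_wpmul2l => //; rewrite lee_fin sqr_ge0.
have H := HC _ _ aq aq' (Z0 q) (Z0 q') Pint _ Gm.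
have Dw0 : 0 <= D * w by rewrite mulr_ge0 // ltW.
rewrite /potential_norm -EFinM; apply: bigmax_le.
  by rewrite lee_fin mulr_ge0 // ltW.
move=> j _; rewrite /L2norm integral_cut.
have rc : rintble (fun x => cmod (cut (fun t => q j t - q' j t) x) ^+ 2) /\
    rint (fun x => cmod (cut (fun t => q j t - q' j t) x) ^+ 2) <= C * (D * w) ^+ 2.
  have ir := rintble_diff aq aq' j; have := H j.
  (* On the reversed edge the stability estimate concerns the reflected difference; the reflection
     about [pi / 2] preserves the norm. *)
  have [j0|j0] := boolP (j == ord0); last first.
    have -> : (fun x => cmod (cut (fun t => q j t - q' j t) x) ^+ 2) =
        (fun t => cmod (edge_potential q j t - edge_potential q' j t) ^+ 2).
      apply/funext => x; rewrite /edge_potential (negbTE j0) /cut.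
      by case: ifP => _; rewrite ?subrr.
    by split.
  have n1 : (-1 : R) != 0 by rewrite oppr_eq0 oner_eq0.
  have -> : (fun x => cmod (cut (fun t => q j t - q' j t) x) ^+ 2) =
      (fun t => (fun x => cmod (edge_potential q j x - edge_potential q' j x) ^+ 2) (-1 * t + pi)).
    apply/funext => x; rewrite !edge_potentialE j0 /refl /= mulN1r [- x + _]addrC subKr /cut.
    by case: ifP => _; rewrite ?subrr.
  move=> Hj; split; first exact: (rintble_affine pi n1 ir).
  by move: Hj; rewrite (rint_affine pi n1 ir) normrN1 mul1r.
have [ri rle] := rc.
rewrite rintE // poweR_EFin lee_fin powR12_sqrt; last by apply: rint_ge0 => x; exact: sqr_ge0.
apply: (le_trans (ler_wsqrtr rle)).
by rewrite sqrtrM ?(ltW C0) // sqrtr_sqr ger0_norm // mulrA.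
Qed.
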